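(* Let $e\ge2$, $n\ge1$, let $\mathbb{K}$ be an algebraically closed field of characteristic $p\neq2$ with $p\nmid e$, let $I=\{0,1,\ldots,e\}$ be the vertex set of the quiver of type $C^{(1)}_e$, and let $\Lambda=\sum_{s=1}^m\Lambda_{i_s}$ with $m\ge1$ and $i_1,\ldots,i_m\in I$. Then the cyclotomic quiver Hecke algebra $R^\Lambda_n(I)$ over $\mathbb{K}$ is semisimple if and only if both of the following hold: (1) for any $1\le s\le m$, $\frac{n-1}{2}\le i_s\le e-\frac{n-1}{2}$; (2) for any $1\le s_1\neq s_2\le m$, $n\le|i_{s_1}-i_{s_2}|$.
   Context: The characteristic $p$ may be $0$ (then $p\nmid e$ holds). The quiver $C^{(1)}_e$ has vertices $0,1,\ldots,e$, double edges $0\Rightarrow1$ and $e\Rightarrow e-1$, and single edges between $i$ and $i+1$ for $1\le i\le e-2$, each oriented arbitrarily. Put $Q_{i,j}(u,v)=u-v$ if $i\to j$; $v-u$ if $i\leftarrow j$; $u-v^2$ if $i\Rightarrow j$; $v-u^2$ if $i\Leftarrow j$; $0$ if $i=j$; $1$ otherwise. All vertices are taken to be even, so that the quiver Hecke superalgebra is the ordinary quiver Hecke algebra. $R_n=R_n(I)$ is the $\mathbb{K}$-algebra generated by $e(\mathbf{i})$ ($\mathbf{i}=(\mathbf i_1,\ldots,\mathbf i_n)\in I^n$), $x_1,\ldots,x_n$, $\tau_1,\ldots,\tau_{n-1}$ with relations: $e(\mathbf{j})e(\mathbf{i})=\delta_{\mathbf{i},\mathbf{j}}e(\mathbf{i})$,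 $\sum_{\mathbf{i}}e(\mathbf{i})=1$; $x_px_q=x_qx_p$; $x_pe(\mathbf{i})=e(\mathbf{i})x_p$; $\tau_ae(\mathbf{i})=e(s_a\mathbf{i})\tau_a$, $s_a=(a,a+1)$; $\tau_ax_p=x_p\tau_a$ ($p\ne a,a+1$); $(\tau_ax_{a+1}-x_a\tau_a)e(\mathbf{i})=(x_{a+1}\tau_a-\tau_ax_a)e(\mathbf{i})=\delta_{\mathbf{i}_a,\mathbf{i}_{a+1}}e(\mathbf{i})$; $\tau_a^2e(\mathbf{i})=Q_{\mathbf{i}_a,\mathbf{i}_{a+1}}(x_a,x_{a+1})e(\mathbf{i})$; $\tau_a\tau_b=\tau_b\tau_a$ ($|a-b|>1$); $(\tau_{a+1}\tau_a\tau_{a+1}-\tau_a\tau_{a+1}\tau_a)e(\mathbf{i})=\frac{Q_{\mathbf{i}_a,\mathbf{i}_{a+1}}(x_{a+2},x_{a+1})-Q_{\mathbf{i}_a,\mathbf{i}_{a+1}}(x_a,x_{a+1})}{x_{a+2}-x_a}e(\mathbf{i})$ if $\mathbf{i}_a=\mathbf{i}_{a+2}$, and $0$ otherwise. $\Lambda_i$ are the fundamental weights, $\langle h_j,\Lambda_i\rangle=\delta_{ij}$, so $\langle h_i,\Lambda\rangle=\sharp\{s:i_s=i\}$. $R^\Lambda_n(I)$ is the quotient of $R_n$ by the two-sided ideal generated by $\sum_{\mathbf{i}\in I^n}x_1^{\langle h_{\mathbf{i}_1},\Lambda\rangle}e(\mathbf{i})$. *)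

(* Defs.v *)
From HB Require Import structures.
From mathcomp Require Import all_boot all_order perm all_algebra.
From mathcomp Require Import boolp classical_sets.
From mathcomp.multinomials Require Import monalg.

Set Implicit Arguments.
Unset Strict Implicit.
Unset Printing Implicit Defensive.

Import GRing.Theory.

Local Open Scope ring_scope.
Local Open Scope quotient_scope.
Local Open Scope classical_set_scope.

(* Algebras are handled as rings: a quotient by an arbitrary ideal is a
   pzRingType but possibly the zero ring, which algType excludes.  In a unital
   K-algebra every ring ideal is a K-subspace, so that (semi)simplicity and
   generated ideals do not depend on K, and K acts on the quotients below
   through the ring morphism c |-> \pi c%:A. *)

Section Ideals.

Variable A : pzRingType.
Implicit Types L J : set A.

Definition left_ideal L :=
  [/\ L 0, forall x y, L x -> L y -> L (x + y)
    & forall a x, L x -> L (a * x)].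

Definition two_sided_ideal J :=
  left_ideal J /\ forall x a, J x -> J (x * a).

Definition simple_left_ideal L :=
  [/\ left_ideal L, L <> [set 0]
    & forall L', left_ideal L' -> L' `<=` L -> L' = [set 0] \/ L' = L].

(* The regular left module is a direct sum of simple submodules.  Finitely
   many summands suffice: those involved in the decomposition of 1. *)
Definition semisimple_ring :=
  exists r (L : 'I_r -> set A), (forall k, simple_left_ideal (L k)) /\
    forall a, exists! c : {ffun 'I_r -> A},
      (forall k, L k (c k)) /\ a = \sum_k c k.

Definition generated_ideal (S : set A) : set A := smallest two_sided_ideal S.

Lemma generated_idealP S : two_sided_ideal (generated_ideal S).
Proof.
split; first split.
- by move=> J [[[]]].
- move=> x y xS yS J JS; have [[[_ JD _] _] _] := JS.
  by apply: JD; [apply: xS|apply: yS].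
- move=> a x xS J JS; have [[[_ _ JM] _] _] := JS.
  by apply: JM; apply: xS.
- by move=> x a xS J JS; have [[_ JM] _] := JS; apply: JM; apply: xS.
Qed.

End Ideals.

Section Quotient.

Variables (A : pzRingType) (S : set A).

Let J := generated_ideal S.

Let J0 : J 0. Proof. by have [[]] := generated_idealP S. Qed.
Let JD x y : J x -> J y -> J (x + y).
Proof. by have [[_ + _] _] := generated_idealP S; apply. Qed.
Let JMl a x : J x -> J (a * x).
Proof. by have [[_ _ +] _] := generated_idealP S; apply. Qed.
Let JMr a x : J x -> J (x * a).
Proof. by have [_ +] := generated_idealP S; apply. Qed.
Let JN x : J x -> J (- x).
Proof. by rewrite -mulN1r; apply: JMl. Qed.

Definition quot_equiv (x y : A) : bool := `[< generated_ideal S (x - y) >].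

Fact quot_equiv_is_equiv : equiv_class_of quot_equiv.
Proof.
split=> [x|x y|y x z]; first by apply/asboolP; rewrite subrr.
  by apply/asboolP/asboolP=> /JN; rewrite opprB.
move=> /asboolP xy /asboolP yz; apply/asboolP.
by have := JD xy yz; rewrite addrA subrK.
Qed.

Canonical quot_equiv_equiv := EquivRelPack quot_equiv_is_equiv.
Canonical quot_equiv_encModRel := defaultEncModRel quot_equiv.

Definition quot_ring := {eq_quot quot_equiv}.

HB.instance Definition _ : EqQuotient A quot_equiv quot_ring :=
  EqQuotient.on quot_ring.
HB.instance Definition _ := Choice.on quot_ring.

Lemma quot_ringP (x y : A) :
  reflect (generated_ideal S (x - y)) (x == y %[mod quot_ring]).
Proof. by rewrite piE; apply: asboolP. Qed.

Let reprJ (x : A) : J (x - repr (\pi_quot_ring x)).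
Proof. by apply/quot_ringP; rewrite reprK. Qed.

Definition quot_zero : quot_ring := \pi_quot_ring 0.
Definition quot_one : quot_ring := \pi_quot_ring 1.
Definition quot_opp (x : quot_ring) : quot_ring := \pi_quot_ring (- repr x).
Definition quot_add (x y : quot_ring) : quot_ring := \pi_quot_ring (repr x + repr y).
Definition quot_mul (x y : quot_ring) : quot_ring := \pi_quot_ring (repr x * repr y).

Let piN (x : A) : quot_opp (\pi_quot_ring x) = \pi_quot_ring (- x).
Proof. by apply/eqP/quot_ringP; have := reprJ x; rewrite opprK addrC. Qed.

Let piD (x y : A) : quot_add (\pi_quot_ring x) (\pi_quot_ring y) = \pi_quot_ring (x + y).
Proof.
apply/esym/eqP/quot_ringP; have := JD (reprJ x) (reprJ y).
by rewrite opprD addrACA.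
Qed.

Let piM (x y : A) : quot_mul (\pi_quot_ring x) (\pi_quot_ring y) = \pi_quot_ring (x * y).
Proof.
apply/esym/eqP/quot_ringP.
have := JD (JMr y (reprJ x)) (JMl (repr (\pi_quot_ring x)) (reprJ y)).
by rewrite mulrBl mulrBr addrA subrK.
Qed.

Let quotI (P : quot_ring -> Prop) :
  (forall x, P (\pi_quot_ring x)) -> forall x, P x.
Proof. by move=> Ppi x; rewrite -[x]reprK; apply: Ppi. Qed.

Fact quot_addA : associative quot_add.
Proof.
by move=> x y z; elim/quotI: x => x; elim/quotI: y => y; elim/quotI: z => z; rewrite !piD addrA.
Qed.
Fact quot_addC : commutative quot_add.
Proof. by move=> x y; elim/quotI: x => x; elim/quotI: y => y; rewrite !piD addrC. Qed.
Fact quot_add0 : left_id quot_zero quot_add.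
Proof. by elim/quotI=> x; rewrite piD add0r. Qed.
Fact quot_addN : left_inverse quot_zero quot_opp quot_add.
Proof. by elim/quotI=> x; rewrite piN piD addNr. Qed.

HB.instance Definition _ :=
  GRing.isZmodule.Build quot_ring quot_addA quot_addC quot_add0 quot_addN.

Fact quot_mulA : associative quot_mul.
Proof.
by move=> x y z; elim/quotI: x => x; elim/quotI: y => y; elim/quotI: z => z; rewrite !piM mulrA.
Qed.
Fact quot_mul1l : left_id quot_one quot_mul.
Proof. by elim/quotI=> x; rewrite piM mul1r. Qed.
Fact quot_mul1r : right_id quot_one quot_mul.
Proof. by elim/quotI=> x; rewrite piM mulr1. Qed.
Fact quot_mulDl : left_distributive quot_mul quot_add.
Proof.
by move=> x y z; elim/quotI: x => x; elim/quotI: y => y; elim/quotI: z => z; rewrite !(piM, piD) mulrDl.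
Qed.
Fact quot_mulDr : right_distributive quot_mul quot_add.
Proof.
by move=> x y z; elim/quotI: x => x; elim/quotI: y => y; elim/quotI: z => z; rewrite !(piM, piD) mulrDr.
Qed.

HB.instance Definition _ := GRing.Zmodule_isPzRing.Build quot_ring
  quot_mulA quot_mul1l quot_mul1r quot_mulDl quot_mulDr.

Definition quot_pi (x : A) : quot_ring := \pi_quot_ring x.

Fact quot_pi_is_zmod_morphism : zmod_morphism quot_pi.
Proof. by move=> x y; rewrite /quot_pi -piD -piN. Qed.
Fact quot_pi_is_monoid_morphism : monoid_morphism quot_pi.
Proof. by split=> // x y; rewrite /quot_pi -piM. Qed.

HB.instance Definition _ :=
  GRing.isZmodMorphism.Build A quot_ring quot_pi quot_pi_is_zmod_morphism.
HB.instance Definition _ :=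
  GRing.isMonoidMorphism.Build A quot_ring quot_pi quot_pi_is_monoid_morphism.

End Quotient.

Section BivariatePolynomials.

Variable K : fieldType.

(* Q(u, v) : {poly {poly K}} has outer variable u = 'X and inner variable
   v = 'Y = 'X%:P.  In (Q(w, v) - Q(u, v)) / (w - u) the new variable w is
   outermost: w = 'X, u = 'X%:P, Q(w, v) = Q^:P and Q(u, v) = Q%:P. *)
Definition div_diff (Q : {poly {poly K}}) : {poly {poly {poly K}}} :=
  (Q^:P - Q%:P) %/ ('X - 'X%:P).

Lemma div_diffK Q : div_diff Q * ('X - 'X%:P) = Q^:P - Q%:P.
Proof.
apply/esym/eqP; rewrite -Pdiv.IdomainMonic.dvdp_eq ?monicXsubC //.
rewrite dvdp_XsubCl /root hornerD hornerN hornerC.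
by rewrite -/(comp_poly _ _) comp_polyXr subrr.
Qed.

Definition eval2 (A : lalgType K) (Q : {poly {poly K}}) (u v : A) : A :=
  \sum_(k < size Q) \sum_(l < size Q`_k) Q`_k`_l *: (u ^+ k * v ^+ l).

Definition eval3 (A : lalgType K) (D : {poly {poly {poly K}}}) (w u v : A) :=
  \sum_(k < size D) w ^+ k * eval2 D`_k u v.

End BivariatePolynomials.

Section QuiverHecke.

Variables (K : fieldType) (I : finType) (Q : I -> I -> {poly {poly K}}).
Variable n : nat.

(* e(i), x_p and tau_a; positions are numbered from 0. *)
Definition qh_gen : Type := {ffun 'I_n -> I} + ('I_n + 'I_n.-1).
HB.instance Definition _ := Choice.on qh_gen.

Definition free_alg : lalgType K := {malg K[{fmonom qh_gen}]}.

Definition free_gen (g : qh_gen) : free_alg := mkmalgU (fmu g) 1.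

Local Notation e i := (free_gen (inl i)).
Local Notation x p := (free_gen (inr (inl p))).
Local Notation tau a := (free_gen (inr (inr a))).

Definition swap_entries (p q : 'I_n) (i : {ffun 'I_n -> I}) :
  {ffun 'I_n -> I} := [ffun k => i (tperm p q k)].

(* In the rules about tau_a, the ordinals p, q, r stand for the positions
   a, a + 1, a + 2. *)
Inductive qh_rel : free_alg -> free_alg -> Prop :=
| qh_idem i j : qh_rel (e j * e i) (if i == j then e i else 0)
| qh_sum : qh_rel (\sum_i e i) 1
| qh_xx p q : qh_rel (x p * x q) (x q * x p)
| qh_xe p i : qh_rel (x p * e i) (e i * x p)
| qh_taue (a : 'I_n.-1) (p q : 'I_n) i of p = a :> nat & q = a.+1 :> nat :
    qh_rel (tau a * e i) (e (swap_entries p q i) * tau a)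
| qh_taux (a : 'I_n.-1) (p : 'I_n) of p != a :> nat & p != a.+1 :> nat :
    qh_rel (tau a * x p) (x p * tau a)
| qh_tauxr (a : 'I_n.-1) (p q : 'I_n) i of p = a :> nat & q = a.+1 :> nat :
    qh_rel ((tau a * x q - x p * tau a) * e i)
           (if i p == i q then e i else 0)
| qh_tauxl (a : 'I_n.-1) (p q : 'I_n) i of p = a :> nat & q = a.+1 :> nat :
    qh_rel ((x q * tau a - tau a * x p) * e i)
           (if i p == i q then e i else 0)
| qh_tau2 (a : 'I_n.-1) (p q : 'I_n) i of p = a :> nat & q = a.+1 :> nat :
    qh_rel (tau a ^+ 2 * e i) (eval2 (Q (i p) (i q)) (x p) (x q) * e i)
| qh_tautau (a b : 'I_n.-1) of (a.+1 < b)%N || (b.+1 < a)%N :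
    qh_rel (tau a * tau b) (tau b * tau a)
| qh_braid (a b : 'I_n.-1) (p q r : 'I_n) i of b = a.+1 :> nat
    & p = a :> nat & q = a.+1 :> nat & r = a.+2 :> nat :
    qh_rel ((tau b * tau a * tau b - tau a * tau b * tau a) * e i)
           (if i p == i r
            then eval3 (div_diff (Q (i p) (i q))) (x r) (x p) (x q) * e i
            else 0).

Definition quiver_hecke : pzRingType :=
  quot_ring [set z : free_alg | exists l r, qh_rel l r /\ z = l - r].

Definition qh_e (i : {ffun 'I_n -> I}) : quiver_hecke := quot_pi _ (e i).
Definition qh_x (p : 'I_n) : quiver_hecke := quot_pi _ (x p).
Definition qh_tau (a : 'I_n.-1) : quiver_hecke := quot_pi _ (tau a).

(* A dominant weight Lambda enters only through j |-> <h_j, Lambda>. *)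
Definition cyclotomic_gen (Lambda : {ffun I -> nat}) (n_gt0 : (0 < n)%N) :
    quiver_hecke :=
  let p1 := Ordinal n_gt0 in
  \sum_(i : {ffun 'I_n -> I}) qh_x p1 ^+ Lambda (i p1) * qh_e i.

Definition cyclotomic_quiver_hecke (Lambda : {ffun I -> nat})
    (n_gt0 : (0 < n)%N) : pzRingType :=
  quot_ring [set cyclotomic_gen Lambda n_gt0].

End QuiverHecke.

Definition fundamental_weight (I : finType) (i : I) : {ffun I -> nat} :=
  [ffun j => (i == j) : nat].

Section QuiverC1.

(* The quiver C^(1)_e; o i tells whether the edge between i and i + 1,
   1 <= i <= e - 2, is oriented as i -> i + 1. *)
Variables (e : nat) (o : nat -> bool).

Definition single_arrow (i j : nat) : bool :=
  [|| [&& (0 < i <= e - 2)%N, j == i.+1 & o i]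
    | [&& (0 < j <= e - 2)%N, i == j.+1 & ~~ o j]].

Definition double_arrow (i j : nat) : bool :=
  (i == 0%N) && (j == 1%N) || (i == e) && (j == e.-1).

Definition QC1 (K : fieldType) (i j : 'I_e.+1) : {poly {poly K}} :=
  if single_arrow i j then 'X - 'Y
  else if single_arrow j i then 'Y - 'X
  else if double_arrow i j then 'X - 'Y ^+ 2
  else if double_arrow j i then 'Y - 'X ^+ 2
  else if i == j then 0
  else 1.

End QuiverC1.

(* Main.v *)
Require Import Defs.
From HB Require Import structures.
From mathcomp Require Import all_boot all_order fingroup perm all_algebra.
From mathcomp Require Import boolp classical_sets.
From mathcomp.multinomials Require Import monalg.
From mathcomp Require Import finmap.
From mathcomp Require Import zify ring lra.

Set Implicit Arguments.
Unset Strict Implicit.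
Unset Printing Implicit Defensive.

Import Order.TTheory GRing.Theory Num.Theory.
Local Open Scope ring_scope.

(**
Write Lambda - alpha for what is left of Lambda after subtracting the simple roots of the
first letters of a word, call <h_c, Lambda - alpha> the slack of c at that place, and call a
word good when each of its letters has slack 1 at the place where it is added.

The conditions are sufficient. For the function G that counts the letters used so far,
twice at the ends 0 and e of the quiver, let the energy be the sum of all
(G(c+1) - G(c))^2 minus twice the sum of all G(i_s). Adding a letter c changes the energy by
a positive multiple of 1 - slack (energy_add), so good words have energy 0. Under the two
conditions a content of at most n letters never has negative energy (profile_ge0): the
vertices i_s are too far from one another and from the ends for the peaks of G at them to
overlap or to run into an end without paying for their height. So a slack never exceeds 1
after a good word of fewer than n letters (good_slack_le1). With this bound an induction on
positions shows that in the cyclotomic quotient all x_p vanish, that e(i) vanishes unless i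
is good, and that tau_a kills e(i) when it would cross equal or adjacent letters (klr_vanish
and its corollaries). What remains are crossings of far letters, which are invertible and
satisfy the braid relations without error terms; hence a left ideal A e(i) has at most one
dimension in each weight, any nonzero vector generates it, and A is the direct sum of the
nonzero ones (span_semisimple).

The conditions are necessary. If one of them fails, a family of representations depending on
a parameter y shows that some dot acts in the quotient in a nilpotent but nonzero way. The
words in question are shuffles of two rows of letters A and B, each of which zigzags along
the quiver, being reflected at 0 and e. Dots have eigenvalue 0 on row A and plus or minus y
(y^2 at 0 and e) on row B, and the tau's act by Young's seminormal form on the space with
basis the shuffles, over K(y) (top_braid, act_rel). The vectors that are obtained from the
vector v of the shuffle A...A B...B by moving entries of row B to the left span a lattice
over K[y] (straightensP), whose component in the weight of v is K[y] v. For a suitable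
nonzero eigenvalue zeta of a dot on v, the lattice contains a subrepresentation into which
the cyclotomic ideal maps it, and whose component in the weight of v is zeta^2 K[y] v
(sublattice_gop, cyc_sublattice). On the quotient the element z, that dot times e(i) for
the word i of v, satisfies z v = zeta v, which is not 0, while z r z v = 0 for all r in the
algebra: impossible when the algebra is semisimple (not_semisimple).

The choice of the rows follows the failing condition. If a vertex occurs twice among the
i_s, or if one of them is an end and n > 1, row A is empty. If two interior vertices c < d
have distance less than n, the rows start at c and at d. If an interior vertex c is less
than (n - 1)/2 away from an end, row A goes from c to this end and back to c, and row B
continues past c on the other side; here words that begin with row B are divided out as well.
*)

(** * The defining polynomials on elements of a ring *)

Section EvalQ.

Variables (K : fieldType) (e : nat) (o : nat -> bool).
Implicit Types i j : 'I_e.+1.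

(** Q_{i,j}(u, v) without reference to a ground field, so that it can be transported
    along ring morphisms. *)
Definition evQ (B : pzRingType) i j (u v : B) : B :=
  if single_arrow e o i j then u - v
  else if single_arrow e o j i then v - u
  else if double_arrow e i j then u - v ^+ 2
  else if double_arrow e j i then v - u ^+ 2
  else if i == j then 0 else 1.

(** The quotient (Q_{i,j}(w, v) - Q_{i,j}(u, v)) / (w - u) in closed form. *)
Definition evD (B : pzRingType) i j (w u v : B) : B :=
  if single_arrow e o i j then 1
  else if single_arrow e o j i then - 1
  else if double_arrow e i j then 1
  else if double_arrow e j i then - (w + u)
  else 0.

Lemma eval2_widen (A : lalgType K) (Q : {poly {poly K}}) (u v : A) m n :
  (size Q <= m)%N -> (forall k, (size (Q`_k)%R <= n)%N) ->
  eval2 Q u v = \sum_(k < m) \sum_(l < n) Q`_k`_l *: (u ^+ k * v ^+ l).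
Proof.
move=> hm hn; rewrite /eval2 (big_ord_widen _ (fun k => \sum_(l < size (Q`_k)%R)
  Q`_k`_l *: (u ^+ k * v ^+ l)) hm) big_mkcond /=.
apply: eq_bigr => k _; rewrite (big_ord_widen _ (fun l =>
  Q`_k`_l *: (u ^+ k * v ^+ l)) (hn k)) [X in if _ then X else _]big_mkcond /=.
case: ltnP => [_|hk]; last first.
  by rewrite big1 // => l _; rewrite [Q`_k]nth_default // coef0 scale0r.
by apply: eq_bigr => l _; case: ltnP => // /(nth_default 0) ->; rewrite scale0r.
Qed.

Lemma eval3_widen (A : lalgType K) (D : {poly {poly {poly K}}}) (w u v : A) m :
  (size D <= m)%N ->
  eval3 D w u v = \sum_(k < m) w ^+ k * eval2 D`_k u v.
Proof.
move=> hm; rewrite /eval3 (big_ord_widen _ (fun k => w ^+ k * eval2 D`_k u v) hm).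
rewrite big_mkcond /=; apply: eq_bigr => k _; case: ltnP => // hk.
by rewrite [D`_k]nth_default // /eval2 size_poly0 big_ord0 mulr0.
Qed.

End EvalQ.

Section EvalQ2.
Variables (K : fieldType) (A : lalgType K).
Implicit Types (u v w : A) (Q : {poly {poly K}}) (D : {poly {poly {poly K}}}).

Lemma eval2_bound Q : exists m, forall m', (m <= m')%N ->
  (size Q <= m')%N /\ forall k, (size (Q`_k)%R <= m')%N.
Proof.
exists (maxn (size Q) (\max_(k < size Q) size (Q`_k)%R)) => m'.
rewrite geq_max => /andP[h1 h2]; split=> // k.
case: (ltnP k (size Q)) => hk; last by rewrite nth_default ?size_poly0.
by apply: leq_trans h2; apply: (leq_bigmax (Ordinal hk)).
Qed.

Lemma eval2D u v Q Q' : eval2 (Q + Q') u v = eval2 Q u v + eval2 Q' u v.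
Proof.
have [m1 h1] := eval2_bound Q; have [m2 h2] := eval2_bound Q'.
have [m3 h3] := eval2_bound (Q + Q').
pose m := maxn m1 (maxn m2 m3).
have [h11 h12] := h1 m (leq_maxl _ _).
have [h21 h22] := h2 m (leq_trans (leq_maxl _ _) (leq_maxr _ _)).
have [h31 h32] := h3 m (leq_trans (leq_maxr _ _) (leq_maxr _ _)).
rewrite !(@eval2_widen _ _ _ _ _ m m) // -big_split; apply: eq_bigr => k _ /=.
by rewrite -big_split; apply: eq_bigr => l _ /=; rewrite !coefD scalerDl.
Qed.

Lemma eval2_0 u v : eval2 (0 : {poly {poly K}}) u v = 0.
Proof. by rewrite /eval2 size_poly0 big_ord0. Qed.

Lemma eval2N u v Q : eval2 (- Q) u v = - eval2 Q u v.
Proof. by apply/eqP; rewrite -addr_eq0 -eval2D addNr eval2_0. Qed.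

Lemma eval2_Xnl u v n : eval2 ('X^n : {poly {poly K}}) u v = u ^+ n.
Proof.
rewrite /eval2 size_polyXn big_ord_recr big1 => [|l _] /=.
  rewrite coefXn eqxx size_poly1 big_ord_recr big_ord0 /= coef1 /= scale1r.
  by rewrite !add0r expr0 mulr1.
by rewrite coefXn ltn_eqF ?ltn_ord // size_poly0 big_ord0.
Qed.

Lemma eval2_X u v : eval2 ('X : {poly {poly K}}) u v = u.
Proof. by have := eval2_Xnl u v 1; rewrite !expr1. Qed.

Lemma eval2_Xn u v n : eval2 (('X^n)%:P : {poly {poly K}}) u v = v ^+ n.
Proof.
rewrite /eval2 size_polyC monic_neq0 ?monicXn //= big_ord_recr big_ord0 /=.
rewrite coefC /= add0r size_polyXn big_ord_recr big1 => [|l _].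
  by rewrite coefXn eqxx /= add0r scale1r expr0 mul1r.
by rewrite coefXn /= ltn_eqF ?scale0r // ltn_ord.
Qed.

Lemma eval2_1 u v : eval2 (1 : {poly {poly K}}) u v = 1.
Proof. by have := eval2_Xn u v 0; rewrite !expr0. Qed.

Lemma eval3_C u v w Q : eval3 Q%:P w u v = eval2 Q u v.
Proof.
rewrite /eval3 size_polyC; case: (eqVneq Q 0) => [->|hQ] /=.
  by rewrite big_ord0 eval2_0.
by rewrite big_ord_recr big_ord0 /= coefC /= add0r expr0 mul1r.
Qed.

Lemma eval3_Xadd u v w Q : eval3 ('X + Q%:P) w u v = w + eval2 Q u v.
Proof.
have hs : (size ('X + Q%:P)%R <= 2)%N.
  by rewrite (leq_trans (size_polyD _ _)) // size_polyX size_polyC; case: eqP.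
rewrite (@eval3_widen _ _ _ _ _ _ 2) // !big_ord_recr big_ord0 /= !coefD !coefX !coefC /=.
by rewrite !add0r addr0 eval2_1 expr0 expr1 mul1r mulr1 addrC.
Qed.

Lemma eval3N u v w D : eval3 (- D) w u v = - eval3 D w u v.
Proof.
rewrite /eval3 size_polyN -sumrN; apply: eq_bigr => k _.
by rewrite coefN eval2N mulrN.
Qed.

Lemma div_diff_eq Q D : D * ('X - 'X%:P) = Q^:P - Q%:P -> div_diff Q = D.
Proof.
move=> hD; apply: (@mulIf _ ('X - 'X%:P)); first by rewrite polyXsubC_eq0.
by rewrite div_diffK hD.
Qed.

Variables (e : nat) (o : nat -> bool).
Implicit Types i j : 'I_e.+1.

Lemma eval2_QC1 i j u v : eval2 (QC1 o K i j) u v = evQ o i j u v.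
Proof.
have hY : ('X%:P : {poly {poly K}}) = ('X^1)%:P by rewrite expr1.
have hY2 : ('X%:P : {poly {poly K}}) ^+ 2 = ('X^2)%:P by rewrite rmorphXn.
rewrite /QC1 /evQ; 
case: (single_arrow e o i j); last case: (single_arrow e o j i);
  last case: (double_arrow e i j); last case: (double_arrow e j i);
  last case: (i == j).
- by rewrite eval2D eval2N eval2_X hY eval2_Xn.
- by rewrite eval2D eval2N eval2_X hY eval2_Xn.
- by rewrite eval2D eval2N eval2_X hY2 eval2_Xn.
- rewrite eval2D eval2N hY eval2_Xn expr1.
  by rewrite eval2_Xnl.
- exact: eval2_0.
- exact: eval2_1.
Qed.

Lemma eval3_QC1 i j u v w :
  eval3 (div_diff (QC1 o K i j)) w u v = evD o i j w u v.
Proof.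
rewrite /QC1 /evD; 
case: (single_arrow e o i j); last case: (single_arrow e o j i);
  last case: (double_arrow e i j); last case: (double_arrow e j i);
  last case: (i == j).
- rewrite (@div_diff_eq _ 1%:P) ?eval3_C ?eval2_1 // mul1r.
  by rewrite !rmorphB /= !map_polyX !map_polyC /=; ring.
- rewrite (@div_diff_eq _ (- 1%:P)) ?eval3N ?eval3_C ?eval2_1 //.
  by rewrite !rmorphB /= !map_polyX !map_polyC /=; ring.
- rewrite (@div_diff_eq _ 1%:P) ?eval3_C ?eval2_1 // mul1r.
  by rewrite !rmorphB /= !map_polyX !rmorphXn /= !map_polyC /=; ring.
- rewrite (@div_diff_eq _ (- ('X + 'X%:P))) ?eval3N ?eval3_Xadd ?eval2_X //.
  by rewrite !rmorphB /= !rmorphXn /= !map_polyX !map_polyC /=; ring.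
- by rewrite (@div_diff_eq _ 0%:P) ?eval3_C ?eval2_0 // !rmorph0 mul0r subr0.
- by rewrite (@div_diff_eq _ 0%:P) ?eval3_C ?eval2_0 // !rmorph1 mul0r subrr.
Qed.

End EvalQ2.

(** * Words, edges of the quiver and the relations *)

Section Positions.
Variables (n : nat) (I : finType).

Fact pos_lo_subproof (a : 'I_n.-1) : (a < n)%N.
Proof. by case: a => a /=; lia. Qed.
Fact pos_hi_subproof (a : 'I_n.-1) : (a.+1 < n)%N.
Proof. by case: a => a /=; lia. Qed.
Definition lo (a : 'I_n.-1) : 'I_n := Ordinal (pos_lo_subproof a).
Definition hi (a : 'I_n.-1) : 'I_n := Ordinal (pos_hi_subproof a).

Implicit Types (a : 'I_n.-1) (i : {ffun 'I_n -> I}).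

Definition sw (a : 'I_n.-1) (i : {ffun 'I_n -> I}) := swap_entries (lo a) (hi a) i.

Lemma sw_lo a i : sw a i (lo a) = i (hi a).
Proof. by rewrite ffunE tpermL. Qed.
Lemma sw_hi a i : sw a i (hi a) = i (lo a).
Proof. by rewrite ffunE tpermR. Qed.
Lemma sw_ne a i (p : 'I_n) : p != a :> nat -> p != a.+1 :> nat -> sw a i p = i p.
Proof. by move=> h1 h2; rewrite ffunE tpermD // -val_eqE /= eq_sym. Qed.
Lemma swK a : involutive (sw a).
Proof. by move=> i; apply/ffunP=> p; rewrite !ffunE tpermK. Qed.

End Positions.

Section Edges.
Variables (e : nat) (o : nat -> bool).
Implicit Types b c : 'I_e.+1.

Definition adjacent b c : bool := (b == c.+1 :> nat) || (c == b.+1 :> nat).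

Lemma adjacent_sym b c : adjacent b c = adjacent c b.
Proof. by rewrite /adjacent orbC. Qed.

Lemma adjacent_neq b c : adjacent b c -> b != c.
Proof. by apply: contraTneq => ->; rewrite /adjacent; lia. Qed.

Hypothesis e_ge2 : (2 <= e)%N.

Lemma double_adjacent b c : double_arrow e b c -> adjacent b c.
Proof. by rewrite /double_arrow /adjacent; lia. Qed.

Lemma evQ_far b c (B : pzRingType) (u v : B) :
  b != c -> ~~ adjacent b c -> evQ o b c u v = 1.
Proof.
move=> bc; rewrite /adjacent /evQ /single_arrow /double_arrow (negPf bc) => h.
have {}bc : (val b != val c)%N by rewrite (inj_eq val_inj).
rewrite !ifF //=; move: h bc => /=; case: (o b); case: (o c) => /=; lia.
Qed.

Lemma evQ_same b (B : pzRingType) (u v : B) : evQ o b b u v = 0.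
Proof.
rewrite /evQ eqxx /single_arrow /double_arrow !ifF //.
all: by case: (o b) => /=; lia.
Qed.

(** The boolean indices tell which end of a double edge is one of the long vertices
    0 and e; single edges come in both orientations. *)
Variant edge_spec b c : bool -> bool -> Type :=
| EdgeSingle of (forall (B : pzRingType) (u v : B), evQ o b c u v = u - v)
    & (forall (B : pzRingType) (w u v : B), evD o b c w u v = 1)
    & (forall (B : pzRingType) (u v : B), evQ o c b u v = v - u)
    & (forall (B : pzRingType) (w u v : B), evD o c b w u v = -1) :
    edge_spec b c false false
| EdgeSingleR of (forall (B : pzRingType) (u v : B), evQ o b c u v = v - u)
    & (forall (B : pzRingType) (w u v : B), evD o b c w u v = -1)
    & (forall (B : pzRingType) (u v : B), evQ o c b u v = u - v)
    & (forall (B : pzRingType) (w u v : B), evD o c b w u v = 1) :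
    edge_spec b c false false
| EdgeDouble of (forall (B : pzRingType) (u v : B), evQ o b c u v = u - v ^+ 2)
    & (forall (B : pzRingType) (w u v : B), evD o b c w u v = 1)
    & (forall (B : pzRingType) (u v : B), evQ o c b u v = v - u ^+ 2)
    & (forall (B : pzRingType) (w u v : B), evD o c b w u v = - (w + u)) :
    edge_spec b c true false
| EdgeDoubleR of (forall (B : pzRingType) (u v : B), evQ o b c u v = v - u ^+ 2)
    & (forall (B : pzRingType) (w u v : B), evD o b c w u v = - (w + u))
    & (forall (B : pzRingType) (u v : B), evQ o c b u v = u - v ^+ 2)
    & (forall (B : pzRingType) (w u v : B), evD o c b w u v = 1) :
    edge_spec b c false true.

Lemma edgeP b c : adjacent b c -> edge_spec b c (double_arrow e b c) (double_arrow e c b).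
Proof.
move=> hbc.
have [sbc|sbc] := boolP (single_arrow e o b c).
  have scb : single_arrow e o c b = false.
    move: sbc hbc; rewrite /single_arrow /adjacent.
    by case: (o b); case: (o c) => /=; lia.
  have dbc : double_arrow e b c = false.
    by move: sbc hbc; rewrite /single_arrow /double_arrow /adjacent; lia.
  have dcb : double_arrow e c b = false.
    by move: sbc hbc; rewrite /single_arrow /double_arrow /adjacent; lia.
  by rewrite dbc dcb; constructor=> *; rewrite /evQ /evD ?sbc ?scb.
have [scb|scb] := boolP (single_arrow e o c b).
  have dbc : double_arrow e b c = false.
    by move: scb hbc; rewrite /single_arrow /double_arrow /adjacent; lia.
  have dcb : double_arrow e c b = false.
    by move: scb hbc; rewrite /single_arrow /double_arrow /adjacent; lia.
  by rewrite dbc dcb; apply: EdgeSingleR=> *; rewrite /evQ /evD ?(negPf sbc) ?scb.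
have [dbc|dbc] := boolP (double_arrow e b c).
  have dcb : double_arrow e c b = false.
    by move: dbc hbc; rewrite /double_arrow /adjacent; lia.
  by rewrite dcb; apply: EdgeDouble=> *;
    rewrite /evQ /evD ?(negPf sbc) ?(negPf scb) ?dbc ?dcb.
have [dcb|dcb] := boolP (double_arrow e c b).
  by apply: EdgeDoubleR=> *;
    rewrite /evQ /evD ?(negPf sbc) ?(negPf scb) ?(negPf dbc) ?dcb.
exfalso; move: sbc scb dbc dcb hbc (ltn_ord b) (ltn_ord c).
rewrite /single_arrow /double_arrow /adjacent.
by case: (o b); case: (o c) => /=; lia.
Qed.

End Edges.

Section Relations.
Variables (n e : nat) (o : nat -> bool).
Local Notation I := 'I_e.+1.
Variables (A : pzRingType) (E : {ffun 'I_n -> I} -> A) (X : 'I_n -> A) (T : 'I_n.-1 -> A).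

(** The defining relations for elements of an arbitrary ring, which is the free algebra
    modulo the relations, its cyclotomic quotient, or any other image. *)
Record klr_relations : Prop := KlrRelations {
  klr_idem : forall i j, E j * E i = if i == j then E i else 0;
  klr_sum : \sum_i E i = 1;
  klr_xx : forall p q, X p * X q = X q * X p;
  klr_xe : forall p i, X p * E i = E i * X p;
  klr_te : forall a i, T a * E i = E (sw a i) * T a;
  klr_tx : forall (a : 'I_n.-1) (p : 'I_n), p != a :> nat -> p != a.+1 :> nat -> T a * X p = X p * T a;
  klr_txr : forall a i, (T a * X (hi a) - X (lo a) * T a) * E i =
              if i (lo a) == i (hi a) then E i else 0;
  klr_txl : forall a i, (X (hi a) * T a - T a * X (lo a)) * E i =
              if i (lo a) == i (hi a) then E i else 0;
  klr_t2 : forall a i, T a * T a * E i =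
              evQ o (i (lo a)) (i (hi a)) (X (lo a)) (X (hi a)) * E i;
  klr_tt : forall a b : 'I_n.-1, (a.+1 < b)%N || (b.+1 < a)%N -> T a * T b = T b * T a;
  klr_braid : forall (a b : 'I_n.-1) i, b = a.+1 :> nat ->
    (T b * T a * T b - T a * T b * T a) * E i =
    if i (lo a) == i (hi b)
    then evD o (i (lo a)) (i (hi a)) (X (hi b)) (X (lo a)) (X (hi a)) * E i else 0
}.

End Relations.

(** * Slack and good words *)

Section Cartan.
Variable e : nat.
Local Notation I := 'I_e.+1.

(** The Cartan integer <h_c, alpha_b>. *)
Definition cartan (c b : I) : int :=
  if c == b then 2 else if double_arrow e b c then -2 else if adjacent b c then -1 else 0.

Variables (n : nat) (Lam : {ffun I -> nat}).
Implicit Types i j : {ffun 'I_n -> I}.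

(** <h_c, Lambda - alpha>, for alpha the sum of the simple roots of the first k letters. *)
Definition slack (i : {ffun 'I_n -> I}) (k : nat) (c : I) : int :=
  (Lam c)%:Z - \sum_(t : 'I_n | (t < k)%N) cartan c (i t).

(** In a semisimple quotient these turn out to be the words of the surviving weight
    spaces: each step adds a letter of slack exactly 1, as for standard tableaux. *)
Definition good (i : {ffun 'I_n -> I}) (k : nat) : bool :=
  [forall t : 'I_n, (t < k)%N ==> (slack i t (i t) == 1)].

Lemma slack0 i c : slack i 0 c = (Lam c)%:Z.
Proof. by rewrite /slack big_pred0 ?subr0. Qed.

Lemma slackS i (t : 'I_n) c : slack i t.+1 c = slack i t c - cartan c (i t).
Proof.
rewrite /slack (bigD1 t) //= -addrA -opprD [cartan _ _ + _]addrC.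
congr (_ - (_ + _)); apply: eq_bigl => s.
by rewrite -(inj_eq val_inj) /=; lia.
Qed.

Lemma slack_eq i j k c : (forall t : 'I_n, (t < k)%N -> i t = j t) ->
  slack i k c = slack j k c.
Proof. by move=> ij; congr (_ - _); apply: eq_bigr => t /ij ->. Qed.

Lemma goodP i k :
  reflect (forall t : 'I_n, (t < k)%N -> slack i t (i t) = 1) (good i k).
Proof.
by apply: (iffP forallP) => h t; [move=> tk; have /implyP/(_ tk)/eqP := h t
  | apply/implyP=> tk; rewrite h].
Qed.

Lemma goodS i (t : 'I_n) : good i t.+1 = good i t && (slack i t (i t) == 1).
Proof.
apply/goodP/andP => [h|[/goodP h /eqP ht] s].
  by split; [apply/goodP=> s st; apply: h; apply: ltnW | rewrite h].
rewrite ltnS leq_eqVlt => /orP[/eqP/val_inj -> //|]; exact: h.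
Qed.

Lemma good_le i k l : (k <= l)%N -> good i l -> good i k.
Proof. by move=> kl /goodP h; apply/goodP => t tk; apply: h; lia. Qed.

(** After a good word the slack of c is -1 only if the last c has not been followed by
    a neighbour: that occurrence can be commuted to the end. *)
Lemma slack_removable i k c : (k <= n)%N -> good i k ->
  (-1 <= slack i k c) /\ (slack i k c = -1 -> exists t : 'I_n,
    [/\ (t < k)%N, i t = c & forall s : 'I_n, (t < s < k)%N ->
       i s != c /\ ~~ adjacent (i s) c]).
Proof.
elim: k => [|k IHk] kn gi; first by rewrite slack0; split; lia.
pose t := Ordinal kn; have [|h1 h2] := IHk (ltnW kn); first exact: good_le gi.
have /andP[_ /eqP ht] : good i t && (slack i t (i t) == 1) by rewrite -goodS.
rewrite (slackS i t) /cartan; have [cit|cit] := eqVneq c (i t).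
  rewrite cit ht; split=> // _; exists t; split=> //= s; lia.
case: ifP => [d|_]; first by split; move: h1; rewrite /=; lia.
case: ifP => [d|d]; first by split; move: h1; rewrite /=; lia.
rewrite subr0; split=> // /h2[s [sk isc hs]]; exists s; split=> //; first lia.
move=> r /andP[sr]; rewrite ltnS leq_eqVlt => /orP[/eqP rk|rk]; last first.
  by apply: hs; rewrite sr.
have -> : r = t by apply: val_inj.
by rewrite eq_sym cit d.
Qed.

End Cartan.

(** * What vanishes in the cyclotomic quotient *)

Section Vanishing.
Variables (n e : nat) (o : nat -> bool).
Hypothesis e_ge2 : (2 <= e)%N.
Local Notation I := 'I_e.+1.
Variables (A : pzRingType) (E : {ffun 'I_n -> I} -> A) (X : 'I_n -> A) (T : 'I_n.-1 -> A).
Hypothesis R : klr_relations o E X T.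
Variables (Lam : {ffun I -> nat}).
Hypothesis cyc : forall (p : 'I_n) (i : {ffun 'I_n -> I}), p = 0%N :> nat -> X p ^+ Lam (i p) * E i = 0.
Hypothesis slack_le1 : forall (i : {ffun 'I_n -> I}) k c, (k < n)%N -> good Lam i k -> slack Lam i k c <= 1.

Notation good := (good Lam).
Notation slack := (slack Lam).
Implicit Types (a b : 'I_n.-1) (i j : {ffun 'I_n -> I}).

(** Once the first dot vanishes on a repeated letter, x_{a+1} tau_a and tau_a x_{a+1}
    both act as the identity, while tau_a^2 = 0. *)
Lemma klr_repeat a i : X (lo a) * E i = 0 -> i (lo a) = i (hi a) -> E i = 0.
Proof.
move=> Xi ii.
have sii : sw a i = i.
  apply/ffunP=> p; rewrite !ffunE; case: tpermP => [->|->|] //.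
have TE : T a * E i = E i * T a by rewrite (klr_te R) sii.
have XTE : X (hi a) * T a * E i = E i.
  have := klr_txl R a i; rewrite ii eqxx mulrBl -[T a * _ * _]mulrA Xi.
  by rewrite mulr0 subr0.
have TXE : T a * X (hi a) * E i = E i.
  have := klr_txr R a i; rewrite ii eqxx mulrBl -[X _ * T a * _]mulrA TE mulrA Xi.
  by rewrite mul0r subr0.
have T2 : T a * T a * E i = 0 by rewrite (klr_t2 R) ii evQ_same // mul0r.
rewrite -XTE -[X in _ * X]TXE -mulrA (mulrA (T a)) (mulrA (T a)) -(mulrA _ (X _)).
by rewrite (klr_xe R) (mulrA _ (E i)) T2 mul0r mulr0.
Qed.

(** Q is 1 at two distinct letters that are not adjacent, so that tau_a is its own
    inverse there. *)
Lemma klr_far a i : i (lo a) != i (hi a) -> ~~ adjacent (i (lo a)) (i (hi a)) ->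
  E i = T a * E (sw a i) * T a.
Proof.
move=> h1 h2; have := klr_t2 R a i; rewrite evQ_far // mul1r => <-.
by rewrite -mulrA (klr_te R) mulrA.
Qed.

Lemma klr_slideX a i p : i (lo a) != i (hi a) -> p = hi a ->
  X p * T a * E i = T a * X (lo a) * E i.
Proof.
move=> h1 ->; apply/eqP; rewrite -subr_eq0 -mulrBl (klr_txl R).
by rewrite (negPf h1).
Qed.

(** The letter c = i_k reappears after b = i_(k-1), and the previous occurrence
   of c commutes up to b: the braid relation for c b c applies. Both of its
   braids pass through words that vanish, and its error term is a unit, or the sum of
   the two dots at c when b is the long end of a double edge. *)
Lemma klr_return a i d (t : 'I_n) :
  (forall j, ~~ good j a.+1 -> E j = 0) ->
  (forall j (p : 'I_n), (p <= a)%N -> X p * E j = 0) ->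
  adjacent (i (lo a)) (i (hi a)) ->
  (t + d).+1 = a :> nat -> i t = i (hi a) ->
  (forall s : 'I_n, (t < s < a)%N -> i s != i (hi a) /\ ~~ adjacent (i s) (i (hi a))) ->
  if double_arrow e (i (lo a)) (i (hi a)) then X (hi a) * E i = 0 else E i = 0.
Proof.
move=> Ebad Xz; elim: d t i => [|d IHd] t i adj tda itc far.
  have ta : (t < n.-1)%N by have := ltn_ord a; rewrite -tda; lia.
  pose a' := Ordinal ta; have aa' : a = a'.+1 :> nat by rewrite /= -tda addn0.
  have lot : lo a' = t by apply: val_inj.
  have hit : hi a' = lo a by apply: val_inj; rewrite /= -tda addn0.
  have Xlo : X (lo a) * E i = 0 by apply: Xz.
  have Xt : X t * E i = 0 by apply: Xz; rewrite -tda; lia.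
  have bc := adjacent_neq adj.
  have E1 : E (sw a i) = 0.
    apply: Ebad; apply/negP => gd.
    have nt : lo a != t by apply/eqP => /(congr1 val) /=; rewrite -tda; lia.
    have st : sw a i t = i t by apply: sw_ne; rewrite -tda; lia.
    have := gd; rewrite (_ : a.+1 = (lo a).+1) // goodS => /andP[g1 /eqP].
    have -> : val (lo a) = t.+1 by rewrite /= -tda addn0.
    rewrite (slackS _ _ t) st sw_lo itc /cartan eqxx.
    have := gd; rewrite (_ : a.+1 = t.+2) ?goodS -?tda ?addn0 //.
    move/(good_le (leqnSn _)); rewrite goodS => /andP[_ /eqP]; rewrite st itc => ->.
    lia.
  have E2 : E (sw a' i) = 0.
    apply: (klr_repeat (a := a)); first exact: Xz.
    have -> : lo a = hi a' by [].
    rewrite sw_hi lot itc sw_ne //=; lia.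
  have := klr_braid R i aa'; rewrite lot -itc eqxx hit itc mulrBl.
  rewrite -(mulrA _ (T a)) (klr_te R) E1 mul0r mulr0.
  rewrite -(mulrA _ (T a')) (klr_te R) E2 mul0r mulr0 subrr.
  move/esym; rewrite adjacent_sym in adj; case: (edgeP o e_ge2 adj) => _ hD _ _; rewrite hD.
  - by rewrite mul1r.
  - by rewrite mulN1r => /eqP; rewrite oppr_eq0 => /eqP.
  - by rewrite mul1r.
  - by rewrite mulNr mulrDl Xt addr0 => /eqP; rewrite oppr_eq0 => /eqP.
have ta : (t < n.-1)%N by have := ltn_ord a; rewrite -tda; lia.
pose a' := Ordinal ta.
have lot : lo a' = t by apply: val_inj.
have fs := far (hi a'); have [|f1 f2] := fs; first by rewrite /= -tda; lia.
have loa : sw a' i (lo a) = i (lo a) by apply: sw_ne; rewrite /= -tda; lia.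
have hia : sw a' i (hi a) = i (hi a) by apply: sw_ne; rewrite /= -tda; lia.
have hE : E i = T a' * E (sw a' i) * T a'.
  by apply: klr_far; rewrite lot itc; [rewrite eq_sym | rewrite adjacent_sym].
have := IHd (hi a') (sw a' i); rewrite loa hia; case/(_ _ _ _ _)/Wrap => //.
- by rewrite /= -tda; lia.
- by rewrite sw_hi lot.
- move=> s hs; rewrite sw_ne; first by apply: far; move: hs => /=; lia.
    by move: hs => /=; lia.
  by move: hs => /=; lia.
case: ifP => _ h; last by rewrite hE h mulr0 mul0r.
rewrite hE !mulrA -(klr_tx R) /=; try (by rewrite -tda; lia).
by rewrite -(mulrA (T a')) h mulr0 mul0r.
Qed.

Lemma cartan_adjacent (b c : I) : adjacent b c ->
  cartan c b = if double_arrow e b c then -2 else -1.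
Proof.
by move=> bc; rewrite /cartan eq_sym (negPf (adjacent_neq bc)) bc.
Qed.

Lemma slack_sw a i c : slack (sw a i) a c = slack i a c.
Proof. by apply: slack_eq => t ta; apply: sw_ne; lia. Qed.

(** Two adjacent letters are never both addable: adding one of them would
   raise the slack of the other one above 1. *)
Lemma good_sw_adjacent a i : good i a.+1 -> adjacent (i (lo a)) (i (hi a)) ->
  ~~ good (sw a i) a.+1.
Proof.
move=> gi adj; apply/negP; rewrite (goodS _ _ (lo a)) sw_lo slack_sw.
case/andP=> _ /eqP s1; have := slack_le1 (i (hi a)) (pos_hi_subproof a) gi.
by rewrite (slackS _ _ (lo a)) s1 cartan_adjacent //; case: ifP; lia.
Qed.

(** Induction on the number of positions. Let the letter c follow b, at the end of a
    good word on which all dots vanish. If c = b, the word vanishes by klr_repeat. If b and c are far, tau_a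
    carries the claim to the swapped word, in which c stands one position earlier. If
    they are adjacent, the swapped word is not good, so that tau_a and therefore Q kill
    the word: when c had slack 0 before b, what is left of Q is the dot at c up to sign;
    when it had slack -1, klr_return applies, and kills the word itself unless b is the
    long end of a double edge, in which case c has slack 1. *)
Lemma klr_vanish k : (k <= n)%N ->
  (forall i, ~~ good i k -> E i = 0) /\
  (forall i (p : 'I_n), (p < k)%N -> X p * E i = 0).
Proof.
elim: k => [|[|k] IHk] kn; first by split=> // i /negP[]; apply/goodP.
  pose p0 := Ordinal kn.
  have L1 i : (Lam (i p0) <= 1)%N.
    have g0 : good i 0 by apply/goodP.
    by have := slack_le1 (i p0) kn g0; rewrite slack0; lia.
  split=> i; rewrite ?(goodS _ _ p0) /=.
    rewrite slack0 => h; have := cyc i (erefl : p0 = 0%N :> nat).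
    have -> : Lam (i p0) = 0%N; last by rewrite expr0 mul1r.
    suff : Lam (i p0) != 1%N by have := L1 i; lia.
    by apply: contra h => /eqP ->; rewrite eqxx andbT; apply/goodP.
  move=> p; rewrite ltnS leqn0 => /eqP pp; have -> : p = p0 by apply: val_inj.
  have := cyc i (erefl : p0 = 0%N :> nat); have := L1 i.
  by case: (Lam _) => [|[]] // _; rewrite expr0 mul1r => ->; rewrite mulr0.
have [Ebad Xz] := IHk (ltnW kn).
have an : (k < n.-1)%N by lia.
pose a := Ordinal an.
have Ebad' i : ~~ good i a.+1 -> E i = 0 by apply: Ebad.
have Xz' i (p : 'I_n) : (p <= a)%N -> X p * E i = 0 by apply: Xz.
suff H i : (~~ good i k.+2 -> E i = 0) /\ X (hi a) * E i = 0.
  split=> [i /(proj1 (H i))//|i p]; rewrite ltnS leq_eqVlt => /orP[/eqP pk|]; last exact: Xz.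
  have -> : p = hi a by apply: val_inj.
  by case: (H i).
have [gi|/Ebad' ->] := boolP (good i a.+1); last by rewrite mulr0.
have gE : good i k.+2 = (slack i k.+1 (i (hi a)) == 1).
  by rewrite (goodS _ _ (hi a)) gi.
rewrite gE; set b := i (lo a); set c := i (hi a).
have sS : slack i k.+1 c = slack i k c - cartan c b by rewrite (slackS _ _ (lo a)).
have [bc|bc] := eqVneq b c; first by rewrite (klr_repeat (Xz' _ (lo a) (leqnn _)) bc) mulr0.
have [adj|far] := boolP (adjacent b c); last first.
  rewrite sS /cartan [c == b]eq_sym (negPf bc) (negPf far).
  have -> : double_arrow e b c = false by apply: contraNF far; apply: double_adjacent.
  rewrite subr0; have hE := klr_far bc far; split=> [h|].
    rewrite hE Ebad' ?mulr0 ?mul0r //; apply: contra h.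
    by rewrite (goodS _ _ (lo a)) sw_lo slack_sw => /andP[].
  rewrite hE !mulrA (klr_slideX (a := a)) //; last by rewrite sw_lo sw_hi eq_sym.
  by rewrite -(mulrA (T a)) Xz' // mulr0 mul0r.
have [|lb rem] := slack_removable (k := k) c _ (good_le (leqnSn k) gi); first lia.
have ub : slack i k.+1 c <= 1 by apply: slack_le1.
have TE : T a * E i = 0.
  by rewrite (klr_te R) Ebad' ?mul0r //; apply: good_sw_adjacent.
have QE : evQ o b c (X (lo a)) (X (hi a)) * E i = 0.
  by rewrite -(klr_t2 R) -mulrA TE mulr0.
have Xlo : X (lo a) * E i = 0 by apply: Xz'.
have [sm1|snm1] := eqVneq (slack i k c) (-1).
  have [t [tk itc far]] := rem sm1.
  have td : (t + (k - t.+1)).+1 = a :> nat by rewrite /= -addSn subnKC.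
  have := klr_return Ebad' Xz' adj td itc far.
  rewrite sS sm1 cartan_adjacent //; case: ifP => _ h; last by rewrite h mulr0.
  by split=> //; rewrite eqxx.
have s0 : slack i k c = 0.
  move: ub; rewrite sS cartan_adjacent //; case: ifP => _; last by lia.
  by move: lb snm1; lia.
move: ub QE; rewrite sS s0 cartan_adjacent //.
case: (edgeP o e_ge2 adj) => hQ _ _ _ ub; rewrite ?hQ ?mulrBl ?expr2 -?mulrA Xlo
  ?mulr0 ?subr0 ?sub0r //.
by move=> /eqP; rewrite oppr_eq0 => /eqP.
Qed.

Lemma klr_vanishX i p : X p * E i = 0.
Proof. by have [_ h] := klr_vanish (leqnn n); apply: h. Qed.

Lemma klr_vanishT a i : adjacent (i (lo a)) (i (hi a)) -> T a * E i = 0.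
Proof.
move=> adj; have [h _] := klr_vanish (pos_lo_subproof a).
have [gi|/h ->] := boolP (good i a.+1); last by rewrite mulr0.
by rewrite (klr_te R) h ?mul0r // good_sw_adjacent.
Qed.

Lemma klr_vanishE a i : i (lo a) = i (hi a) -> E i = 0.
Proof. by apply: klr_repeat; apply: klr_vanishX. Qed.

End Vanishing.

(** * Semisimplicity when only far letters cross *)

Section AdjacentTranspositions.
Variable n : nat.
Implicit Types (a b : 'I_n.-1) (s : 'S_n).

Definition adj_tperm a : 'S_n := tperm (lo a) (hi a).
Local Notation tp := adj_tperm.

Lemma lo_neq_hi a : lo a != hi a.
Proof. by rewrite -(inj_eq val_inj) /=; lia. Qed.

Lemma tp_lo a s : (tp a * s)%g (lo a) = s (hi a).
Proof. by rewrite permM tpermL. Qed.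
Lemma tp_hi a s : (tp a * s)%g (hi a) = s (lo a).
Proof. by rewrite permM tpermR. Qed.
Lemma tp_ne a s (p : 'I_n) : p != a :> nat -> p != a.+1 :> nat -> (tp a * s)%g p = s p.
Proof. by move=> h1 h2; rewrite permM tpermD // -(inj_eq val_inj) /= eq_sym. Qed.

Lemma tpK a s : (tp a * (tp a * s))%g = s.
Proof. by rewrite mulgA tperm2 mul1g. Qed.

Lemma tp_comm a b s : (a.+1 < b)%N || (b.+1 < a)%N ->
  (tp a * (tp b * s))%g = (tp b * (tp a * s))%g.
Proof.
move=> ab; rewrite !mulgA; congr (_ * s)%g.
rewrite conjgC /adj_tperm tpermJ !tpermD // -(inj_eq val_inj) /=; lia.
Qed.

Lemma tp_braid a b s : b = a.+1 :> nat ->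
  (tp a * (tp b * (tp a * s)) = tp b * (tp a * (tp b * s)))%g.
Proof.
move=> ba; have lb : lo b = hi a by apply: val_inj.
have h1 : lo a != lo b by rewrite -(inj_eq val_inj) /= ba; lia.
have h2 : lo a != hi b by rewrite -(inj_eq val_inj) /= ba; lia.
have h3 := lo_neq_hi a; have h4 := lo_neq_hi b.
have eab : (tp a * tp b = tp b * tperm (lo a) (hi b))%g.
  by rewrite conjgC /adj_tperm tpermJ -lb tpermL tpermD // eq_sym.
have eba : (tp b * tp a = tp a * tperm (lo a) (hi b))%g.
  by rewrite conjgC /adj_tperm tpermJ lb tpermR tpermD // -lb // eq_sym.
rewrite !mulgA; congr (_ * s)%g; transitivity (tperm (lo a) (hi b)).
  by rewrite -mulgA eba mulgA tperm2 mul1g.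
by rewrite -mulgA eab mulgA tperm2 mul1g.
Qed.

End AdjacentTranspositions.

Section SpanSemisimple.
Variables (K : fieldType) (n e : nat) (o : nat -> bool).
Hypothesis e_ge2 : (2 <= e)%N.
Local Notation I := 'I_e.+1.
Variables (A : pzRingType) (E : {ffun 'I_n -> I} -> A) (X : 'I_n -> A) (T : 'I_n.-1 -> A).
Hypothesis R : klr_relations o E X T.
Variable sc : K -> A.
Hypothesis sc1 : sc 1 = 1.
Hypothesis scD : forall c d, sc (c + d) = sc c + sc d.
Hypothesis scM : forall c d, sc (c * d) = sc c * sc d.
Hypothesis scC : forall c x, sc c * x = x * sc c.
Hypothesis gen_ind : forall P : A -> Prop,
  (forall x y, P x -> P y -> P (x + y)) -> (forall c, P (sc c)) ->
  (forall i x, P x -> P (E i * x)) -> (forall p x, P x -> P (X p * x)) ->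
  (forall a x, P x -> P (T a * x)) -> forall x, P x.
Hypothesis XE0 : forall p i, X p * E i = 0.
Hypothesis TE0 : forall (a : 'I_n.-1) (i : {ffun 'I_n -> I}), adjacent (i (lo a)) (i (hi a)) -> T a * E i = 0.
Hypothesis E0 : forall (a : 'I_n.-1) (i : {ffun 'I_n -> I}), i (lo a) = i (hi a) -> E i = 0.

Implicit Types (a b : 'I_n.-1) (i j : {ffun 'I_n -> I}) (s : 'S_n).

Definition far (b c : I) := (b != c) && ~~ adjacent b c.

Lemma far_sym (b c : I) : far b c = far c b.
Proof. by rewrite /far eq_sym adjacent_sym. Qed.

Local Notation tp := adj_tperm.

(** The strand of i that stands at position p after the crossings is s p. *)
Definition word_of i s : {ffun 'I_n -> I} := [ffun p => i (s p)].

Lemma word_of_tp i a s : word_of i (tp a * s)%g = sw a (word_of i s).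
Proof. by apply/ffunP=> p; rewrite !ffunE permM. Qed.

(** t is a product of tau's along a reduced path from i to word_of i s that
   only crosses far apart letters. *)
Inductive reduced i : nat -> 'S_n -> A -> Prop :=
| Reduced0 : reduced i 0 1%g (E i)
| ReducedS m s t a of reduced i m s t & (s (lo a) < s (hi a))%N
    & far (i (s (lo a))) (i (s (hi a))) :
    reduced i m.+1 (tp a * s)%g (T a * t).

Lemma reducedE i m s t : reduced i m s t -> E (word_of i s) * t = t.
Proof.
elim=> [|{}m {}s {}t a _ IH _ _].
  have -> : word_of i 1%g = i by apply/ffunP=> p; rewrite ffunE perm1.
  by rewrite (klr_idem R) eqxx.
by rewrite word_of_tp mulrA -(klr_te R) -mulrA IH.
Qed.

Lemma reduced_inv i m s t (p q : 'I_n) : reduced i m s t -> (p < q)%N ->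
  (s q < s p)%N -> far (i (s p)) (i (s q)).
Proof.
move=> h; elim: h p q => [|{}m {}s {}t a _ IH asc hfar] p q pq; first by rewrite !perm1; lia.
have [pa|pa] := eqVneq p (lo a); have [qa|qa] := eqVneq q (hi a).
- by rewrite pa qa tp_lo tp_hi far_sym.
- rewrite pa tp_lo [(tp a * s)%g q]tp_ne; [apply: IH| |];
   move: pq qa; rewrite pa -?(inj_eq val_inj) /=; lia.
- rewrite qa tp_hi [(tp a * s)%g p]tp_ne; [apply: IH| |];
   move: pq pa; rewrite qa -?(inj_eq val_inj) /=; lia.
have [pb|pb] := eqVneq p (hi a).
  rewrite pb tp_hi [(tp a * s)%g q]tp_ne; [apply: IH| |];
   move: pq; rewrite pb -?(inj_eq val_inj) /=; lia.
have [qb|qb] := eqVneq q (lo a).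
  rewrite qb tp_lo [(tp a * s)%g p]tp_ne; [apply: IH| |];
   move: pq; rewrite qb -?(inj_eq val_inj) /=; lia.
move: pa pb qa qb; rewrite -!(inj_eq val_inj) /= => pa pb qa qb.
by rewrite !tp_ne //; apply: IH.
Qed.

Lemma klr_TT i a t : far (i (lo a)) (i (hi a)) -> E i * t = t -> T a * (T a * t) = t.
Proof.
case/andP=> h1 h2 <-; rewrite !mulrA (klr_t2 R) evQ_far //; by rewrite mul1r.
Qed.

Lemma klr_braid0 i a b t : b = a.+1 :> nat -> i (lo a) != i (hi b) -> E i * t = t ->
  T b * (T a * (T b * t)) = T a * (T b * (T a * t)).
Proof.
move=> ba ii <-; apply/eqP; rewrite -subr_eq0 !mulrA -!mulrBl (klr_braid R) //.
by rewrite (negPf ii) mul0r.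
Qed.

Lemma reduced0 i s t : reduced i 0 s t -> s = 1%g /\ t = E i.
Proof. by move em : 0%N => m h; case: h em. Qed.

Lemma reduced_descent i m s t a : reduced i m s t -> (s (hi a) < s (lo a))%N ->
  exists m', m = m'.+1.
Proof.
case: m => [|m] h; last by exists m.
by have [-> _] := reduced0 h; rewrite !perm1 /=; lia.
Qed.

(** The exchange property of reduced words: far commutations and braids, which hold
    without error terms at far letters, bring any descent of s to the last step. *)
Lemma reduced_exchange i m s t a : reduced i m.+1 s t -> (s (hi a) < s (lo a))%N ->
  exists2 t', reduced i m (tp a * s)%g t' & t = T a * t'.
Proof.
elim/ltn_ind: m s t a => m IHm s t a h.
move em : m.+1 h => m1 h; case: h em => // m' s1 t1 b h1 asc hfar [em]; subst m'.
have [->|nab] := eqVneq a b; first by exists t1; rewrite ?tpK.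
have [ab|ab] := boolP ((a.+1 < b)%N || (b.+1 < a)%N).
  rewrite !tp_ne /=; try lia; move=> desc.
  have [m' em] := reduced_descent h1 desc; subst m.
  have [t2 h2 ->] := IHm m' (ltnSn _) s1 t1 a h1 desc.
  exists (T b * t2); last by rewrite !mulrA (klr_tt R) // orbC.
  by rewrite tp_comm //; apply: ReducedS h2 _ _; rewrite !tp_ne //=; lia.
have {ab nab} : (b == a.+1 :> nat) || (a == b.+1 :> nat).
  by move: nab ab; rewrite -(inj_eq val_inj) /=; lia.
case/orP=> /eqP ab.
  have lb : lo b = hi a by apply: val_inj.
  have ra : hi b != a :> nat by rewrite /= ab; lia.
  have rb : hi b != a.+1 :> nat by rewrite /= ab; lia.
  have qa : lo a != b :> nat by rewrite /= ab; lia.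
  have qb : lo a != b.+1 :> nat by rewrite /= ab; lia.
  rewrite -{1}lb tp_lo tp_ne // => desc; rewrite lb in asc hfar.
  have d1 : (s1 (hi a) < s1 (lo a))%N by lia.
  have [m' em] := reduced_descent h1 d1; subst m.
  have [t2 h2 e1] := IHm m' (ltnSn _) s1 t1 a h1 d1.
  have d2 : ((tp a * s1)%g (hi b) < (tp a * s1)%g (lo b))%N by rewrite lb tp_hi tp_ne.
  have [m'' em] := reduced_descent h2 d2; subst m'.
  have [t3 h3 e2] := IHm m'' (leqnSn _) _ t2 b h2 d2.
  have f1 : far (i (s1 (hi a))) (i (s1 (lo a))).
    by rewrite far_sym; apply: (reduced_inv h1) => //=.
  exists (T b * (T a * t3)); last first.
    rewrite e1 e2; apply: (klr_braid0 ab) (reducedE h3); rewrite !ffunE.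
    rewrite tp_hi lb tp_hi tp_ne // tp_lo.
    by case/andP: f1.
  have -> : (tp a * (tp b * s1) = tp b * (tp a * (tp b * (tp a * s1))))%g.
    by rewrite -tp_braid // tpK.
  have v1 : (tp b * (tp a * s1))%g (lo a) = s1 (hi a) by rewrite tp_ne // tp_lo.
  have v2 : (tp b * (tp a * s1))%g (hi a) = s1 (hi b) by rewrite -lb tp_lo tp_ne.
  have v3 : (tp b * (tp a * s1))%g (hi b) = s1 (lo a) by rewrite tp_hi lb tp_hi.
  have w1 : (tp a * (tp b * (tp a * s1)))%g (lo b) = s1 (hi a) by rewrite lb tp_hi v1.
  have w2 : (tp a * (tp b * (tp a * s1)))%g (hi b) = s1 (lo a) by rewrite tp_ne.
  by apply: ReducedS; [apply: ReducedS h3 _ _| |]; rewrite ?w1 ?w2 ?v1 ?v2.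
have lb : hi b = lo a by apply: val_inj.
have ra : lo b != a :> nat by rewrite /= ab; lia.
have rb : lo b != a.+1 :> nat by rewrite /= ab; lia.
have qa : hi a != b :> nat by rewrite /= ab; lia.
have qb : hi a != b.+1 :> nat by rewrite /= ab; lia.
rewrite -{1}lb tp_hi tp_ne // => desc; rewrite lb in asc hfar.
have d1 : (s1 (hi a) < s1 (lo a))%N by lia.
have [m' em] := reduced_descent h1 d1; subst m.
have [t2 h2 e1] := IHm m' (ltnSn _) s1 t1 a h1 d1.
have d2 : ((tp a * s1)%g (hi b) < (tp a * s1)%g (lo b))%N by rewrite lb tp_lo tp_ne.
have [m'' em] := reduced_descent h2 d2; subst m'.
have [t3 h3 e2] := IHm m'' (leqnSn _) _ t2 b h2 d2.
have f1 : far (i (s1 (hi a))) (i (s1 (lo a))).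
  by rewrite far_sym; apply: (reduced_inv h1) => //=.
exists (T b * (T a * t3)); last first.
  rewrite e1 e2; apply/esym; apply: (klr_braid0 ab) (reducedE h3); rewrite !ffunE.
  rewrite tp_lo lb tp_lo tp_ne // tp_hi.
  by case/andP: f1.
have -> : (tp a * (tp b * s1) = tp b * (tp a * (tp b * (tp a * s1))))%g.
  by rewrite tp_braid // tpK.
have v1 : (tp b * (tp a * s1))%g (lo b) = s1 (hi a) by rewrite tp_lo lb tp_lo.
have v2 : (tp b * (tp a * s1))%g (lo a) = s1 (lo b) by rewrite -lb tp_hi tp_ne.
have v3 : (tp b * (tp a * s1))%g (hi a) = s1 (lo a) by rewrite tp_ne // tp_hi.
have w1 : (tp a * (tp b * (tp a * s1)))%g (lo b) = s1 (hi a) by rewrite tp_ne.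
have w2 : (tp a * (tp b * (tp a * s1)))%g (hi b) = s1 (lo a) by rewrite lb tp_lo v3.
by apply: ReducedS; [apply: ReducedS h3 _ _| |]; rewrite ?w1 ?w2 ?v2 ?v3.
Qed.

(** Matsumoto's argument: the exchange property lets two reduced paths end in the same
    step. *)
Lemma reduced_unique i m m' s t t' : reduced i m s t -> reduced i m' s t' -> t = t'.
Proof.
move=> h; elim: h m' t' => [|{}m {}s {}t a h IH asc hfar] m' t' h'.
  case: m' h' => [/reduced0[]//|m'] h'; exfalso.
  move em : m'.+1 h' => m1; move es : 1%g => s1 h'.
  case: h' es em => // m2 s2 t2 a _ asc _ es _.
  have := tp_lo a s2; have := tp_hi a s2; rewrite -es !perm1 => e1 e2.
  by move: asc; rewrite -e1 -e2 /=; lia.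
have desc : ((tp a * s)%g (hi a) < (tp a * s)%g (lo a))%N by rewrite tp_lo tp_hi.
have [m2 em] := reduced_descent h' desc; subst m'.
by have [t2] := reduced_exchange h' desc; rewrite tpK => /IH -> ->.
Qed.

Lemma reduced_inverse i m s t : reduced i m s t -> exists x, x * t = E i.
Proof.
elim=> [|{}m {}s {}t a h [x <-] _ hfar]; first by exists 1; rewrite mul1r.
exists (x * T a); rewrite -mulrA (klr_TT _ (reducedE h)) // !ffunE.
exact: hfar.
Qed.

(** Equal letters never cross, so the final word determines the permutation. *)
Lemma reduced_word_inj i m m' s s' t t' : reduced i m s t -> reduced i m' s' t' ->
  word_of i s = word_of i s' -> s = s'.
Proof.
move=> h h' ww; have wE p : i (s p) = i (s' p).
  by move/ffunP/(_ p): ww; rewrite !ffunE.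
have mono m1 s1 t1 p q : reduced i m1 s1 t1 -> i (s1 p) = i (s1 q) ->
    (p < q)%N -> (s1 p < s1 q)%N.
  move=> h1 ii pq; case: (ltngtP (s1 p) (s1 q)) => // [lt|/val_inj/perm_inj pq'].
    by have := reduced_inv h1 pq lt; rewrite ii /far eqxx.
  by move: pq; rewrite pq' ltnn.
have key s1 s2 m1 m2 t1 t2 (p : 'I_n) : reduced i m1 s1 t1 -> reduced i m2 s2 t2 ->
    (forall p, i (s1 p) = i (s2 p)) -> (forall q : 'I_n, (q < p)%N -> s1 q = s2 q) ->
    ~~ (s1 p < s2 p)%N.
  move=> h1 h2 w12 eq12; apply/negP => lt.
  have [q sq] : exists q, s2 q = s1 p by exists (s2^-1 (s1 p))%g; rewrite permKV.
  have iq : i (s2 q) = i (s2 p) by rewrite sq w12.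
  case: (ltngtP q p) => [qp|pq|/val_inj qp].
  - by move: (eq12 q qp); rewrite sq => /perm_inj qp'; rewrite qp' ltnn in qp.
  - by have := mono _ _ _ _ _ h2 (esym iq) pq; rewrite sq; lia.
  - by move: lt; rewrite -sq qp ltnn.
apply/permP=> p; have [k pk] := ubnP (val p); elim: k p pk => // k IHk p pk.
have eq12 (q : 'I_n) : (q < p)%N -> s q = s' q by move=> qp; apply: IHk; exact: leq_trans qp pk.
have := key _ _ _ _ _ _ p h h' wE eq12.
have := key _ _ _ _ _ _ p h' h (fun p => esym (wE p)) (fun q qp => esym (eq12 q qp)).
by rewrite -!leqNgt => h1 h2; apply/val_inj/eqP; rewrite /= eqn_leq h1 h2.
Qed.

Inductive spanned i : A -> Prop :=
| Spanned0 : spanned i 0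
| SpannedD x y of spanned i x & spanned i y : spanned i (x + y)
| SpannedZ c m s t of reduced i m s t : spanned i (sc c * t).

Lemma spanned_stable i (f : A -> A) :
  f 0 = 0 -> (forall x y, f (x + y) = f x + f y) -> (forall c x, f (sc c * x) = sc c * f x) ->
  (forall m s t, reduced i m s t -> spanned i (f t)) ->
  forall x, spanned i x -> spanned i (f x).
Proof.
move=> f0 fD fZ ft x; elim=> [|{}x y _ IHx _ IHy|c m s t h].
- by rewrite f0; constructor.
- by rewrite fD; constructor.
rewrite fZ; elim: (ft _ _ _ h) => [|{}x y _ IHx _ IHy|d m' s' t' h'].
- by rewrite mulr0; constructor.
- by rewrite mulrDr; constructor.
- by rewrite mulrA -scM; apply: SpannedZ h'.
Qed.

Lemma spanned_reduced i m s t : reduced i m s t -> spanned i t.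
Proof. by move=> h; rewrite -[t]mul1r -sc1; apply: SpannedZ h. Qed.

(** The dots vanish, tau kills equal and adjacent letters, and at far letters it either
    prolongs a reduced path or, by the exchange property, cancels its last step. *)
Lemma klr_spanned i x : spanned i (x * E i).
Proof.
have mulsc y c z : y * (sc c * z) = sc c * (y * z) by rewrite mulrA -scC mulrA.
elim/gen_ind: x => [x y hx hy|c|j x|p x|a x].
- by rewrite mulrDl; constructor.
- by apply: SpannedZ; constructor.
- rewrite -mulrA; apply: (spanned_stable (f := fun z => E j * z)) => [|y z|c y|m s t h];
    rewrite ?mulr0 ?mulrDr //; rewrite -(reducedE h) mulrA (klr_idem R).
  case: eqP => _; last by rewrite mul0r; constructor.
  by rewrite (reducedE h); apply: spanned_reduced h.
- rewrite -mulrA; apply: (spanned_stable (f := fun z => X p * z)) => [|y z|c y|m s t h];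
    rewrite ?mulr0 ?mulrDr //; rewrite -(reducedE h) mulrA XE0 mul0r; constructor.
rewrite -mulrA; apply: (spanned_stable (f := fun z => T a * z)) => [|y z|c y|m s t h];
  rewrite ?mulr0 ?mulrDr //.
case: (ltngtP (s (lo a)) (s (hi a))) => [asc|desc|/val_inj/perm_inj/eqP]; last first.
- by rewrite (negPf (lo_neq_hi a)).
- have [m' em] := reduced_descent h desc; subst m.
  have [t' h' ->] := reduced_exchange h desc.
  rewrite (klr_TT _ (reducedE h')); first exact: spanned_reduced h'.
  by rewrite !ffunE tp_lo tp_hi far_sym; apply: (reduced_inv h) => /=.
have [hfar|nfar] := boolP (far (i (s (lo a))) (i (s (hi a)))).
  exact: spanned_reduced (ReducedS h asc hfar).
rewrite -(reducedE h) mulrA; suff -> : T a * E (word_of i s) = 0 by rewrite mul0r; constructor.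
move: nfar; rewrite negb_and !negbK => /orP[/eqP ii|adj].
  by rewrite (@E0 a) ?mulr0 // !ffunE.
by rewrite TE0 // !ffunE.
Qed.

Lemma spanned_corner i j x : spanned i x ->
  E j * x = 0 \/ exists c m s t, reduced i m s t /\ word_of i s = j /\ E j * x = sc c * t.
Proof.
elim=> [|{}x y _ IHx _ IHy|c m s t h]; first by left; rewrite mulr0.
  rewrite mulrDr; case: IHx => [->|[c [m [s [t [h [wj ->]]]]]]]; first by rewrite add0r.
  case: IHy => [->|[c' [m' [s' [t' [h' [wj' ->]]]]]]]; right.
    by exists c, m, s, t; rewrite addr0.
  have ss' : s = s' by apply: reduced_word_inj h h' _; rewrite wj.
  subst s'; rewrite (reduced_unique h' h); exists (c + c'), m, s, t.
  by rewrite scD mulrDl.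
have -> : E j * (sc c * t) = sc c * (E j * t) by rewrite mulrA -scC mulrA.
rewrite -{1}(reducedE h) (mulrA (E j)) (klr_idem R).
case: eqP => [wj|_]; last by left; rewrite mul0r mulr0.
right; exists c, m, s, t; do 2!split=> //.
by rewrite -wj (reducedE h).
Qed.

Local Open Scope classical_set_scope.

Definition col_ideal i : set A := [set x | x * E i = x].

Lemma col_ideal_left i : left_ideal (col_ideal i).
Proof.
split=> [|x y hx hy|a x hx]; rewrite /col_ideal /= ?mul0r //.
  by rewrite mulrDl hx hy.
by rewrite -mulrA hx.
Qed.

(** Each weight space of A e(i) is spanned by one reduced path, and a reduced path can
    be run backwards to e(i). *)
Lemma col_ideal_simple i : E i != 0 -> simple_left_ideal (col_ideal i).
Proof.
move=> Ei; split; first exact: col_ideal_left.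
  move/seteqP => [/(_ (E i))]; rewrite /col_ideal /= (klr_idem R) eqxx => /(_ erefl) /eqP.
  by rewrite (negPf Ei).
move=> L [L0 LD LM] sub; have [Lz|] := pselect (forall x, L x -> x = 0).
  by left; apply/seteqP; split=> x /=; [exact: Lz | move=> ->].
move/existsNP => [x /not_implyP[Lx /eqP x0]]; right.
have xE : x * E i = x by apply: sub.
have [j jx] : exists j, E j * x != 0.
  apply/not_existsP => h; case/eqP: x0.
  rewrite -[x]mul1r -(klr_sum R) mulr_suml big1 // => j _; apply/eqP.
  by apply/negPn/negP; apply: h.
have := klr_spanned i x; rewrite xE => /(spanned_corner j).
case=> [/eqP|[c [m [s [t [h [_ e1]]]]]]]; first by rewrite (negPf jx).
have c0 : c != 0.
  apply: contra jx => /eqP c0; rewrite e1 c0.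
  have -> : sc 0 = 0 by apply: (addrI (sc 0)); rewrite -scD !addr0.
  by rewrite mul0r.
have [y yt] := reduced_inverse h.
have LE : L (E i).
  have -> : E i = (y * sc c^-1) * (E j * x).
    by rewrite e1 mulrA -(mulrA y) -scM mulVf // sc1 mulr1 yt.
  exact: (LM _ _ (LM _ _ Lx)).
by apply/seteqP; split=> [//|z zE]; rewrite -(zE : z * E i = z); apply: LM.
Qed.

Lemma span_semisimple : semisimple_ring A.
Proof.
pose W := [pred i | E i != 0].
exists #|W|, (fun k => col_ideal (enum_val k)); split=> [k|a].
  by apply: col_ideal_simple; have := enum_valP k.
have W0 i : i \notin W -> E i = 0 by rewrite inE negbK => /eqP.
exists [ffun k => a * E (enum_val k)]; split.
  split=> [k|]; first by rewrite /col_ideal /= ffunE -mulrA (klr_idem R) eqxx.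
  rewrite -[LHS]mulr1 -(klr_sum R) mulr_sumr (bigID (mem W)) /= addrC big1 ?add0r.
    by rewrite big_enum_val; apply: eq_bigr => k _; rewrite ffunE.
  by move=> i /W0 ->; rewrite mulr0.
move=> c [hc ac]; apply/ffunP=> k; rewrite ffunE ac mulr_suml (bigD1 k) //= hc.
rewrite big1 ?addr0 // => l lk; rewrite -(hc l) -mulrA (klr_idem R).
by rewrite (inj_eq enum_val_inj) eq_sym (negPf lk) mulr0.
Qed.

End SpanSemisimple.

(** * The energy of a content function *)

Section Profile.
Variables (e n m : nat) (iv : 'I_m -> 'I_e.+1) (G : nat -> nat).
Hypotheses (e_ge2 : (2 <= e)%N) (n_gt0 : (0 < n)%N).
Hypothesis G0 : G 0%N != 1%N.
Hypothesis Ge : G e != 1%N.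
Hypothesis Gtot : (\sum_(0 <= c < e) (G c + G c.+1) <= 2 * n)%N.
Hypothesis edge : forall s, (n <= (iv s).*2.+1)%N /\ (n + (iv s).*2 <= e.*2.+1)%N.
Hypothesis gap : forall s s', s != s' -> (iv s + n <= iv s')%N || (iv s' + n <= iv s)%N.

Definition slope (c : nat) : int := (G c.+1)%:Z - (G c)%:Z.

(** For integers |z| <= z^2, so that the squared slopes dominate the total variation. *)
Lemma slope_tele a b : (a <= b)%N ->
  (G b)%:Z - (G a)%:Z <= \sum_(a <= c < b) slope c ^+ 2 /\
  (G a)%:Z - (G b)%:Z <= \sum_(a <= c < b) slope c ^+ 2.
Proof.
elim: b => [|b IHb]; first by rewrite leqn0 => /eqP ->; rewrite big_geq // subrr.
rewrite leq_eqVlt => /orP[/eqP ->|ab]; first by rewrite big_geq // subrr.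
have [h1 h2] := IHb ab; rewrite big_nat_recr //=.
have h3 : slope b <= slope b ^+ 2 by move: (slope b) => z; rewrite expr2; nia.
have h4 : - slope b <= slope b ^+ 2 by move: (slope b) => z; rewrite expr2; nia.
have h5 : slope b = (G b.+1)%:Z - (G b)%:Z by [].
move: h1 h2 h3 h4 h5; move: (slope b ^+ 2) (\sum_(_ <= _ < _) _) (slope b) => x y z.
by move=> *; split; lia.
Qed.

Lemma trapezoid_ge k a b : (a <= b)%N -> (forall c, (a <= c <= b)%N -> (k <= G c)%N) ->
  (k.*2 * (b - a) <= \sum_(a <= c < b) (G c + G c.+1))%N.
Proof.
move=> ab h; rewrite mulnC -sum_nat_const_nat; rewrite big_nat_cond [leqRHS]big_nat_cond.
by apply: leq_sum => c /andP[hc _]; have := h c; have := h c.+1; lia.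
Qed.

(** Follow G from i_s in both directions down to its first zero, or to an end of the
    quiver. A descent to zero costs at least G(i_s) on its side. If on one side the cost
    is smaller, then G is positive, hence at least 2, all the way to the end; as the total
    content is at most 2n and i_s is at least (n - 1)/2 away from the end, this is possible
    only for G(i_s) = 2 with a drop to 0 in one step on the other side, and the square of
    that slope is 4 = 2 G(i_s). *)
Lemma peak (s : 'I_m) : exists l r, [/\ (l <= iv s <= r)%N, (r <= e)%N,
  forall c, (l < c <= iv s)%N -> (0 < G c)%N,
  forall c, (iv s <= c < r)%N -> (0 < G c)%N &
  2 * (G (iv s))%:Z <= \sum_(l <= c < r) slope c ^+ 2].
Proof.
have [h1 h2] := edge s; have ie : (iv s <= e)%N by rewrite -ltnS ltn_ord.
move: h1 h2 ie; move: (nat_of_ord (iv s)) => i h1 h2 ie.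
have [l [li lz lp]] : exists l, [/\ (l <= i)%N, (G l = 0%N \/ l = 0%N) &
    forall c, (l < c <= i)%N -> (0 < G c)%N].
  elim: i {ie h1 h2} => [|i [l [li lz lp]]].
    by exists 0%N; split=> [//||c]; [right|lia].
  have [z|p] := posnP (G i.+1); first by exists i.+1; split=> [//||c]; [left|lia].
  exists l; split=> [|//|c]; first lia.
  by case: (ltngtP c i.+1) => [ci|ci|->] lc; try lia; apply: lp; lia.
have [r [ir re rz rp]] : exists r, [/\ (i <= r)%N, (r <= e)%N, (G r = 0%N \/ r = e) &
    forall c, (i <= c < r)%N -> (0 < G c)%N].
  move ed : (e - i)%N => d.
  elim: d (i) ie ed {h1 h2 li lp} => [|d IHd] i' ie ed.
    by exists e; split=> [//|//||c]; [right|lia].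
  have [z|p] := posnP (G i'); first by exists i'; split=> [//|//||c]; [left|lia].
  have ie' : (i'.+1 <= e)%N by lia.
  have ed' : (e - i'.+1 = d)%N by lia.
  have [r [ir re rz rp]] := IHd i'.+1 ie' ed'.
  exists r; split=> [|//|//|c]; first lia.
  by case: (ltngtP c i') => [ci|ci|->] lc; try lia; apply: rp; lia.
exists l, r; split=> //; first by rewrite li.
rewrite (@big_cat_nat _ _ _ i) //=.
have [L1 L2] := slope_tele li; have [R1 R2] := slope_tele ir.
have sq_ge0 a b : 0 <= \sum_(a <= c < b) slope c ^+ 2.
  by apply: sumr_ge0 => c _; apply: sqr_ge0.
have [SL eL] : exists x, x = \sum_(l <= c < i) slope c ^+ 2 by eexists.
have [SR eR] : exists x, x = \sum_(i <= c < r) slope c ^+ 2 by eexists.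
have SL0 := sq_ge0 l i; have SR0 := sq_ge0 i r.
rewrite -eL -eR in L1 L2 R1 R2 SL0 SR0 *.
have /orP[Lok|Lbad] := orbN ((G i)%:Z <= SL).
  have /orP[Rok|Rbad] := orbN ((G i)%:Z <= SR); first lia.
  case: rz => [rz|re']; first by move: R2 Rbad; rewrite rz; lia.
  subst r.
  have big q : (i <= q <= e)%N -> (2 <= G q)%N.
    move=> /andP[iq qe]; have [_ A] := slope_tele iq; have [B _] := slope_tele qe.
    have := eR; rewrite (@big_cat_nat _ _ _ q) //=; move: A B Rbad G0 Ge.
    by move: (\sum_(_ <= _ < _) _) (\sum_(_ <= _ < _) _); lia.
  have T := trapezoid_ge ie big.
  case: i => [|i] in h1 h2 ie li lz lp ir rp L1 L2 R1 R2 eL eR Lok Rbad big T *.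
    by move: Gtot T; lia.
  have := Gtot; rewrite (@big_cat_nat _ _ _ i.+1) //= big_nat_recr //= => T3.
  have M2 := big i.+1.
  have [Gi Gp] : G i.+1 = 2%N /\ G i = 0%N.
    by move: T T3 M2; move: (\sum_(_ <= _ < _) _)%N (\sum_(_ <= _ < _) _)%N; lia.
  have li1 : (l <= i)%N.
    rewrite leqNgt; apply/negP => ll; have lE : l = i.+1 by lia.
    by case: lz; rewrite lE ?Gi.
  have h5 : slope i ^+ 2 = 4 by rewrite /slope Gi Gp.
  move: eL (sq_ge0 l i) SR0; rewrite big_nat_recr //= h5 Gi.
  by move: (\sum_(_ <= _ < _) _); lia.
case: lz => [lz|l0]; first by move: L1 Lbad; rewrite lz; lia.
subst l.
have big q : (0 <= q <= i)%N -> (2 <= G q)%N.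
  move=> /andP[iq qe]; have [_ A] := slope_tele iq; have [B _] := slope_tele qe.
  have := eL; rewrite (@big_cat_nat _ _ _ q) //=; move: A B Lbad G0 Ge.
  by move: (\sum_(_ <= _ < _) _) (\sum_(_ <= _ < _) _); lia.
have T := trapezoid_ge (leq0n i) big.
have ilt : (i < e)%N.
  rewrite ltn_neqAle ie andbT; apply/eqP => ie'; move: Gtot T; rewrite ie'.
  by move: (\sum_(_ <= _ < _) _)%N; lia.
have := Gtot; rewrite (@big_cat_nat _ _ _ i) //= (big_ltn ilt) //= => T3.
have M2 := big i.
have [Gi Gp] : G i = 2%N /\ G i.+1 = 0%N.
  by move: T T3 M2; move: (\sum_(_ <= _ < _) _)%N (\sum_(_ <= _ < _) _)%N; lia.
have li1 : (i < r)%N.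
  rewrite ltnNge; apply/negP => ll; have lE : r = i by lia.
  by case: rz; rewrite lE ?Gi // => ie'; rewrite ie' ltnn in ilt.
have h5 : slope i ^+ 2 = 4 by rewrite /slope Gi Gp.
move: eR (sq_ge0 i.+1 r) SL0; rewrite (big_ltn li1) //= h5 Gi.
by move: (\sum_(_ <= _ < _) _); lia.
Qed.

(** The intervals found by peak for two different s are disjoint: sharing an edge would
    make G positive on the whole way between the two vertices, whose distance is at least
    n, and this needs a larger content than is available. *)
Lemma profile_ge0 :
  2 * (\sum_s (G (iv s))%:Z) <= \sum_(0 <= c < e) slope c ^+ 2.
Proof.
have /fin_all_exists[l /fin_all_exists[r lr]] := peak.
have le1 c : \sum_(s < m) (l s <= c < r s)%:R <= (1 : int).
  rewrite -natr_sum -[1]/(1%:R) ler_nat.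
  have -> : (\sum_(s < m) (l s <= c < r s)%N = #|[pred s | l s <= c < r s]|)%N.
    by rewrite -sum1_card [RHS]big_mkcond; apply: eq_bigr => s _; rewrite inE; case: ifP.
  apply/card_le1_eqP => s s'; rewrite !inE => hs hs'.
  apply/eqP/negPn/negP => ss'.
  wlog lt : s s' hs hs' ss' / (iv s + n <= iv s')%N.
    move=> W; case/orP: (gap ss') => h; last exact: (W s s' hs hs' ss' h).
    by apply: (W s' s hs' hs _ h); rewrite eq_sym.
  have [h1 h2 h3 h4 _] := lr s; have [h1' h2' h3' h4' _] := lr s'.
  have pos x : (iv s <= x <= iv s')%N -> (1 <= G x)%N.
    by move=> hx; case: (leqP x c) => xc; [apply: h4 | apply: h3']; lia.
  have ss : (iv s <= iv s')%N by lia.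
  have T := trapezoid_ge ss pos; have Gs := pos (iv s).
  have := Gtot; have ise : (iv s' <= e)%N by rewrite -ltnS ltn_ord.
  rewrite (@big_cat_nat _ _ _ (iv s)) //=; last exact: leq_trans ise.
  rewrite (@big_cat_nat _ _ _ (iv s') (iv s)) //=.
  case: (posnP (iv s)) => [i0|ip].
    have T1 := @trapezoid_ge 1 1 (iv s').
    rewrite {}i0 in lt ss pos T Gs *.
    rewrite [X in (_ + (X + _))%N]big_ltn; last lia.
    have G1 : (1 <= G 1)%N by apply: pos; lia.
    have T2 : (1.*2 * (iv s' - 1) <= \sum_(1 <= c < iv s') (G c + G c.+1))%N.
      by apply: T1; [lia | move=> x hx; apply: pos; lia].
    move: T2 G1 Gs G0; move: (\sum_(_ <= _ < _) _)%N (\sum_(_ <= _ < _) _)%N => u v; lia.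
  move: T Gs; rewrite -(prednK ip) big_nat_recr //= (prednK ip).
  move: (\sum_(_ <= _ < _) _)%N (\sum_(_ <= _ < _) _)%N => u v; lia.
rewrite mulr_sumr.
apply: (le_trans (y := \sum_s \sum_(0 <= c < e) (l s <= c < r s)%:R * slope c ^+ 2)).
  apply: ler_sum => s _; have [h1 h2 h3 h4 h5] := lr s; apply: le_trans h5 _.
  rewrite [leRHS](@big_cat_nat _ _ _ (l s)) //=; [|lia..].
  rewrite [X in _ <= _ + X](@big_cat_nat _ _ _ (r s)) //=; [|lia..].
  rewrite -[leLHS]add0r -[X in _ + X <= _]addr0.
  apply: lerD; first by apply: sumr_ge0 => c _; rewrite mulr_ge0 ?ler0n ?sqr_ge0.
  apply: lerD; last by apply: sumr_ge0 => c _; rewrite mulr_ge0 ?ler0n ?sqr_ge0.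
  by apply: ler_sum_nat => c ->; rewrite mul1r.
rewrite exchange_big /=; apply: ler_sum => c _; rewrite -mulr_suml.
by rewrite ler_piMl ?sqr_ge0.
Qed.

End Profile.

Section Energy.
Variables (e m : nat) (iv : 'I_m -> 'I_e.+1).
Hypothesis e_ge2 : (2 <= e)%N.
Local Notation Lam := (\sum_(s < m) fundamental_weight (iv s)).

(** Contents are counted twice at the long vertices. This symmetrises the Cartan matrix,
    and turns the slack into a discrete Laplacian. *)
Definition mult (b : nat) : nat := if (b == 0)%N || (b == e) then 2 else 1.
Definition content (b x : nat) : nat := if x == b then mult b else 0.

Definition lap (G : nat -> nat) (c : nat) : int :=
  (if (c < e)%N then slope G c else 0) - (if (0 < c)%N then slope G c.-1 else 0).

Definition energy (G : nat -> nat) : int :=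
  \sum_(0 <= c < e) slope G c ^+ 2 - 2 * \sum_s (G (iv s))%:Z.

Lemma sum_pick (F : nat -> int) b :
  \sum_(0 <= c < e) (if c == b then F c else 0) = if (b < e)%N then F b else 0.
Proof. by rewrite -big_mkcond big_nat1_eq. Qed.

Lemma sum_pickS (F : nat -> int) b : (b <= e)%N ->
  \sum_(0 <= c < e) (if c.+1 == b then F c else 0) = if (0 < b)%N then F b.-1 else 0.
Proof.
case: b => [|b] be /=; first by rewrite big1.
by rewrite sum_pick be.
Qed.

Lemma LamE c : Lam c = (\sum_(s < m) (iv s == c))%N.
Proof.
rewrite sum_ffunE; apply: eq_bigr => s _; by rewrite ffunE.
Qed.

(** The energy is a quadratic function whose gradient is the Laplacian, so a step in
    direction b changes it by a linear term and a constant. *)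
Lemma energy_add G (b : 'I_e.+1) :
  energy (fun x => (G x + content b x)%N) =
  energy G + 2 * (mult b)%:Z * (1 - ((Lam b)%:Z + lap G b)).
Proof.
have be : (b <= e)%N by rewrite -ltnS ltn_ord.
pose w := (mult b)%:Z.
have sE c : slope (fun x => (G x + content b x)%N) c ^+ 2 = slope G c ^+ 2 +
    ((if c.+1 == b :> nat then 2 * w * slope G c + w ^+ 2 else 0) +
     (if c == b :> nat then - (2 * w * slope G c) + w ^+ 2 else 0)).
  rewrite /slope /content /w; case: (eqVneq c (b : nat)) => [->|_].
    have -> : (b.+1 == b :> nat) = false by lia.
    by rewrite addn0 add0r PoszD; move: (mult b) => u; ring.
  by case: eqP => _; rewrite ?addn0 ?addr0 ?PoszD //; move: (mult b) => u; ring.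
have LE : \sum_s (G (iv s) + content b (iv s))%N%:Z = \sum_s (G (iv s))%:Z + w * (Lam b)%:Z.
  rewrite LamE -[(\sum_(s < m) _)%N%:Z]natz natr_sum mulr_sumr -big_split.
  apply: eq_bigr => s _ /=; rewrite PoszD /content -(inj_eq val_inj) /= /w.
  by case: eqP => _; rewrite ?mulr1 ?mulr0.
rewrite /energy LE; under eq_bigr do rewrite sE.
rewrite !big_split /= sum_pick sum_pickS // /lap.
rewrite -/w; have : w = if (b == 0 :> nat)%N || (b == e :> nat) then 2 else 1.
  by rewrite /w /mult; case: ifP.
case: (posnP b) => b0.
  have -> : (b < e)%N by lia.
  rewrite orTb => ->; ring.
case: (ltnP b e) => b1.
  by rewrite (ltn_eqF b1) => ->; ring.
have -> : b == e :> nat by lia.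
by rewrite orbT => ->; ring.
Qed.

End Energy.

Section Bridge.
Variables (e n m : nat) (iv : 'I_m -> 'I_e.+1).
Hypotheses (e_ge2 : (2 <= e)%N) (n_gt0 : (0 < n)%N).
Local Notation I := 'I_e.+1.
Local Notation Lam := (\sum_(s < m) fundamental_weight (iv s)).
Hypothesis edge : forall s, (n <= (iv s).*2.+1)%N /\ (n + (iv s).*2 <= e.*2.+1)%N.
Hypothesis gap : forall s s', s != s' -> (iv s + n <= iv s')%N || (iv s' + n <= iv s)%N.
Implicit Types (i : {ffun 'I_n -> I}).

Definition prof i (k x : nat) : nat := (\sum_(t < n | (t < k)%N) content e (i t) x)%N.

Lemma profS i (t : 'I_n) x : prof i t.+1 x = (prof i t x + content e (i t) x)%N.
Proof.
rewrite /prof (bigD1 t) //= addnC; congr (_ + _)%N; apply: eq_bigl => s.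
by rewrite -(inj_eq val_inj) /=; lia.
Qed.

Lemma lapD G H c : lap e (fun x => (G x + H x)%N) c = lap e G c + lap e H c.
Proof. by rewrite /lap /slope !PoszD; case: ifP => _; case: ifP => _; ring. Qed.

Lemma lap_content (b c : I) : lap e (content e b) c = - cartan c b.
Proof.
have bc : (c == b) = (c == b :> nat) by [].
have := ltn_ord b; have := ltn_ord c; rewrite /lap /slope /content /cartan /mult bc /double_arrow /adjacent.
move: (val b) (val c) => /= {bc} u v hv hu.
repeat case: ifP => ?; lia.
Qed.

Lemma slack_lap i k c : (k <= n)%N -> slack Lam i k c = (Lam c)%:Z + lap e (prof i k) c.
Proof.
elim: k => [|k IHk] kn.
  have p0 x : prof i 0 x = 0%N by rewrite /prof big_pred0.
  by rewrite slack0 /lap /slope !p0 subrr !if_same subrr addr0.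
pose t := Ordinal kn; rewrite (slackS _ _ t) IHk ?(ltnW kn) // -addrA; congr (_ + _).
rewrite -lap_content -lapD /lap /slope -!(profS i t) //.
Qed.

(** Letters of slack 1 are those that leave the energy unchanged. *)
Lemma good_energy i k : (k <= n)%N -> good Lam i k -> energy iv (prof i k) = 0.
Proof.
elim: k => [|k IHk] kn.
  move=> _; have p0 x : prof i 0 x = 0%N by rewrite /prof big_pred0.
  by rewrite /energy !big1 ?mulr0 ?subrr // => s _; rewrite /slope ?p0.
pose t := Ordinal kn; rewrite (goodS _ _ t) => /andP[gk /eqP st].
have -> : energy iv (prof i k.+1) = energy iv (fun x => (prof i k x + content e (i t) x)%N).
  rewrite /energy; congr (_ - 2 * _); apply: eq_bigr => s _; rewrite /slope ?(profS i t) //.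
by rewrite energy_add // IHk ?(ltnW kn) // -slack_lap ?(ltnW kn) // st subrr mulr0.
Qed.

Lemma content_trapezoid (b : I) : (\sum_(0 <= c < e) (content e b c + content e b c.+1) = 2)%N.
Proof.
have be : (b <= e)%N by rewrite -ltnS.
have h1 : \sum_(0 <= c < e) (content e b c)%:R = if (b < e)%N then (mult e b)%:Z else 0.
  rewrite -(sum_pick e (fun=> (mult e b)%:Z)); apply: eq_bigr => c _.
  by rewrite /content natz; case: eqP.
have h2 : \sum_(0 <= c < e) (content e b c.+1)%:R = if (0 < b)%N then (mult e b)%:Z else 0.
  rewrite -(sum_pickS (fun=> (mult e b)%:Z) be); apply: eq_bigr => c _.
  by rewrite /content natz; case: eqP.
apply/eqP; rewrite -(eqr_nat int) natr_sum; under eq_bigr do rewrite natrD.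
by rewrite big_split /= h1 h2 /mult; repeat case: ifP => ?; lia.
Qed.

(** A good word has energy 0, and one more letter c changes the energy by a positive
    multiple of 1 - slack: a slack above 1 would make it negative. *)
Lemma good_slack_le1 i k c : (k < n)%N -> good Lam i k -> slack Lam i k c <= 1.
Proof.
move=> kn gk; pose G x := (prof i k x + content e c x)%N.
have ev x : (x == 0)%N || (x == e) -> G x != 1%N.
  move=> hx; have h b : odd (content e b x) = false.
    by rewrite /content /mult; case: eqP => // <-; rewrite hx.
  suff : odd (G x) = false by case: (G x) => [|[]].
  rewrite oddD h addbF /prof; elim/big_ind: _ => // u v hu hv; by rewrite oddD hu hv.
have tot : (\sum_(0 <= x < e) (G x + G x.+1) <= 2 * n)%N.
  have -> : (\sum_(0 <= x < e) (G x + G x.+1) =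
     \sum_(t < n | (t < k)%N) \sum_(0 <= x < e) (content e (i t) x + content e (i t) x.+1)
     + \sum_(0 <= x < e) (content e c x + content e c x.+1))%N.
    rewrite exchange_big -big_split /=; apply: eq_bigr => x _.
    by rewrite big_split /= /G /prof addnACA.
  rewrite content_trapezoid; under eq_bigr do rewrite content_trapezoid.
  by rewrite (big_ord_narrow (ltnW kn)) sum_nat_const card_ord; lia.
have h : 0 <= energy iv G.
  rewrite subr_ge0; apply: (profile_ge0 e_ge2 n_gt0 _ _ tot edge gap); by apply: ev; rewrite eqxx ?orbT.
move: h; rewrite energy_add // good_energy ?(ltnW kn) // -slack_lap ?(ltnW kn) // add0r.
have : (0 < mult e c)%N by rewrite /mult; case: ifP.
by move: (slack _ _ _ _) (mult e c) => x y; nia.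
Qed.

End Bridge.

(** * The presentation of the cyclotomic quotient *)

Section QuotientFacts.
Variables (A : pzRingType) (S : set A).

Lemma quot_pi_surj (z : quot_ring S) : exists x, z = quot_pi S x.
Proof. by exists (generic_quotient.repr z); rewrite /quot_pi reprK. Qed.

Lemma quot_pi_eq (x y : A) : generated_ideal S (x - y) <-> quot_pi S x = quot_pi S y.
Proof.
split=> [h|/eqP h]; last exact/quot_ringP.
by apply/eqP; apply/quot_ringP.
Qed.

Lemma generated_ideal_mem (x : A) : S x -> generated_ideal S x.
Proof. by move=> Sx J [_ SJ]; apply: SJ. Qed.

Lemma quot_pi_sum0 (J : finType) (F : J -> A) g :
  g = \sum_j F j -> S g -> \sum_j quot_pi S (F j) = 0.
Proof.
move=> gE Sg; rewrite -rmorph_sum -gE -(rmorph0 (quot_pi S)).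
by apply/quot_pi_eq; rewrite subr0; apply: generated_ideal_mem.
Qed.

End QuotientFacts.

Section FreeAlgebra.
Variables (K : fieldType) (I : finType) (n : nat).
Local Notation FA := (free_alg K I n).

Lemma free_alg_ind (P : FA -> Prop) :
  (forall x y, P x -> P y -> P (x + y)) -> (forall c, P c%:A) ->
  (forall g x, P x -> P (free_gen K g * x)) -> forall x, P x.
Proof.
move=> PD Pc Pg x; rewrite [x]monalgE.
have Pm (k : {fmonom qh_gen I n}) c : P << c *g k >>.
  have -> : k = FMonom (fmonom_val k) by case: k.
  elim: (fmonom_val k) => [|g s IHs].
    have := Pc c; rewrite -mul_malgC mulr1.
    by congr P; congr mkmalgU; rewrite -fmoneE.
  have := Pg g _ IHs; congr P.
  rewrite /free_gen malgM_def fgmulUU mul1r; congr mkmalgU.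
  by apply/eqP; rewrite fmP fmM fmU.
elim/big_ind: _ => [|u v|k _]; [|exact: PD|exact: Pm].
by have := Pc 0; rewrite scale0r.
Qed.

Lemma free_alg_scalar_comm (c : K) (x : FA) : c%:A * x = x * c%:A.
Proof.
rewrite -[c%:A]mul_malgC mulr1 mul_malgC malgM_def fgmulgU malgZ_def /fgscale.
by apply: eq_bigr => k _; rewrite mulrC mulm1.
Qed.

Lemma free_alg_scalarM (c d : K) : (c * d)%:A = c%:A * d%:A :> FA.
Proof. by rewrite -scalerAl mul1r scalerA. Qed.

End FreeAlgebra.

Section Presentation.
Variables (K : fieldType) (e n : nat) (o : nat -> bool).
Local Notation I := 'I_e.+1.
Local Notation FA := (free_alg K I n).
Local Notation Q := (@QC1 e o K).

Lemma evQ_rmorph (A B : pzRingType) (f : {rmorphism A -> B}) (i j : I) u v :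
  f (evQ o i j u v) = evQ o i j (f u) (f v).
Proof.
rewrite /evQ; case: (single_arrow e o i j); last case: (single_arrow e o j i);
  last case: (double_arrow e i j); last case: (double_arrow e j i);
  last case: (i == j); by rewrite ?rmorphB ?rmorphXn ?rmorph0 ?rmorph1.
Qed.

Lemma evD_rmorph (A B : pzRingType) (f : {rmorphism A -> B}) (i j : I) w u v :
  f (evD o i j w u v) = evD o i j (f w) (f u) (f v).
Proof.
rewrite /evD; case: (single_arrow e o i j); last case: (single_arrow e o j i);
  last case: (double_arrow e i j); last case: (double_arrow e j i);
  by rewrite ?rmorphN ?rmorphD ?rmorph0 ?rmorph1.
Qed.

Section LalgMorphism.
Variables (A : lalgType K) (B : pzRingType) (f : {rmorphism A -> B}).
Implicit Types x y z t w : A.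

Lemma lmorph_if (b : bool) x y : f x = f (if b then y else 0) ->
  f x = if b then f y else 0.
Proof. by case: b => // ->; rewrite rmorph0. Qed.

Lemma lmorph_idem (b : bool) x y z : f (x * y) = f (if b then z else 0) ->
  f x * f y = if b then f z else 0.
Proof. by move/lmorph_if => <-; rewrite rmorphM. Qed.

Lemma lmorph_sum (J : finType) (F : J -> A) : f (\sum_j F j) = f 1 -> \sum_j f (F j) = 1.
Proof. by rewrite rmorph_sum rmorph1. Qed.

Lemma lmorph_comm x y z t : f (x * y) = f (z * t) -> f x * f y = f z * f t.
Proof. by rewrite !rmorphM. Qed.

Lemma lmorph_tx (b : bool) x y z t w :
  f ((x * y - z * t) * w) = f (if b then w else 0) ->
  (f x * f y - f z * f t) * f w = if b then f w else 0.
Proof. by move/lmorph_if => <-; rewrite rmorphM rmorphB !rmorphM. Qed.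

Lemma lmorph_t2 (i j : I) x y z t : f (x ^+ 2 * y) = f (evQ o i j z t * y) ->
  f x * f x * f y = evQ o i j (f z) (f t) * f y.
Proof. by rewrite !rmorphM /= evQ_rmorph. Qed.

Lemma lmorph_braid3 (b : bool) (i j : I) x y w z t u :
  f ((x * y * x - y * x * y) * w) = f (if b then evD o i j z t u * w else 0) ->
  (f x * f y * f x - f y * f x * f y) * f w =
  if b then evD o i j (f z) (f t) (f u) * f w else 0.
Proof.
by move/lmorph_if; rewrite !rmorphM !rmorphB !rmorphM evD_rmorph.
Qed.
End LalgMorphism.

Lemma klr_of_morphism (B : pzRingType) (f : {rmorphism FA -> B}) :
  (forall l r, qh_rel Q l r -> f l = f r) ->
  klr_relations o (fun i => f (free_gen K (inl i))) (fun p => f (free_gen K (inr (inl p))))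
    (fun a => f (free_gen K (inr (inr a)))).
Proof.
move=> fr; split.
- move=> i j; exact: lmorph_idem (fr _ _ (qh_idem Q i j)).
- exact: lmorph_sum (fr _ _ (qh_sum Q n)).
- move=> p q; exact: lmorph_comm (fr _ _ (qh_xx Q p q)).
- move=> p i; exact: lmorph_comm (fr _ _ (qh_xe Q p i)).
- move=> a i; exact: lmorph_comm (fr _ _ (@qh_taue _ _ Q _ a (lo a) (hi a) i erefl erefl)).
- move=> a p h1 h2; exact: lmorph_comm (fr _ _ (@qh_taux _ _ Q _ a p h1 h2)).
- move=> a i; exact: lmorph_tx (fr _ _ (@qh_tauxr _ _ Q _ a (lo a) (hi a) i erefl erefl)).
- move=> a i; exact: lmorph_tx (fr _ _ (@qh_tauxl _ _ Q _ a (lo a) (hi a) i erefl erefl)).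
- move=> a i; have := fr _ _ (@qh_tau2 _ _ Q _ a (lo a) (hi a) i erefl erefl).
  rewrite eval2_QC1; exact: lmorph_t2.
- move=> a b ab; exact: lmorph_comm (fr _ _ (@qh_tautau _ _ Q _ a b ab)).
- move=> a b i ba; have rE : hi b = a.+2 :> nat by rewrite /= ba.
  have := fr _ _ (@qh_braid _ _ Q _ a b (lo a) (hi a) (hi b) i ba erefl erefl rE).
  rewrite eval3_QC1; exact: lmorph_braid3.
Qed.

Variables (Lam : {ffun I -> nat}) (n_gt0 : (0 < n)%N).

Local Notation qpi := (@quot_pi FA [set z : FA | exists l r, qh_rel Q l r /\ z = l - r]).
Local Notation cpi := (@quot_pi (quiver_hecke Q n) [set cyclotomic_gen Q Lam n_gt0]).

Lemma qpi_rel l r : qh_rel Q l r -> qpi l = qpi r.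
Proof.
by move=> lr; apply/quot_pi_eq; apply: generated_ideal_mem; exists l, r.
Qed.

Definition cyc_pi : FA -> cyclotomic_quiver_hecke Q Lam n_gt0 := cpi \o qpi.
HB.instance Definition _ := GRing.RMorphism.on cyc_pi.

Lemma cyc_pi_surj z : exists x, z = cyc_pi x.
Proof.
by have [y ->] := quot_pi_surj z; have [x ->] := quot_pi_surj y; exists x.
Qed.

Local Notation cE := (fun i => cyc_pi (free_gen K (inl i))).
Local Notation cX := (fun p => cyc_pi (free_gen K (inr (inl p)))).
Local Notation cT := (fun a => cyc_pi (free_gen K (inr (inr a)))).

Lemma cyc_klr : klr_relations o cE cX cT.
Proof.
apply: (@klr_of_morphism _ cyc_pi) => l r lr.
exact: (congr1 cpi (qpi_rel lr)).
Qed.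

(** Multiplication by e(i) isolates one summand of the generator of the ideal. *)
Lemma cyc_gen (p : 'I_n) (i : {ffun 'I_n -> I}) : p = 0%N :> nat -> cX p ^+ Lam (i p) * cE i = 0.
Proof.
move=> p0; have -> : p = Ordinal n_gt0 by apply: val_inj.
have h : \sum_(j : {ffun 'I_n -> I}) cX (Ordinal n_gt0) ^+ Lam (j (Ordinal n_gt0)) * cE j = 0.
  rewrite -[RHS](@quot_pi_sum0 _ [set cyclotomic_gen Q Lam n_gt0] _ _
    (cyclotomic_gen Q Lam n_gt0) erefl erefl).
  by apply: eq_bigr => j _; rewrite rmorphM rmorphXn.
have := congr1 (fun z => z * cE i) h; rewrite mul0r mulr_suml (bigD1 i) //= big1.
  rewrite addr0 -mulrA.
  by have := klr_idem cyc_klr i i; rewrite eqxx => ->.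
move=> j ji; rewrite -mulrA.
by have := klr_idem cyc_klr i j; rewrite eq_sym (negPf ji) => ->; rewrite mulr0.
Qed.

End Presentation.

(** * The two conditions are sufficient *)

Theorem cyclotomic_semisimple (K : fieldType) (e n m : nat) (o : nat -> bool)
    (iv : 'I_m -> 'I_e.+1) (e_ge2 : (2 <= e)%N) (n_gt0 : (0 < n)%N) :
  (forall s, (n <= (iv s).*2.+1)%N /\ (n + (iv s).*2 <= e.*2.+1)%N) ->
  (forall s s', s != s' -> (iv s + n <= iv s')%N || (iv s' + n <= iv s)%N) ->
  semisimple_ring (cyclotomic_quiver_hecke (@QC1 e o K)
    (\sum_(s < m) fundamental_weight (iv s)) n_gt0).
Proof.
move=> edge gap; set Lam := \sum_(s < m) _.
have R := cyc_klr K o Lam n_gt0.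
have cyc := @cyc_gen K e n o Lam n_gt0.
have le1 (i : {ffun 'I_n -> 'I_e.+1}) k c : (k < n)%N -> good Lam i k -> slack Lam i k c <= 1.
  exact: good_slack_le1.
apply: (span_semisimple e_ge2 R (sc := fun c : K => cyc_pi o Lam n_gt0 c%:A)).
- by rewrite scale1r rmorph1.
- by move=> c d; rewrite scalerDl rmorphD.
- by move=> c d; rewrite free_alg_scalarM rmorphM.
- by move=> c z; have [x ->] := cyc_pi_surj z; rewrite -!rmorphM free_alg_scalar_comm.
- move=> P PD Pc PE PX PT z; have [x ->] := cyc_pi_surj z.
  elim/free_alg_ind: x => [x y Px Py|c|[i|[p|a]] x Px]; rewrite ?rmorphD ?rmorphM.
  + exact: PD.
  + exact: Pc.
  + exact: PE.
  + exact: PX.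
  + exact: PT.
- by move=> p i; exact: (klr_vanishX e_ge2 R cyc le1).
- exact: (klr_vanishT e_ge2 R cyc le1).
- exact: (klr_vanishE e_ge2 R cyc le1).
Qed.

(** * Seminormal form on shuffles of two rows *)

Section EvQComm.
Variables (e : nat) (o : nat -> bool).
Hypothesis e_ge2 : (2 <= e)%N.
Local Notation I := 'I_e.+1.

Lemma evQ_sym (B : comPzRingType) (i j : I) (u v : B) : evQ o i j u v = evQ o j i v u.
Proof.
have [->|ij] := eqVneq i j; first by rewrite !evQ_same.
have [adj|nadj] := boolP (adjacent i j); last first.
  by rewrite !evQ_far // 1?eq_sym // adjacent_sym.
by case: (edgeP o e_ge2 adj) => h1 _ h2 _; rewrite h1 h2.
Qed.

Lemma evD_evQ (B : comPzRingType) (i j : I) (w u v : B) :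
  evD o i j w u v * (w - u) = evQ o i j w v - evQ o i j u v.
Proof.
have [->|ij] := eqVneq i j.
  rewrite !evQ_same // subrr /evD /single_arrow /double_arrow !ifF ?mul0r //; lia.
have [adj|nadj] := boolP (adjacent i j); last first.
  rewrite !evQ_far // subrr; move: nadj; rewrite /evD /adjacent /single_arrow /double_arrow => h.
  by rewrite !ifF ?mul0r //; move: h; case: (o i); case: (o j) => /=; lia.
by case: (edgeP o e_ge2 adj) => h1 h2 _ _; rewrite !h1 h2; ring.
Qed.

End EvQComm.

Section States.
Variable n : nat.
Local Notation S := {ffun 'I_n -> bool}.
Implicit Types (s : S) (a b : 'I_n.-1) (p : 'I_n).

Definition cnt (c : bool) s (k : nat) : nat := \sum_(r < n | (r < k)%N) (s r == c).

Lemma cnt0 c s : cnt c s 0 = 0%N.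
Proof. by rewrite /cnt big_pred0. Qed.

Lemma cntS c s p : cnt c s p.+1 = (cnt c s p + (s p == c))%N.
Proof.
rewrite /cnt (bigD1 p) //= addnC; congr (_ + _)%N; apply: eq_bigl => r.
by rewrite -(inj_eq val_inj) /=; lia.
Qed.

Lemma cnt_eq c s s' k : (forall r : 'I_n, (r < k)%N -> s r = s' r) -> cnt c s k = cnt c s' k.
Proof. by move=> h; apply: eq_bigr => r /h ->. Qed.

Lemma cnt_sw c a s k : k != a.+1 -> cnt c (sw a s) k = cnt c s k.
Proof.
move=> ka; have [kl|kl] := leqP k a; first by apply: cnt_eq => r rk; rewrite sw_ne //; lia.
have {ka kl} : (a.+2 <= k)%N by lia.
elim: k => [//|k IHk]; rewrite leq_eqVlt => /orP[/eqP [<-]|lt].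
  rewrite (cntS c _ (hi a)) (cntS c _ (lo a)) (cntS c s (hi a)) (cntS c s (lo a)).
  rewrite sw_lo sw_hi addnAC; congr (_ + _ + _)%N.
  by apply: cnt_eq => r ra; rewrite sw_ne //; move: ra => /=; lia.
have [kn|kn] := ltnP k n; last first.
  have big c' s' : cnt c' s' k.+1 = cnt c' s' k.
    by apply: eq_bigl => r; have := ltn_ord r; lia.
  by rewrite !big IHk.
rewrite !(cntS c _ (Ordinal kn)) /= IHk // sw_ne //=; lia.
Qed.

(** A state tells for each position from which of two rows of letters its entry is taken,
    each row being used in order: false stands for row A, true for row B. The rank is the
    index of the entry in its row. *)
Definition rank s p : nat := cnt (s p) s p.

Lemma rank_sw_lo a s : s (lo a) != s (hi a) -> rank (sw a s) (lo a) = rank s (hi a).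
Proof.
move=> ne; rewrite /rank sw_lo cnt_sw /=; last by lia.
by rewrite (cntS _ s (lo a)) (negPf ne) addn0.
Qed.

Lemma rank_sw_hi a s : s (lo a) != s (hi a) -> rank (sw a s) (hi a) = rank s (lo a).
Proof.
move=> ne; rewrite /rank sw_hi (cntS _ _ (lo a)) sw_lo eq_sym (negPf ne) addn0.
by rewrite cnt_sw //=; lia.
Qed.

Lemma rank_sw_ne a s p : p != a :> nat -> p != a.+1 :> nat -> rank (sw a s) p = rank s p.
Proof. by move=> h1 h2; rewrite /rank sw_ne // cnt_sw. Qed.

Lemma rank_same a s : s (lo a) = s (hi a) -> rank s (hi a) = (rank s (lo a)).+1.
Proof. by move=> h; rewrite /rank (cntS _ s (lo a)) -h eqxx addn1. Qed.

End States.

(** The rows have letters L and eigenvalues W, and the states index a basis. Dots are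
    diagonal, and tau_a relates the two states that differ at a, a + 1, in the way of
    Young's seminormal form. Two entries of the same row do not cross: row_Q and row_D
    say that the letters of one row, with tau = 0, already form a representation. Equal
    letters of different rows have different eigenvalues by W_ne. *)
Section SeminormalModule.
Variables (n e : nat) (o : nat -> bool).
Hypothesis e_ge2 : (2 <= e)%N.
Local Notation I := 'I_e.+1.
Local Notation S := {ffun 'I_n -> bool}.
Variables (F : fieldType) (L : bool -> nat -> I) (W : bool -> nat -> F).
Hypothesis L_ne : forall c r, L c r != L c r.+1.
Hypothesis row_Q : forall c r, evQ o (L c r) (L c r.+1) (W c r) (W c r.+1) = 0.
Hypothesis row_D : forall c r, L c r = L c r.+2 ->
  evD o (L c r) (L c r.+1) (W c r.+2) (W c r) (W c r.+1) = 0.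
Hypothesis W_ne : forall c r t, L c r = L (~~ c) t -> W c r != W (~~ c) t.
Implicit Types (s : S) (a b : 'I_n.-1) (p q : 'I_n) (i : {ffun 'I_n -> I}).

Definition letter s p : I := L (s p) (rank s p).
Definition value s p : F := W (s p) (rank s p).
Definition word s : {ffun 'I_n -> I} := [ffun p => letter s p].

Definition state_vec := {ffun S -> F^o}.
Implicit Types f g : state_vec.

Definition eop i f : state_vec := [ffun s : S => if word s == i then f s else 0].
Definition xop p f : state_vec := [ffun s : S => value s p * f s].
Definition dcoef a s : F :=
  if letter s (lo a) == letter s (hi a) then (value s (hi a) - value s (lo a))^-1 else 0.
Definition qcoef a s : F :=
  evQ o (letter s (lo a)) (letter s (hi a)) (value s (lo a)) (value s (hi a)).
(** The coefficient of tau_a from the swapped state into s. The product of the two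
    coefficients in opposite directions is Q minus the square of the diagonal entry; the
    normalisation gives coefficient 1 to the step that moves row B to the left. *)
Definition kcoef a s : F :=
  if s (lo a) then 1
  else if letter s (lo a) == letter s (hi a) then - dcoef a s ^+ 2 else qcoef a s.
Definition top a f : state_vec := [ffun s : S =>
  if s (lo a) == s (hi a) then 0 else dcoef a s * f s + kcoef a s * f (sw a s)].
Definition qop a f : state_vec := [ffun s : S => qcoef a s * f s].
Definition sameop p q f : state_vec := [ffun s : S => if letter s p == letter s q then f s else 0].
Definition dop p q r f : state_vec := [ffun s : S => if letter s p == letter s r
  then evD o (letter s p) (letter s q) (value s r) (value s p) (value s q) * f s else 0].

Section Swap.
Variables (a : 'I_n.-1) (s : S).
Hypothesis ne : s (lo a) != s (hi a).

Lemma letter_lo : letter (sw a s) (lo a) = letter s (hi a).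
Proof. by rewrite /letter rank_sw_lo // sw_lo. Qed.
Lemma letter_hi : letter (sw a s) (hi a) = letter s (lo a).
Proof. by rewrite /letter rank_sw_hi // sw_hi. Qed.
Lemma value_lo : value (sw a s) (lo a) = value s (hi a).
Proof. by rewrite /value rank_sw_lo // sw_lo. Qed.
Lemma value_hi : value (sw a s) (hi a) = value s (lo a).
Proof. by rewrite /value rank_sw_hi // sw_hi. Qed.
Lemma sw_neq : sw a s (lo a) != sw a s (hi a).
Proof. by rewrite sw_lo sw_hi eq_sym. Qed.

Lemma word_sw : word (sw a s) = sw a (word s).
Proof.
apply/ffunP=> p; rewrite ffunE.
have [->|h1] := eqVneq p (lo a); first by rewrite letter_lo sw_lo ffunE.
have [->|h2] := eqVneq p (hi a); first by rewrite letter_hi sw_hi ffunE.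
move: h1 h2; rewrite -!(inj_eq val_inj) /= => h1 h2.
by rewrite sw_ne // ffunE /letter rank_sw_ne // sw_ne.
Qed.

Lemma dcoef_sw : dcoef a (sw a s) = - dcoef a s.
Proof.
rewrite /dcoef letter_lo letter_hi value_lo value_hi eq_sym.
by case: ifP; rewrite ?oppr0 // -invrN opprB.
Qed.

Lemma qcoef_sw : qcoef a (sw a s) = qcoef a s.
Proof. by rewrite /qcoef letter_lo letter_hi value_lo value_hi evQ_sym. Qed.

Lemma dcoef_sub : letter s (lo a) = letter s (hi a) ->
  dcoef a s * (value s (hi a) - value s (lo a)) = 1.
Proof.
move=> h; rewrite /dcoef h eqxx mulVf // subr_eq0 /value.
have -> : s (lo a) = ~~ s (hi a) by case: (s (lo a)) (s (hi a)) ne => [] [].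
apply: W_ne; move: h; rewrite /letter.
by have -> : s (lo a) = ~~ s (hi a) by case: (s (lo a)) (s (hi a)) ne => [] [].
Qed.

Lemma kcoef_sw : dcoef a s ^+ 2 + kcoef a s * kcoef a (sw a s) = qcoef a s.
Proof.
rewrite /kcoef letter_lo letter_hi sw_lo dcoef_sw qcoef_sw.
rewrite [letter s (hi a) == _]eq_sym; case: eqP => h.
  have -> : qcoef a s = 0 by rewrite /qcoef h evQ_same.
  by move: ne; case: (s (lo a)); case: (s (hi a)) => // _; ring.
have -> : dcoef a s = 0 by rewrite /dcoef; case: eqP h.
by move: ne; case: (s (lo a)); case: (s (hi a)) => // _; ring.
Qed.

End Swap.

Lemma value_ne a s p : p != a :> nat -> p != a.+1 :> nat -> value (sw a s) p = value s p.
Proof. by move=> h1 h2; rewrite /value rank_sw_ne // sw_ne. Qed.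
Lemma letter_ne a s p : p != a :> nat -> p != a.+1 :> nat -> letter (sw a s) p = letter s p.
Proof. by move=> h1 h2; rewrite /letter rank_sw_ne // sw_ne. Qed.

Lemma same_letter_ne a s : s (lo a) = s (hi a) -> letter s (lo a) != letter s (hi a).
Proof. by move=> h; rewrite /letter (rank_same h) -h. Qed.

Lemma topE a f s : top a f s =
  if s (lo a) == s (hi a) then 0 else dcoef a s * f s + kcoef a s * f (sw a s).
Proof. by rewrite ffunE. Qed.

Lemma top_e a i f : top a (eop i f) = eop (sw a i) (top a f).
Proof.
apply/ffunP=> s; rewrite !ffunE; case: eqP => [_|/eqP ne]; first by rewrite if_same.
have h : (word (sw a s) == i) = (word s == sw a i).
  by rewrite word_sw // (can2_eq (@swK _ _ a) (@swK _ _ a)).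
rewrite h; case: (eqVneq (letter s (lo a)) (letter s (hi a))) => [ll|ll].
  have -> : (word s == i) = (word s == sw a i).
    rewrite -h word_sw //; congr (_ == _); apply/ffunP=> p; rewrite [RHS]ffunE.
    by case: tpermP => [->|->|] //; rewrite !ffunE.
  by case: ifP => _; rewrite ?mulr0 ?addr0.
rewrite /dcoef (negPf ll) !mul0r !add0r.
by case: ifP => _; rewrite ?mulr0.
Qed.

Lemma top_x a p f : p != a :> nat -> p != a.+1 :> nat -> top a (xop p f) = xop p (top a f).
Proof.
move=> h1 h2; apply/ffunP=> s; rewrite !ffunE value_ne //.
by case: ifP => _; rewrite ?mulr0 //; ring.
Qed.

Lemma top_xr a f : top a (xop (hi a) f) - xop (lo a) (top a f) = sameop (lo a) (hi a) f.
Proof.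
apply/ffunP=> s; rewrite !ffunE; case: eqP => [h|/eqP ne].
  by rewrite (negPf (same_letter_ne h)) mulr0 subr0.
rewrite value_hi // /kcoef; case: (eqVneq (letter s (lo a)) _) => [h|h].
  transitivity (dcoef a s * (value s (hi a) - value s (lo a)) * f s); first by ring.
  by rewrite dcoef_sub // mul1r.
by rewrite /dcoef (negPf h); ring.
Qed.

Lemma top_xl a f : xop (hi a) (top a f) - top a (xop (lo a) f) = sameop (lo a) (hi a) f.
Proof.
apply/ffunP=> s; rewrite !ffunE; case: eqP => [h|/eqP ne].
  by rewrite (negPf (same_letter_ne h)) mulr0 subr0.
rewrite value_lo // /kcoef; case: (eqVneq (letter s (lo a)) _) => [h|h].
  transitivity (dcoef a s * (value s (hi a) - value s (lo a)) * f s); first by ring.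
  by rewrite dcoef_sub // mul1r.
by rewrite /dcoef (negPf h); ring.
Qed.

Lemma top_top a f : top a (top a f) = qop a f.
Proof.
apply/ffunP=> s; rewrite !topE [RHS]ffunE; case: eqP => [h|/eqP ne].
  rewrite /qcoef /letter /value (rank_same h) -h.
  by rewrite row_Q mul0r.
rewrite (negPf (sw_neq ne)) swK dcoef_sw // -(kcoef_sw ne); ring.
Qed.

Lemma sw_far a b s p : (a.+1 < b)%N || (b.+1 < a)%N ->
  (p == lo b) || (p == hi b) -> [/\ sw a s p = s p, letter (sw a s) p = letter s p &
    value (sw a s) p = value s p].
Proof.
move=> ab pb; have h1 : p != a :> nat.
  by case/orP: pb => /eqP -> /=; lia.
have h2 : p != a.+1 :> nat by case/orP: pb => /eqP -> /=; lia.
by rewrite sw_ne // letter_ne // value_ne.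
Qed.

Lemma sw_comm a b s : (a.+1 < b)%N || (b.+1 < a)%N -> sw a (sw b s) = sw b (sw a s).
Proof.
move=> ab; apply/ffunP=> p; rewrite !ffunE; congr (s _).
by have := congr1 (fun t : 'S_n => t p) (tp_comm 1%g ab); rewrite !mulg1 !permM.
Qed.

Lemma coef_sw_far a b s : (a.+1 < b)%N || (b.+1 < a)%N ->
  [/\ dcoef b (sw a s) = dcoef b s, kcoef b (sw a s) = kcoef b s,
     sw a s (lo b) = s (lo b) & sw a s (hi b) = s (hi b)].
Proof.
move=> ab.
have [|s1 l1 v1] := @sw_far a b s (lo b) ab; first by rewrite eqxx.
have [|s2 l2 v2] := @sw_far a b s (hi b) ab; first by rewrite eqxx orbT.
by split=> //; rewrite /kcoef /dcoef /qcoef ?s1 ?l1 ?l2 ?v1 ?v2.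
Qed.

Lemma top_comm a b f : (a.+1 < b)%N || (b.+1 < a)%N ->
  top a (top b f) = top b (top a f).
Proof.
move=> ab; have ba : (b.+1 < a)%N || (a.+1 < b)%N by rewrite orbC.
apply/ffunP=> s; rewrite !topE (sw_comm s ba).
have [-> -> -> ->] := coef_sw_far s ab; have [-> -> -> ->] := coef_sw_far s ba.
by case: ifP => _; case: ifP => _; rewrite ?mulr0 ?addr0 //; ring.
Qed.

Lemma kcoef_letter_ne a s : s (lo a) != s (hi a) -> letter s (lo a) != letter s (hi a) ->
  kcoef a s * kcoef a (sw a s) = qcoef a s.
Proof.
by move=> ne ll; rewrite -kcoef_sw // /dcoef (negPf ll) expr0n add0r.
Qed.

Lemma row_letter s p q : s p = s q -> rank s q = (rank s p).+1 -> letter s p != letter s q.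
Proof. by move=> h hr; rewrite /letter hr -h. Qed.

Lemma row_Q0 s p q : s p = s q -> rank s q = (rank s p).+1 ->
  evQ o (letter s p) (letter s q) (value s p) (value s q) = 0.
Proof. by move=> h hr; rewrite /letter /value hr -h row_Q. Qed.

Section Braid.
Variables (a b : 'I_n.-1) (f : state_vec) (s : S).
Hypothesis ba : b = a.+1 :> nat.
Local Notation p := (lo a).
Local Notation q := (hi a).
Local Notation r := (hi b).

Let lb : lo b = q. Proof. exact: val_inj. Qed.
Let pr1 : r != a :> nat. Proof. rewrite /= ba; lia. Qed.
Let pr2 : r != a.+1 :> nat. Proof. rewrite /= ba; lia. Qed.
Let pp1 : p != b :> nat. Proof. rewrite /= ba; lia. Qed.
Let pp2 : p != b.+1 :> nat. Proof. rewrite /= ba; lia. Qed.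

Lemma top_braid_xxx : s p = s q -> s q = s r -> dop p q r f s = 0.
Proof.
move=> pq qr; rewrite ffunE; case: eqP => // ll.
have rq : rank s q = (rank s p).+1 by apply: rank_same.
have rr : rank s r = (rank s q).+1 by rewrite (@rank_same _ b) lb.
move: ll; rewrite /letter /value -qr -pq rr rq => ll.
by rewrite row_D ?mul0r.
Qed.

(** The outer entries are consecutive in their row. When one of them crosses the middle
    entry, they become neighbours and tau vanishes there; the diagonal terms would need
    the middle letter to be equal to both. *)
Lemma top_braid_xyx : s p != s q -> s q != s r ->
  [/\ top b (top a (top b f)) s = 0, top a (top b (top a f)) s = 0 & dop p q r f s = 0].
Proof.
move=> pq qr; have pr : s p = s r by move: pq qr; case: (s p) (s q) (s r) => [] [] [].
have rr : rank s r = (rank s p).+1.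
  rewrite /rank (cntS _ _ (lo b)) lb (negPf qr) addn0 (cntS _ _ (lo a)).
  by rewrite pr eqxx addn1.
have ll : letter s p != letter s r by apply: row_letter.
have dd : dcoef a s * dcoef b s = 0.
  rewrite /dcoef lb; case: eqP => [e1|]; last by rewrite mul0r.
  by rewrite ifF ?mulr0 // -e1 (negPf ll).
have sbp : sw b s p = sw b s q by rewrite sw_ne // -lb sw_lo.
have saq : sw a s (lo b) = sw a s r by rewrite lb sw_hi sw_ne.
split.
- rewrite topE lb (negPf qr) [top a _ (sw b s)]topE sbp eqxx mulr0 addr0.
  rewrite topE (negPf pq) [top b f (sw a s)]topE saq eqxx mulr0 addr0.
  by rewrite mulrA [dcoef b s * _]mulrC dd mul0r.
- rewrite topE (negPf pq) [top b _ (sw a s)]topE saq eqxx mulr0 addr0.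
  rewrite topE lb (negPf qr) [top a f (sw b s)]topE sbp eqxx mulr0 addr0.
  by rewrite mulrA dd mul0r.
- by rewrite ffunE (negPf ll).
Qed.

Lemma top_braid_xxy : s p = s q -> s q != s r ->
  top b (top a (top b f)) s = dop p q r f s.
Proof.
move=> pq qr; have pr : s p != s r by rewrite pq.
have rq : rank s q = (rank s p).+1 by apply: rank_same.
have neb : s (lo b) != s (hi b) by rewrite lb.
have s2p : sw b s p = s p by rewrite sw_ne.
have s2q : sw b s q = s r by rewrite -lb sw_lo.
have l2p : letter (sw b s) p = letter s p by rewrite letter_ne.
have l2q : letter (sw b s) q = letter s r by rewrite -lb letter_lo.
have l2r : letter (sw b s) r = letter s q by rewrite letter_hi // lb.
have v2p : value (sw b s) p = value s p by rewrite value_ne.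
have v2q : value (sw b s) q = value s r by rewrite -lb value_lo.
have ll : letter s p != letter s q by apply: row_letter.
have saq : sw a (sw b s) (lo b) = sw a (sw b s) r.
  by rewrite lb sw_hi s2p [RHS]sw_ne // sw_hi lb.
rewrite topE lb (negPf qr) [top a _ s]topE pq eqxx mulr0 add0r.
rewrite topE s2p s2q (negPf pr) [top b f (sw a _)]topE saq eqxx mulr0 addr0.
rewrite topE (negPf (sw_neq neb)) swK ffunE.
rewrite {1}/dcoef l2p l2q v2p v2q; case: eqP => [e1|_]; last by rewrite mul0r mulr0.
have -> : dcoef b (sw b s) = 0 by rewrite /dcoef lb l2q l2r -e1 (negPf ll).
rewrite mul0r add0r mulrCA !mulrA.
have nz : value s r - value s p != 0.
  rewrite subr_eq0 /value; have -> : s r = ~~ s p by case: (s p) (s r) pr => [] [].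
  rewrite eq_sym; apply: W_ne; move: e1; rewrite /letter.
  by have -> : s r = ~~ s p by case: (s p) (s r) pr => [] [].
have -> : (value s r - value s p)^-1 * kcoef b s * kcoef b (sw b s) =
    evD o (letter s p) (letter s q) (value s r) (value s p) (value s q).
  have kk : kcoef b s * kcoef b (sw b s) = qcoef b s.
    by apply: kcoef_letter_ne; rewrite // lb -e1 eq_sym.
  rewrite -mulrA kk mulrC.
  apply: (mulIf nz); rewrite mulfVK // evD_evQ // row_Q0 // subr0.
  by rewrite /qcoef lb -e1 evQ_sym.
by [].
Qed.

Lemma top_braid_yxx : s p != s q -> s q = s r ->
  top a (top b (top a f)) s = - dop p q r f s.
Proof.
move=> pq qr; have pr : s p != s r by rewrite -qr.
have rr : rank s r = (rank s q).+1 by rewrite (@rank_same _ b) lb.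
have s2p : sw a s p = s q by rewrite sw_lo.
have s2q : sw a s q = s p by rewrite sw_hi.
have s2r : sw a s r = s r by rewrite sw_ne.
have l2p : letter (sw a s) p = letter s q by rewrite letter_lo.
have l2q : letter (sw a s) q = letter s p by rewrite letter_hi.
have l2r : letter (sw a s) r = letter s r by rewrite letter_ne.
have v2q : value (sw a s) q = value s p by rewrite value_hi.
have v2r : value (sw a s) r = value s r by rewrite value_ne.
have ll : letter s q != letter s r by apply: row_letter.
have sbp : sw b (sw a s) p = sw b (sw a s) q.
  by rewrite [LHS]sw_ne // s2p -lb sw_lo s2r lb.
rewrite topE (negPf pq) [top b _ s]topE lb qr eqxx mulr0 add0r.
rewrite topE lb s2q s2r (negPf pr) [top a f (sw b _)]topE sbp eqxx mulr0 addr0.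
rewrite topE (negPf (sw_neq pq)) swK ffunE.
rewrite {1}/dcoef lb l2q l2r v2q v2r; case: eqP => [e1|_]; last by rewrite mul0r mulr0 oppr0.
have -> : dcoef a (sw a s) = 0 by rewrite /dcoef l2q l2p e1 (negPf ll).
rewrite mul0r add0r mulrCA !mulrA -mulNr; congr (_ * _).
have nz : value s r - value s p != 0.
  rewrite subr_eq0 /value; have -> : s r = ~~ s p by case: (s p) (s r) pr => [] [].
  rewrite eq_sym; apply: W_ne; move: e1; rewrite /letter.
  by have -> : s r = ~~ s p by case: (s p) (s r) pr => [] [].
have kk : kcoef a s * kcoef a (sw a s) = qcoef a s.
  by apply: kcoef_letter_ne; rewrite // e1 eq_sym.
rewrite -mulrA kk mulrC.
apply: (mulIf nz); rewrite mulfVK // mulNr evD_evQ //.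
rewrite e1 evQ_sym // row_Q0 // sub0r opprK.
by rewrite /qcoef e1.
Qed.

(** By cases on which of the three entries come from the same row. *)
Lemma top_braid : top b (top a (top b f)) s - top a (top b (top a f)) s = dop p q r f s.
Proof.
have [pq|pq] := eqVneq (s p) (s q); have [qr|qr] := eqVneq (s q) (s r).
- by rewrite top_braid_xxx // topE lb qr eqxx topE pq qr eqxx subrr.
- by rewrite top_braid_xxy // [top a _ s]topE pq eqxx subr0.
- by rewrite top_braid_yxx // [top b _ s]topE lb qr eqxx sub0r opprK.
- by have [-> -> ->] := top_braid_xyx pq qr; rewrite subrr.
Qed.

End Braid.

End SeminormalModule.

(** * The shuffle space as a representation *)

Section FreeAction.
Variables (K : fieldType) (I : finType) (n : nat) (F : fieldType) (k : {rmorphism K -> F}).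
Variables (V : lmodType F) (gop : qh_gen I n -> V -> V).
Hypothesis gopD : forall g f h, gop g (f + h) = gop g f + gop g h.
Hypothesis gopZ : forall g c f, gop g (c *: f) = c *: gop g f.
Local Notation FA := (free_alg K I n).

Definition act (x : FA) (f : V) : V :=
  \sum_(m <- msupp x) k x@_m *: foldr gop f (fmonom_val m).

Lemma act_widen (d : {fset {fmonom qh_gen I n}}) x f : (msupp x `<=` d)%fset ->
  act x f = \sum_(m <- d) k x@_m *: foldr gop f (fmonom_val m).
Proof.
move=> le; apply: big_fset_incl => // m _ mx.
by rewrite mcoeff_outdom // rmorph0 scale0r.
Qed.

Lemma actD x y f : act (x + y) f = act x f + act y f.
Proof.
pose d := (msupp x `|` msupp y)%fset.
rewrite (@act_widen d (x + y)) ?msuppD_le // (@act_widen d x) ?fsubsetUl //.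
rewrite (@act_widen d y) ?fsubsetUr // -big_split; apply: eq_bigr => m _ /=.
by rewrite mcoeffD rmorphD scalerDl.
Qed.

Lemma act0 f : act 0 f = 0.
Proof. by rewrite /act msupp0 big_seq_fset0. Qed.

Lemma actN x f : act (- x) f = - act x f.
Proof. by apply/eqP; rewrite -addr_eq0 -actD addNr act0. Qed.

Lemma act_monom c m f : act << c *g m >> f = k c *: foldr gop f (fmonom_val m).
Proof. by rewrite (act_widen _ msuppU_le) big_seq_fset1 mcoeffUU. Qed.

Lemma act_scalar c f : act c%:A f = k c *: f.
Proof. by rewrite -mul_malgC mulr1 act_monom fm1. Qed.

Lemma act1 f : act 1 f = f.
Proof. by have := act_scalar 1 f; rewrite rmorph1 !scale1r. Qed.

Lemma gop0 g : gop g 0 = 0.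
Proof. by have := gopZ g 0 0; rewrite !scale0r. Qed.

Lemma foldr_gopZ s c f : foldr gop (c *: f) s = c *: foldr gop f s.
Proof. by elim: s => //= g s ->. Qed.

Lemma act_scaler x c f : act x (c *: f) = c *: act x f.
Proof.
rewrite scaler_sumr; apply: eq_bigr => m _.
by rewrite foldr_gopZ !scalerA mulrC.
Qed.

Lemma act_sumr (J : Type) (r : seq J) (P : pred J) (G : J -> FA) f :
  act (\sum_(j <- r | P j) G j) f = \sum_(j <- r | P j) act (G j) f.
Proof.
elim/big_rec2: _ => [|j y z _ <-]; first exact: act0.
by rewrite actD.
Qed.

Lemma act_genM g x f : act (free_gen K g * x) f = gop g (act x f).
Proof.
have gop_sum (r : seq {fmonom qh_gen I n}) (G : _ -> V) :
    gop g (\sum_(m <- r) G m) = \sum_(m <- r) gop g (G m).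
  by elim/big_rec2: _ => [|m y z _ <-]; [exact: gop0 | rewrite gopD].
rewrite [x in LHS]monalgE mulr_sumr act_sumr /act gop_sum; apply: eq_bigr => m _.
rewrite /free_gen malgM_def fgmulUU mul1r -/(act _ _) act_monom gopZ.
by rewrite fmM fmU.
Qed.

Lemma act_gen g f : act (free_gen K g) f = gop g f.
Proof. by rewrite -[free_gen K g]mulr1 act_genM act1. Qed.

Lemma act_scalel c x f : act (c *: x) f = k c *: act x f.
Proof.
rewrite (@act_widen (msupp x) (c *: x) f (msuppZ_le c x)) scaler_sumr.
by apply: eq_bigr => m _; rewrite mcoeffZ rmorphM scalerA.
Qed.

Lemma actM x y f : act (x * y) f = act x (act y f).
Proof.
elim/free_alg_ind: x => [x z hx hz|c|g x hx].
- apply: etrans (congr1 (act^~ f) (mulrDl x z y)) _.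
  apply: etrans (actD (x * y) (z * y) f) _.
  exact: etrans (congr2 +%R hx hz) (esym (actD x z (act y f))).
- apply: etrans (congr1 (act^~ f) (mulr_algl c y)) _.
  exact: etrans (act_scalel c y f) (esym (act_scalar c (act y f))).
- apply: etrans (congr1 (act^~ f) (esym (mulrA (free_gen K g) x y))) _.
  apply: etrans (act_genM g (x * y) f) _.
  exact: etrans (congr1 (gop g) hx) (esym (act_genM g x (act y f))).
Qed.

End FreeAction.

Section SeminormalAction.
Variables (K : fieldType) (n e : nat) (o : nat -> bool).
Hypothesis e_ge2 : (2 <= e)%N.
Local Notation I := 'I_e.+1.
Local Notation S := {ffun 'I_n -> bool}.
Variables (F : fieldType) (k : {rmorphism K -> F}) (L : bool -> nat -> I) (W : bool -> nat -> F).
Hypothesis L_ne : forall c r, L c r != L c r.+1.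
Hypothesis row_Q : forall c r, evQ o (L c r) (L c r.+1) (W c r) (W c r.+1) = 0.
Hypothesis row_D : forall c r, L c r = L c r.+2 ->
  evD o (L c r) (L c r.+1) (W c r.+2) (W c r) (W c r.+1) = 0.
Hypothesis W_ne : forall c r t, L c r = L (~~ c) t -> W c r != W (~~ c) t.
Local Notation V := {ffun S -> F^o}.
Local Notation eop := (@eop n e F L).
Local Notation xop := (@xop n F W).
Local Notation top := (@top n e o F L W).
Local Notation sameop := (@sameop n e F L).
Local Notation value := (@value n F W).
Local Notation letter := (@letter n e L).
Implicit Types (s : S) (a b : 'I_n.-1) (p q : 'I_n) (i j : {ffun 'I_n -> I}) (f h : V).

Definition gen_op (g : qh_gen I n) : V -> V :=
  match g with inl i => eop i | inr (inl p) => xop p | inr (inr a) => top a end.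

Lemma gen_opD g f h : gen_op g (f + h) = gen_op g f + gen_op g h.
Proof.
case: g => [i|[p|a]]; apply/ffunP => s; rewrite !ffunE.
- by case: ifP => _; rewrite ?addr0.
- exact: mulrDr.
- by case: ifP => _; rewrite ?addr0 //; ring.
Qed.

Lemma gen_opZ g c f : gen_op g (c *: f) = c *: gen_op g f.
Proof.
have scE (u v : F) : (u *: (v : F^o)) = u * v by [].
case: g => [i|[p|a]]; apply/ffunP => s; rewrite !ffunE !scE.
- by case: ifP => _; rewrite ?mulr0.
- by rewrite mulrCA.
- by case: ifP => _; rewrite ?mulr0 //; ring.
Qed.

Section Abstract.
Variables (A : lalgType K) (ac : A -> V -> V).
Hypothesis acD : forall x y f, ac (x + y) f = ac x f + ac y f.
Hypothesis acN : forall x f, ac (- x) f = - ac x f.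
Hypothesis acM : forall x y f, ac (x * y) f = ac x (ac y f).
Hypothesis ac1 : forall f, ac 1 f = f.
Hypothesis ac0 : forall f, ac 0 f = 0.
Variables (E : {ffun 'I_n -> I} -> A) (X : 'I_n -> A) (T : 'I_n.-1 -> A).
Hypothesis acE : forall i f, ac (E i) f = eop i f.
Hypothesis acX : forall p f, ac (X p) f = xop p f.
Hypothesis acT : forall a f, ac (T a) f = top a f.

Let acB x y f : ac (x - y) f = ac x f - ac y f. Proof. by rewrite acD acN. Qed.

Lemma ac_if (c : bool) x f : ac (if c then x else 0) f = if c then ac x f else 0.
Proof. by case: c. Qed.

Lemma ac_sum (J : finType) (G : J -> A) f : ac (\sum_j G j) f = \sum_j ac (G j) f.
Proof. by elim/big_rec2: _ => [|j y z _ <-]; [exact: ac0|exact: acD]. Qed.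

Lemma eopE i f s : eop i f s = if word L s == i then f s else 0.
Proof. by rewrite ffunE. Qed.

Lemma ac_idem i j f : ac (E j * E i) f = ac (if i == j then E i else 0) f.
Proof.
rewrite acM ac_if !acE; apply/ffunP => s; rewrite !eopE.
case: (eqVneq i j) => [->|ij]; first by rewrite !eopE; case: (word L s == j).
by rewrite ffunE; case: eqP => // ->; rewrite eq_sym (negPf ij).
Qed.

Lemma ac_one f : ac (\sum_i E i) f = ac 1 f.
Proof.
rewrite ac_sum ac1; apply/ffunP => s; rewrite sum_ffunE (bigD1 (word L s)) //= big1.
  by rewrite acE eopE eqxx addr0.
by move=> i; rewrite acE eopE eq_sym => /negPf ->.
Qed.

Lemma ac_xx p q f : ac (X p * X q) f = ac (X q * X p) f.
Proof. by rewrite !acM !acX; apply/ffunP => s; rewrite !ffunE mulrCA. Qed.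

Lemma ac_xe p i f : ac (X p * E i) f = ac (E i * X p) f.
Proof.
rewrite !acM !acX !acE; apply/ffunP => s; rewrite !ffunE.
by case: ifP; rewrite ?mulr0.
Qed.

Lemma ac_te a i f : ac (T a * E i) f = ac (E (sw a i) * T a) f.
Proof. by rewrite !acM !acT !acE top_e. Qed.

Lemma ac_tx a p f : p != a :> nat -> p != a.+1 :> nat -> ac (T a * X p) f = ac (X p * T a) f.
Proof. by move=> h1 h2; rewrite !acM !acT !acX top_x. Qed.

Lemma sameop_e p q i f : sameop p q (eop i f) =
  ac (if i p == i q then E i else 0) f.
Proof.
rewrite ac_if acE; apply/ffunP => s; rewrite ffunE eopE.
case: (eqVneq (word L s) i) => [<-|ne]; last first.
  by rewrite if_same; case: ifP => _; rewrite ?eopE ?ffunE // (negPf ne).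
by rewrite !ffunE; case: ifP => _; rewrite ?eopE ?ffunE // eqxx.
Qed.

Lemma ac_txr a i f : ac ((T a * X (hi a) - X (lo a) * T a) * E i) f =
  ac (if i (lo a) == i (hi a) then E i else 0) f.
Proof.
rewrite acM acB !acM !acT !acX acE.
exact: etrans (top_xr o L_ne W_ne a (eop i f)) (sameop_e (lo a) (hi a) i f).
Qed.

Lemma ac_txl a i f : ac ((X (hi a) * T a - T a * X (lo a)) * E i) f =
  ac (if i (lo a) == i (hi a) then E i else 0) f.
Proof.
rewrite acM acB !acM !acT !acX acE.
exact: etrans (top_xl o L_ne W_ne a (eop i f)) (sameop_e (lo a) (hi a) i f).
Qed.

Lemma ac_evQ (c d : I) p q f : ac (evQ o c d (X p) (X q)) f =
  [ffun s => evQ o c d (value s p) (value s q) * f s].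
Proof.
rewrite /evQ; case: (single_arrow e o c d); last case: (single_arrow e o d c);
  last case: (double_arrow e c d); last case: (double_arrow e d c); last case: (c == d);
  rewrite ?acB ?expr2 ?acM ?acX ?ac0 ?ac1; apply/ffunP => s; rewrite !ffunE; ring.
Qed.

Lemma ac_evD (c d : I) r p q f : ac (evD o c d (X r) (X p) (X q)) f =
  [ffun s => evD o c d (value s r) (value s p) (value s q) * f s].
Proof.
rewrite /evD; case: (single_arrow e o c d); last case: (single_arrow e o d c);
  last case: (double_arrow e c d); last case: (double_arrow e d c);
  rewrite ?acN ?acD ?acX ?ac0 ?ac1; apply/ffunP => s; rewrite !ffunE; ring.
Qed.

Lemma ac_t2 a i f : ac (T a ^+ 2 * E i) f =
  ac (evQ o (i (lo a)) (i (hi a)) (X (lo a)) (X (hi a)) * E i) f.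
Proof.
rewrite expr2 !acM !acT ac_evQ acE top_top //; apply/ffunP => s; rewrite !ffunE.
by case: eqP => [<-|]; rewrite ?mulr0 // /qcoef !ffunE.
Qed.

Lemma ac_tt a b f : (a.+1 < b)%N || (b.+1 < a)%N -> ac (T a * T b) f = ac (T b * T a) f.
Proof. by move=> ab; rewrite !acM !acT top_comm. Qed.

Lemma ac_braid a b i f : b = a.+1 :> nat ->
  ac ((T b * T a * T b - T a * T b * T a) * E i) f =
  ac (if i (lo a) == i (hi b) then
    evD o (i (lo a)) (i (hi a)) (X (hi b)) (X (lo a)) (X (hi a)) * E i else 0) f.
Proof.
move=> ba; rewrite acM acB !acM !acT ac_if acM ac_evD acE; apply/ffunP => s.
rewrite [LHS]ffunE [X in _ + X]ffunE top_braid // ffunE eopE.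
case: (eqVneq (word L s) i) => [<-|ne]; last first.
  by rewrite mulr0 if_same; case: ifP => _; rewrite !ffunE // (negPf ne) mulr0.
by rewrite !ffunE; case: ifP => _; rewrite !ffunE // eqxx.
Qed.

End Abstract.

Local Notation Q := (@QC1 e o K).
Local Notation FA := (free_alg K I n).
Local Notation actV := (act k gen_op).

Lemma act_rel l r f : qh_rel Q l r -> actV l f = actV r f.
Proof.
have acD := actD k gen_op; have acN := actN k gen_op.
have acM := actM k gen_opD gen_opZ; have ac1 := act1 k gen_op.
have ac0 := act0 k gen_op; have acg := act_gen k gen_opD gen_opZ.
pose gE (i : {ffun 'I_n -> I}) : FA := free_gen K (inl i).
pose gX (p : 'I_n) : FA := free_gen K (inr (inl p)).
pose gT (a : 'I_n.-1) : FA := free_gen K (inr (inr a)).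
have aE i h : actV (gE i) h = eop i h by apply: acg.
have aX p h : actV (gX p) h = xop p h by apply: acg.
have aT a h : actV (gT a) h = top a h by apply: acg.
case=> [i j||p q|p i|a p q i pa qa|a p h1 h2|a p q i pa qa|a p q i pa qa|a p q i pa qa|a b ab|a b p q r' i ba pa qa ra].
- exact: (ac_idem acM ac0 aE).
- exact: (ac_one acD ac1 ac0 aE).
- exact: (ac_xx acM aX).
- exact: (ac_xe acM aE aX).
- have -> : p = lo a by apply: val_inj.
  have -> : q = hi a by apply: val_inj.
  exact: (ac_te acM aE aT).
- exact: (ac_tx acM aX aT f h1 h2).
- have -> : p = lo a by apply: val_inj.
  have -> : q = hi a by apply: val_inj.
  exact: (ac_txr acD acN acM ac0 aE aX aT).
- have -> : p = lo a by apply: val_inj.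
  have -> : q = hi a by apply: val_inj.
  exact: (ac_txl acD acN acM ac0 aE aX aT).
- have -> : p = lo a by apply: val_inj.
  have -> : q = hi a by apply: val_inj.
  rewrite eval2_QC1; exact: (ac_t2 acD acN acM ac1 ac0 aE aX aT).
- exact: (ac_tt acM aT f ab).
- have -> : p = lo a by apply: val_inj.
  have -> : q = hi a by apply: val_inj.
  have -> : r' = hi b by apply: val_inj; rewrite /= ra ba.
  rewrite eval3_QC1; exact: (ac_braid acD acN acM ac1 ac0 aE aX aT i f ba).
Qed.

End SeminormalAction.

(** * A criterion against semisimplicity *)

Section MorphismKernel.
Variables (A B : pzRingType) (f : {rmorphism A -> B}).
Implicit Types x y z : A.

Lemma rmorph_sub0 x y : f x = f y -> f (x - y) = 0.
Proof. by rewrite rmorphB => ->; rewrite subrr. Qed.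

Lemma rmorph_return z x a : f x = f a * f (z * x) -> f (z * x) = f (z * (a * (z * x))).
Proof. by move=> h; rewrite [LHS]rmorphM h -!rmorphM. Qed.

Lemma rmorph_sub_unit (J : finType) (c : J -> A) z :
  1 = \sum_j f (c j) -> f (z - z * \sum_j c j) = 0.
Proof. by move=> h; rewrite rmorphB rmorphM rmorph_sum -h mulr1 subrr. Qed.

End MorphismKernel.

Section Criterion.
Variables (K : fieldType) (n e : nat) (o : nat -> bool).
Hypothesis e_ge2 : (2 <= e)%N.
Local Notation I := 'I_e.+1.
Local Notation S := {ffun 'I_n -> bool}.
Variables (F : fieldType) (k : {rmorphism K -> F}) (iota : {rmorphism {poly K} -> F}).
Variables (L : bool -> nat -> I) (W : bool -> nat -> F).
Hypothesis L_ne : forall c r, L c r != L c r.+1.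
Hypothesis row_Q : forall c r, evQ o (L c r) (L c r.+1) (W c r) (W c r.+1) = 0.
Hypothesis row_D : forall c r, L c r = L c r.+2 ->
  evD o (L c r) (L c r.+1) (W c r.+2) (W c r) (W c r.+1) = 0.
Hypothesis W_ne : forall c r t, L c r = L (~~ c) t -> W c r != W (~~ c) t.
Local Notation V := {ffun S -> F^o}.
Implicit Types (f h : V).
Local Notation gop := (@gen_op n e o F L W).
Local Notation Q := (@QC1 e o K).
Local Notation FA := (free_alg K I n).
Local Notation actV := (act k gop).
Variables (Lam : {ffun I -> nat}) (n_gt0 : (0 < n)%N).
Let p0 := Ordinal n_gt0.

Let acD := actD k gop.
Let acN := actN k gop.
Let acM := actM k (@gen_opD n e o F L W) (@gen_opZ n e o F L W).
Let ac1 := act1 k gop.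
Let ac0 := act0 k gop.
Let acg := act_gen k (@gen_opD n e o F L W) (@gen_opZ n e o F L W).
Let acs := act_scalar k gop.
Let acz := act_scaler k (@gen_opZ n e o F L W).

Variables (P N : V -> Prop).
Hypothesis PN_add : forall f h : V, N f -> N h -> N (f + h).
Hypothesis N_scal : forall c (f : V), N f -> N (k c *: f).
Hypothesis N_gop : forall g (f : V), N f -> N (gop g f).
Hypothesis P_add : forall f h : V, P f -> P h -> P (f + h).
Hypothesis P_scal : forall c (f : V), P f -> P (k c *: f).
Hypothesis P_gop : forall g (f : V), P f -> P (gop g f).
Hypothesis cyc_PN : forall (i : {ffun 'I_n -> I}) (f : V), P f ->
  N (iter (Lam (i p0)) (xop W p0) (eop L i f)).

Lemma stable0 (f : V) : N f -> N 0.
Proof. by move=> Nf; have := N_scal 0 Nf; rewrite rmorph0 scale0r. Qed.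

Lemma stable_act (M : V -> Prop) :
  (forall f h, M f -> M h -> M (f + h)) -> (forall c f, M f -> M (k c *: f)) ->
  (forall g f, M f -> M (gop g f)) -> forall x f, M f -> M (actV x f).
Proof.
move=> MD MZ Mg x; elim/free_alg_ind: x => [x y hx hy|c|g x hx] f Mf.
- by rewrite acD; apply: MD; [apply: hx|apply: hy].
- by rewrite acs; apply: MZ.
- by rewrite acM acg; apply: Mg; apply: hx.
Qed.

Let actN_stable := stable_act PN_add N_scal N_gop.
Let actP_stable := stable_act P_add P_scal P_gop.

Local Notation qset := [set z : FA | exists l r, qh_rel Q l r /\ z = l - r]%classic.

Lemma act_r0 x : actV x 0 = 0.
Proof. by have := acz x 0 0; rewrite !scale0r. Qed.

Lemma act_kernel x f : generated_ideal qset x -> actV x f = 0.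
Proof.
move=> h; suff : [set x : FA | forall f, actV x f = 0]%classic x by apply.
apply: h; split; [split; [split|]|].
- by move=> h; rewrite ac0.
- move=> y z hy hz h; apply: etrans (acD y z h) _.
  by rewrite (hy h) (hz h) addr0.
- move=> a y hy h; apply: etrans (acM a y h) _; rewrite (hy h); exact: act_r0.
- by move=> y a hy h; apply: etrans (acM y a h) (hy _).
- move=> z [l [r [lr ->]]] h; rewrite acD acN.
  by rewrite (act_rel e_ge2 k L_ne row_Q row_D W_ne h lr) subrr.
Qed.

Definition act_qh (w : quiver_hecke Q n) : V -> V := actV (generic_quotient.repr w).

Lemma act_qhE x f : act_qh (quot_pi qset x) f = actV x f.
Proof.
rewrite /act_qh; set y := generic_quotient.repr _.
have : generated_ideal qset (y - x).
  by apply/quot_pi_eq; rewrite /quot_pi /y generic_quotient.reprK.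
by move/(act_kernel f); rewrite acD acN => /eqP; rewrite subr_eq0 => /eqP.
Qed.

(** The elements that map P into N form a two-sided ideal, because P and N are stable;
    it contains the generator of the cyclotomic ideal. *)
Lemma cyc_pi_kernel x f : P f -> cyc_pi o Lam n_gt0 x = 0 -> N (actV x f).
Proof.
move=> Pf x0; have Nz : N 0.
  by apply: stable0; exact: (cyc_PN [ffun => ord0] Pf).
have : generated_ideal [set cyclotomic_gen Q Lam n_gt0]%classic (quot_pi qset x).
  by rewrite -[X in generated_ideal _ X]subr0; apply/quot_pi_eq; rewrite rmorph0.
pose J := [set w : quiver_hecke Q n | forall f, P f -> N (act_qh w f)]%classic.
suff HJ : two_sided_ideal J /\ ([set cyclotomic_gen Q Lam n_gt0] `<=` J)%classic.
  by move=> h; have := h J HJ f Pf; rewrite act_qhE.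
split; [split; [split|]|].
- move=> h Ph; rewrite -(rmorph0 (quot_pi qset)) act_qhE ac0; exact: Nz.
- move=> y z; have [y' ->] := quot_pi_surj y; have [z' ->] := quot_pi_surj z.
  move=> hy hz h Ph; rewrite -rmorphD act_qhE acD -!act_qhE.
  by apply: PN_add; [apply: hy | apply: hz].
- move=> a y; have [y' ->] := quot_pi_surj y; have [a' ->] := quot_pi_surj a.
  move=> hy h Ph; rewrite -rmorphM act_qhE acM; apply: actN_stable.
  by rewrite -act_qhE; apply: hy.
- move=> y a; have [y' ->] := quot_pi_surj y; have [a' ->] := quot_pi_surj a.
  move=> hy h Ph; rewrite -rmorphM act_qhE acM -act_qhE.
  by apply: hy; apply: actP_stable.
- move=> w -> h Ph.
  have -> : cyclotomic_gen Q Lam n_gt0 = quot_pi qset (\sum_(i : {ffun 'I_n -> I})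
      free_gen K (inr (inl p0)) ^+ Lam (i p0) * free_gen K (inl i)).
    rewrite /cyclotomic_gen rmorph_sum; apply: eq_bigr => i _.
    by rewrite rmorphM rmorphXn.
  rewrite act_qhE act_sumr; elim/big_rec: _ => [|i f' _]; first exact: Nz.
  apply: PN_add; rewrite acM acg.
  have -> t f'' : actV (free_gen K (inr (inl p0)) ^+ t) f'' = iter t (xop W p0) f''.
    elim: t => [|t IHt]; first by rewrite expr0 ac1.
    by rewrite exprS acM acg IHt.
  exact: cyc_PN.
Qed.


Variables (p : 'I_n) (W0 : {ffun 'I_n -> I}) (zeta : {poly K}) (v : V).
Hypothesis zeta_ndvd : ~~ (zeta ^+ 2 %| zeta).
Hypothesis Pv : P v.
Hypothesis P_word : forall f : V, P f -> exists alpha, eop L W0 f = iota alpha *: v :> V.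
Hypothesis v_word : eop L W0 v = v.
Hypothesis v_x : xop W p v = iota zeta *: v.
Hypothesis v_N : forall gam, N (iota (zeta ^+ 2 * gam) *: v).
Hypothesis N_v : forall beta, N (iota beta *: v) -> zeta ^+ 2 %| beta.

Let z : FA := free_gen K (inr (inl p)) * free_gen K (inl W0).

Let zE f : actV z f = xop W p (eop L W0 f).
Proof. by rewrite acM !acg. Qed.

Let xopZ c (f : V) : xop W p (c *: f) = c *: (xop W p f : V).
Proof. exact: (@gen_opZ n e o F L W (inr (inl p)) c f). Qed.

Let z_P f : P f -> exists alpha, actV z f = iota (zeta * alpha) *: v.
Proof.
move=> Pf; have [al h] := P_word Pf; exists al.
by rewrite zE h xopZ v_x scalerA -rmorphM mulrC.
Qed.

(** Here z is a dot times e(W0), so that z maps P into the multiples of zeta v: write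
    z c v = zeta alpha v, and z r v = zeta rho v. The hypothesis puts zeta alpha (1 - zeta rho) v
    in N, so zeta^2 divides zeta alpha (1 - zeta rho); hence zeta divides alpha. *)
Lemma zc_N (c r : FA) : cyc_pi o Lam n_gt0 (z * c) = cyc_pi o Lam n_gt0 (z * (r * (z * c))) ->
  N (actV (z * c) v).
Proof.
move=> h; have {h} : N (actV (z * c - z * (r * (z * c))) v).
  exact: (cyc_pi_kernel Pv (rmorph_sub0 h)).
have -> : actV (z * c - z * (r * (z * c))) v =
    actV z (actV c v) - actV z (actV r (actV z (actV c v))).
  apply: etrans (acD _ _ v) _; congr (_ + _); first exact: acM.
  apply: etrans (acN _ v) _; congr (- _); apply: etrans (acM z _ v) _.
  congr (actV z _); apply: etrans (acM r _ v) _; congr (actV r _); exact: acM.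
suff H : N (actV z (actV c v) - actV z (actV r (actV z (actV c v)))) -> N (actV z (actV c v)).
  by move/H => h; exact: (@eq_ind _ _ N h _ (esym (acM z c v))).
have [al ->] := z_P (actP_stable c Pv); rewrite acz.
rewrite acz; have [rho ->] := z_P (actP_stable r Pv).
rewrite scalerA -rmorphM -scalerBl -rmorphB => /N_v.
have z0 : zeta != 0 by apply: contraNneq zeta_ndvd => ->; rewrite dvdp0.
have -> : zeta * al - zeta * al * (zeta * rho) = zeta * (al - zeta * (al * rho)) by ring.
rewrite expr2 dvdp_mul2l // dvdp_subl; last by rewrite dvdp_mulr.
move/dvdpP => [gam ->].
have -> : zeta * (gam * zeta) = zeta ^+ 2 * gam by ring.
exact: v_N.
Qed.

(** Write 1 as the sum of its components c_j in simple left ideals. If z c_j is not 0,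
    it generates the ideal of c_j, so that z c_j = z r z c_j for some r; in both cases
    z c_j v is in N by zc_N. Then so is the sum, which is z v = zeta v. *)
Theorem not_semisimple : ~ semisimple_ring (cyclotomic_quiver_hecke Q Lam n_gt0).
Proof.
case=> r [Li [simp dec]].
have [c [[cL c1] _]] := dec 1.
have /fin_all_exists [c' cE] : forall j, exists x, c j = cyc_pi o Lam n_gt0 x.
  by move=> j; apply: cyc_pi_surj.
have Nzc j : N (actV (z * c' j) v).
  have [[L0 LD LM] Lne Lmin] := simp j.
  set zc := cyc_pi o Lam n_gt0 (z * c' j).
  have Lzc : Li j zc.
    have -> : zc = cyc_pi o Lam n_gt0 z * c j by rewrite cE; exact: rmorphM.
    by apply: LM; exact: cL.
  have [zc0|zc0] := pselect (zc = 0); first exact: (cyc_pi_kernel Pv zc0).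
  have [||h|h] := Lmin [set x | exists a, x = a * zc]%classic.
  - split; first by exists 0; rewrite mul0r.
      by move=> x y [a ->] [b ->]; exists (a + b); rewrite mulrDl.
    by move=> a x [b ->]; exists (a * b); rewrite mulrA.
  - by move=> x [a ->]; apply: LM.
  - by case: zc0; have : [set 0]%classic zc by rewrite -h; exists 1; rewrite mul1r.
  have : Li j (c j) by apply: cL.
  rewrite -h => -[a ca]; have [a' aE] := cyc_pi_surj a.
  apply: (@zc_N _ a'); apply: rmorph_return.
  have ca' : cyc_pi o Lam n_gt0 (c' j) = cyc_pi o Lam n_gt0 a' * zc by rewrite -aE -cE.
  exact: ca'.
have N1 : N (actV (z * \sum_j c' j) v).
  rewrite mulr_sumr act_sumr; elim/big_rec: _ => [|j f _]; last by apply: PN_add.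
  by have := v_N 0; rewrite mulr0 rmorph0 scale0r.
have N2 : N (actV (z - z * \sum_j c' j) v).
  apply: (cyc_pi_kernel Pv (rmorph_sub_unit _ _)).
  by rewrite c1; apply: eq_bigr => j _; exact: cE.
have : N (actV z v).
  have -> : actV z v = actV (z - z * \sum_j c' j) v + actV (z * \sum_j c' j) v; last exact: PN_add.
  rewrite -{1}[z](subrK (z * \sum_j c' j)); exact: acD.
rewrite zE v_word v_x => /N_v; exact/negP.
Qed.

End Criterion.

(** * Lattices in the shuffle space *)

Section Lattice.
Variables (K : fieldType) (n e : nat) (o : nat -> bool).
Hypothesis e_ge2 : (2 <= e)%N.
Local Notation I := 'I_e.+1.
Local Notation S := {ffun 'I_n -> bool}.
Variables (F : fieldType) (iota : {rmorphism {poly K} -> F}).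
Variables (L : bool -> nat -> I) (W : bool -> nat -> {poly K}).
Local Notation iW := (fun c r => iota (W c r)).
Hypothesis L_ne : forall c r, L c r != L c r.+1.
Hypothesis row_Q : forall c r, evQ o (L c r) (L c r.+1) (iW c r) (iW c r.+1) = 0.
Hypothesis row_D : forall c r, L c r = L c r.+2 ->
  evD o (L c r) (L c r.+1) (iW c r.+2) (iW c r) (iW c r.+1) = 0.
Hypothesis W_ne : forall c r t, L c r = L (~~ c) t -> iW c r != iW (~~ c) t.
Local Notation V := {ffun S -> F^o}.
Implicit Types (f h : V) (s : S) (a b : 'I_n.-1) (p q : 'I_n).
Local Notation gop := (@gen_op n e o F L iW).
Local Notation eop i f := (@eop n e F L i f).
Local Notation xop p f := (@xop n F iW p f).
Local Notation top a f := (@top n e o F L iW a f).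
Local Notation dop p q r f := (@dop n e o F L iW p q r f).
Local Notation qop a f := (@qop n e o F L iW a f).
Local Notation word s := (@word n e L s).

Let eopD i f h : eop i (f + h) = eop i f + eop i h.
Proof. exact: (@gen_opD n e o F L iW (inl i) f h). Qed.
Let eopZ i c f : eop i (c *: f) = c *: eop i f.
Proof. exact: (@gen_opZ n e o F L iW (inl i) c f). Qed.
Let xopD p f h : xop p (f + h) = xop p f + xop p h.
Proof. exact: (@gen_opD n e o F L iW (inr (inl p)) f h). Qed.
Let xopZ p c f : xop p (c *: f) = c *: xop p f.
Proof. exact: (@gen_opZ n e o F L iW (inr (inl p)) c f). Qed.

Lemma gen_op0 g : gop g (0 : V) = 0.
Proof. by have := gen_opZ o L iW g 0 (0 : V); rewrite !scale0r. Qed.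

(** Linear combinations with coefficients in K[y], inside a space over K(y). *)
Inductive Ospan (B : V -> Prop) : V -> Prop :=
| Ospan_gen f of B f : Ospan B f
| Ospan0 : Ospan B 0
| OspanD f h of Ospan B f & Ospan B h : Ospan B (f + h)
| OspanZ c f of Ospan B f : Ospan B (iota c *: f).

Lemma Ospan_sub (B C : V -> Prop) f : (forall h, B h -> Ospan C h) -> Ospan B f -> Ospan C f.
Proof.
move=> BC; elim=> {f} [f /BC //||f h _ hf _ hh|c f _ hf].
- exact: Ospan0.
- exact: OspanD.
- exact: OspanZ.
Qed.

Lemma Ospan_map (B C : V -> Prop) (g : V -> V) f :
  (forall f h, g (f + h) = g f + g h) -> (forall c f, g (c *: f) = c *: g f) ->
  (forall h, B h -> Ospan C (g h)) -> Ospan B f -> Ospan C (g f).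
Proof.
move=> gD gZ BC; elim=> {f} [f /BC //||f h _ hf _ hh|c f _ hf].
- by have := gZ 0 0; rewrite !scale0r => ->; exact: Ospan0.
- by rewrite gD; exact: OspanD.
- by rewrite gZ; exact: OspanZ.
Qed.

Lemma Ospan_gop (B C : V -> Prop) g f :
  (forall h, B h -> Ospan C (gop g h)) -> Ospan B f -> Ospan C (gop g f).
Proof. by apply: Ospan_map; [exact: gen_opD | exact: gen_opZ]. Qed.

Lemma Ospan_ext B h f : Ospan B h -> (forall s, f s = h s) -> Ospan B f.
Proof. by move=> Bh fh; suff -> : f = h by []; apply/ffunP. Qed.

Lemma OspanN B f : Ospan B f -> Ospan B (- f).
Proof. by move=> h; rewrite -scaleN1r -(rmorph1 iota) -rmorphN; exact: OspanZ. Qed.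

Lemma OspanB B f h : Ospan B f -> Ospan B h -> Ospan B (f - h).
Proof. by move=> hf hh; apply: OspanD => //; exact: OspanN. Qed.

Variable k : nat.
Hypothesis k_le : (k <= n)%N.

Definition start : S := [ffun p : 'I_n => (k <= p)%N].
Definition dirac s : V := [ffun t : S => (t == s)%:R].
Definition start_vec := dirac start.
Definition start_word := word start.

(** Products of tau's applied to the vector of the state A...A B...B, along paths of
    states in which every step moves an entry of row B to the left past one of row A. *)
Inductive std : nat -> S -> V -> Prop :=
| std0 : std 0 start start_vec
| stdS m s T a of std m s T & ~~ s (lo a) & s (hi a) : std m.+1 (sw a s) (top a T).

Lemma std0_inv s T : std 0 s T -> s = start /\ T = start_vec.
Proof. by move=> b; move E : 0%N b => m b; case: b E. Qed.

Lemma stdS_inv m s T : std m.+1 s T -> exists a s' T',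
  [/\ s = sw a s', T = top a T', std m s' T', ~~ s' (lo a) & s' (hi a)].
Proof.
move=> b; move E : m.+1 b => m' b; case: b E => // {}m' {}s {}T a b sA sB [->].
by exists a, s, T.
Qed.

Lemma eop_dirac i s : eop i (dirac s) = if word s == i then dirac s else 0.
Proof.
apply/ffunP=> t; rewrite !ffunE; case: (eqVneq t s) => [<-|ts].
  by case: ifP => _; rewrite !ffunE ?eqxx.
by case: (word s == i); rewrite !ffunE ?(negPf ts); case: ifP.
Qed.

Lemma eop0 i : eop i 0 = 0. Proof. exact: (gen_op0 (inl i)). Qed.

Lemma std_word m s T i : std m s T -> eop i T = if word s == i then T else 0.
Proof.
move=> h; elim: h i => [|{}m {}s {}T a _ IH sA sB] i; first exact: eop_dirac.
have ne : s (lo a) != s (hi a) by rewrite (negPf sA) sB.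
rewrite word_sw // (can2_eq (@swK _ _ a) (@swK _ _ a)).
have -> : eop i (top a T) = top a (eop (sw a i) T).
  by rewrite (top_e o L iW a (sw a i) T) swK.
by rewrite IH; case: ifP => _ //; exact: (gen_op0 (inr (inr a))).
Qed.

Lemma top_dirac a s : s (lo a) = s (hi a) -> top a (dirac s) = 0.
Proof.
move=> h; apply/ffunP=> t; rewrite !ffunE; case: (eqVneq (t (lo a)) (t (hi a))) => // ne.
have h1 : (t == s) = false by apply: contraNF ne => /eqP ->; rewrite h.
have h2 : (sw a t == s) = false.
  by apply: contraNF ne => /eqP ts; rewrite -(sw_lo a t) -(sw_hi a t) ts h.
by rewrite h1 h2 !mulr0 addr0.
Qed.

Lemma xop_dirac p s : xop p (dirac s) = iota (W (s p) (rank s p)) *: dirac s.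
Proof.
by apply/ffunP=> t; rewrite !ffunE /value; case: (eqVneq t s) => [->|_] //; rewrite !mulr0 scaler0.
Qed.

(** A last step next to p would leave A at p or B at p + 1, so the last step is at p or
    commutes with tau_p. *)
Lemma std_removable (p : 'I_n.-1) m s T : std m s T -> s (lo p) -> ~~ s (hi p) ->
  exists m1 T1, [/\ m = m1.+1, T = top p T1 & std m1 (sw p s) T1].
Proof.
move=> h; elim: h => [|{}m {}s {}T a hT IH sA sB] h1 h2.
  by move: h1 h2; rewrite !ffunE /=; lia.
have [pa|pa] := eqVneq (val p) (val a).
  have {pa} -> : p = a by apply: val_inj.
  by exists m, T; rewrite swK.
have [far|near] := boolP ((p.+1 < a)%N || (a.+1 < p)%N).
  have far' : (a.+1 < p)%N || (p.+1 < a)%N by rewrite orbC.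
  have e1 : sw a s (lo p) = s (lo p) by apply: sw_ne => /=; clear -far; lia.
  have e2 : sw a s (hi p) = s (hi p) by apply: sw_ne => /=; clear -far; lia.
  have e3 : sw p s (lo a) = s (lo a) by apply: sw_ne => /=; clear -far; lia.
  have e4 : sw p s (hi a) = s (hi a) by apply: sw_ne => /=; clear -far; lia.
  rewrite e1 in h1; rewrite e2 in h2; have [m1 [T1 [-> -> b1]]] := IH h1 h2.
  exists m1.+1, (top a T1); split=> //; first exact: top_comm.
  by rewrite sw_comm //; apply: stdS; rewrite ?e3 ?e4.
have [pa1|pa1] := eqVneq (val p) a.+1.
  have e1 : lo p = hi a by apply: val_inj.
  by move: h1; rewrite e1 sw_hi (negPf sA).
have e1 : hi p = lo a by apply: val_inj => /=; move: pa near pa1 => /=; lia.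
by move: h2; rewrite e1 sw_lo sB.
Qed.

Definition filt_gen (m : nat) (T : V) : Prop := exists m1 s, (m1 <= m)%N /\ std m1 s T.
Definition filt m := Ospan (filt_gen m).

Lemma filt_le m m' f : (m <= m')%N -> filt m f -> filt m' f.
Proof.
move=> le; apply: Ospan_sub => h [m1 [s [l b]]]; apply: Ospan_gen.
by exists m1, s; split=> //; lia.
Qed.

Lemma std_filt m s T : std m s T -> filt m T.
Proof. by move=> b; apply: Ospan_gen; exists m, s. Qed.

Lemma filt_eop m i f : filt m f -> filt m (eop i f).
Proof.
apply: (@Ospan_gop _ _ (inl i)) => h [m1 [s [l b]]] /=.
rewrite (std_word i b); case: ifP => _; [apply: Ospan_gen; exists m1, s => //|exact: Ospan0].
Qed.

Definition closed_x (M : V -> Prop) := forall p f, M f -> M (xop p f).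

Lemma Ospan_evQ p q (c d : I) B f : closed_x (Ospan B) -> Ospan B f ->
  Ospan B [ffun s : S => evQ o c d (value iW s p) (value iW s q) * f s : F^o].
Proof.
move=> BX Bf; have B1 p' : Ospan B (xop p' f) by apply: BX.
have B2 p' : Ospan B (xop p' (xop p' f)) by apply: BX.
rewrite /evQ; case: (single_arrow e o c d); last case: (single_arrow e o d c);
  last case: (double_arrow e c d); last case: (double_arrow e d c); last case: (c == d).
- apply: (@Ospan_ext B (xop p f - xop q f)); first exact: OspanB.
  by move=> s; rewrite !ffunE mulrBl.
- apply: (@Ospan_ext B (xop q f - xop p f)); first exact: OspanB.
  by move=> s; rewrite !ffunE mulrBl.
- apply: (@Ospan_ext B (xop p f - xop q (xop q f))); first exact: OspanB.
  by move=> s; rewrite !ffunE mulrBl expr2 mulrA.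
- apply: (@Ospan_ext B (xop q f - xop p (xop p f))); first exact: OspanB.
  by move=> s; rewrite !ffunE mulrBl expr2 mulrA.
- apply: (@Ospan_ext B (0)); first exact: Ospan0.
  by move=> s; rewrite !ffunE mul0r.
- apply: (@Ospan_ext B (f)); first exact: Bf.
  by move=> s; rewrite !ffunE mul1r.
Qed.

Lemma Ospan_evD p q r (c d : I) B f : closed_x (Ospan B) -> Ospan B f ->
  Ospan B [ffun s : S => evD o c d (value iW s r) (value iW s p) (value iW s q) * f s : F^o].
Proof.
move=> BX Bf; have B1 p' : Ospan B (xop p' f) by apply: BX.
have BN h : Ospan B h -> Ospan B (- h) by apply: OspanN.
rewrite /evD; case: (single_arrow e o c d); last case: (single_arrow e o d c);
  last case: (double_arrow e c d); last case: (double_arrow e d c).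
- apply: (@Ospan_ext B (f)); first exact: Bf.
  by move=> s; rewrite !ffunE mul1r.
- apply: (@Ospan_ext B (- f)); first exact: BN.
  by move=> s; rewrite !ffunE mulN1r.
- apply: (@Ospan_ext B (f)); first exact: Bf.
  by move=> s; rewrite !ffunE mul1r.
- apply: (@Ospan_ext B (- (xop r f + xop p f))); first by apply: BN; exact: OspanD.
  by move=> s; rewrite !ffunE mulNr mulrDl.
- apply: (@Ospan_ext B (0)); first exact: Ospan0.
  by move=> s; rewrite !ffunE mul0r.
Qed.

Lemma qop_word a (i : {ffun 'I_n -> I}) f : eop i f = f -> qop a f =
  [ffun s : S => evQ o (i (lo a)) (i (hi a)) (value iW s (lo a)) (value iW s (hi a)) * f s : F^o].
Proof.
move=> fi; apply/ffunP=> s; rewrite !ffunE -fi !ffunE.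
by case: eqP => [<-|]; rewrite ?mulr0 // /qcoef !ffunE.
Qed.

Lemma dop_word p q r (i : {ffun 'I_n -> I}) f : eop i f = f -> dop p q r f =
  if i p == i r then
  [ffun s : S => evD o (i p) (i q) (value iW s r) (value iW s p) (value iW s q) * f s : F^o]
  else 0.
Proof.
move=> fi; apply/ffunP=> s; rewrite !ffunE -fi !ffunE.
case: (eqVneq (word s) i) => [<-|ne].
  by rewrite !ffunE; case: ifP => _; rewrite !ffunE // eqxx.
by rewrite !mulr0 if_same; case: ifP => _; rewrite !ffunE // (negPf ne) mulr0.
Qed.

Lemma sameop_word p q (i : {ffun 'I_n -> I}) f : eop i f = f ->
  @sameop n e F L p q f = if i p == i q then f else 0.
Proof.
move=> fi; apply/ffunP=> s; rewrite !ffunE -{1}fi !ffunE.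
case: (eqVneq (word s) i) => [<-|ne]; first by rewrite !ffunE; case: ifP => _; rewrite ?ffunE.
rewrite if_same; case: ifP => _; last by rewrite ffunE.
by rewrite -fi ffunE (negPf ne).
Qed.

Lemma std_eop m s T : std m s T -> eop (word s) T = T.
Proof. by move=> b; rewrite (std_word _ b) eqxx. Qed.

Lemma top_braidV a b f : b = a.+1 :> nat ->
  top b (top a (top b f)) = top a (top b (top a f)) + dop (lo a) (hi a) (hi b) f.
Proof.
move=> ba; apply/ffunP=> s; rewrite [RHS]ffunE; apply/eqP; rewrite addrC -subr_eq; apply/eqP.
exact: top_braid.
Qed.

Lemma filt_sameop m s T p q : std m s T -> filt m (@sameop n e F L p q T).
Proof.
move=> b; rewrite (sameop_word p q (std_eop b)); case: ifP => _; last exact: Ospan0.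
exact: std_filt b.
Qed.

Definition straightens (m : nat) : Prop :=
  (forall p f, filt m f -> filt m (xop p f)) /\
  (forall s T a, std m s T -> filt m.+1 (top a T) /\
    (~~ s (lo a) && s (hi a) \/ filt m (top a T))).

Lemma filt_top m a f : (forall m1, (m1 <= m)%N -> straightens m1) -> filt m f -> filt m.+1 (top a f).
Proof.
move=> st; apply: (@Ospan_gop _ _ (inr (inr a))) => h [m1 [s [l b]]].
by have [_ /(_ _ _ a b) [h1 _]] := st _ l; apply: filt_le h1.
Qed.

(** Induction on the length of the path. A dot is moved through the last tau. For tau_q
    there are three cases besides A B. At B A the last step can be taken at q, and tau_q^2
    is a polynomial in the dots. At two entries of one row tau_q either commutes with the
    last step, or the path can be rearranged so that tau_q completes a braid with its two
    last steps; on the other side of the braid relation the first tau acts at two entries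
    of one row again, lower in the filtration. *)
Lemma straightensP m : straightens m.
Proof.
elim/ltn_ind: m => -[_|m IH].
  split=> [p f|s T a b].
    apply: (@Ospan_gop _ _ (inr (inl p))) => h [m1 [s [l b]]].
    have {l} m10 : m1 = 0%N by lia.
    rewrite m10 in b; have [_ ->] := std0_inv b.
    rewrite /= xop_dirac; apply: OspanZ; exact: std_filt std0.
  have [sT sE] := std0_inv b.
  have [ab|nab] := boolP (~~ s (lo a) && s (hi a)).
    by case/andP: (ab) => h1 h2; split; [exact: (std_filt (stdS b h1 h2)) | left].
  have -> : top a T = 0.
    by rewrite sE /start_vec top_dirac //; move: nab; rewrite sT !ffunE /=; lia.
  by split; [|right]; exact: Ospan0.
have IHm : straightens m by apply: IH.
have IHt j a f : (j <= m)%N -> filt j f -> filt j.+1 (top a f).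
  by move=> jm; apply: filt_top => m1 l; apply: IH; lia.
have IHx j p f : (j <= m)%N -> filt j f -> filt j (xop p f).
  by move=> jm; have [h _] := IH j jm; apply: h.
have Xx p f : filt m.+1 f -> filt m.+1 (xop p f).
  apply: (@Ospan_gop _ _ (inr (inl p))) => h [m1 [s [l b]]].
  have [l1|] := leqP m1 m; first by apply: (filt_le (leqnSn m)); apply: IHx => //; apply: filt_le l1 (std_filt b).
  move=> l2; have m1E : m1 = m.+1 by lia.
  rewrite m1E in b; have [a [s' [T [_ -> {}b sA sB]]]] := stdS_inv b.
  have XT := std_filt b.
  have [pl|pl] := eqVneq p (lo a).
    have -> : gop (inr (inl p)) (top a T) = top a (xop (hi a) T) - (@sameop n e F L (lo a) (hi a) T).
      by rewrite -(top_xr o L_ne W_ne a T) opprB addrCA subrr addr0 pl.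
    by apply: OspanB; [apply: IHt => //; exact: IHx | apply: filt_le (filt_sameop _ _ b)].
  have [ph|ph] := eqVneq p (hi a).
    have -> : gop (inr (inl p)) (top a T) = top a (xop (lo a) T) + (@sameop n e F L (lo a) (hi a) T).
      by rewrite -(top_xl o L_ne W_ne a T) addrCA subrr addr0 ph.
    by apply: OspanD; [apply: IHt => //; exact: IHx | apply: filt_le (filt_sameop _ _ b)].
  have -> : gop (inr (inl p)) (top a T) = top a (xop p T).
    by apply/esym/top_x.
  by apply: IHt => //; exact: IHx.
split=> // s T q b.
suff H : ~~ s (lo q) && s (hi q) \/ filt m.+1 (top q T).
  case: H => [h|h]; last by split; [exact: filt_le h | right].
  by split; [case/andP: (h) => h1 h2; exact: (std_filt (stdS b h1 h2)) | left].
have [ab|nab] := boolP (~~ s (lo q) && s (hi q)); [by left | right].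
have closedX j : (j <= m)%N -> closed_x (filt j) by move=> jm p f; exact: IHx.
(* B A: the last step can be taken at q, so that tau_q occurs squared. *)
have [/andP[ba1 ba2]|nba] := boolP (s (lo q) && ~~ s (hi q)).
  have [m1 [T1 [[<-] -> b1]]] := std_removable b ba1 ba2.
  rewrite top_top // (qop_word q (std_eop b1)).
  apply: (filt_le (leqnSn m)); apply: Ospan_evQ; first exact: (closedX m (leqnn m)).
  exact: std_filt b1.
have sq : s (lo q) = s (hi q) by move: nab nba; case: (s (lo q)) (s (hi q)) => [] [].
have {nab nba} HB (a : 'I_n.-1) m1 s1 T1 : (m1 <= m)%N -> std m1 s1 T1 ->
    s1 (lo a) = s1 (hi a) -> filt m1 (top a T1).
  move=> l b1 s1E; have [_ /(_ _ _ a b1) [_ [|//]]] := IH m1 l.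
  by rewrite s1E; case: (s1 (hi a)).
have [a [s' [T' [sE -> {}b sA sB]]]] := stdS_inv b; rewrite {s}sE in sq.
have [aq|aq] := eqVneq (val a) (val q).
  have {}aq : a = q by apply: val_inj.
  by move: sq; rewrite aq sw_lo sw_hi => h; move: sA sB; rewrite aq h => /negPf ->.
have [far|near] := boolP ((q.+1 < a)%N || (a.+1 < q)%N).
  rewrite top_comm //; apply: IHt => //; apply: HB b _ => //.
  have e1 : sw a s' (lo q) = s' (lo q) by apply: sw_ne => /=; clear -far; lia.
  have e2 : sw a s' (hi q) = s' (hi q) by apply: sw_ne => /=; clear -far; lia.
  by rewrite -e1 -e2.
have [qa|qa] := eqVneq (val q) a.+1.
  have lq : lo q = hi a by apply: val_inj.
  have e2 : sw a s' (hi q) = s' (hi q) by apply: sw_ne; rewrite /= qa; clear; lia.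
  rewrite lq sw_hi e2 in sq.
  have [||m2 [T2 [m2E T2E b2]]] := std_removable (p := q) b; rewrite ?lq -?sq //.
  have dX : filt m2 (dop (lo a) (hi a) (hi q) T2).
    rewrite (dop_word _ _ _ (std_eop b2)); case: ifP => _; last exact: Ospan0.
    by apply: Ospan_evD; [apply: closedX; lia | exact: std_filt b2].
  rewrite T2E top_braidV //; apply: OspanD; last by apply: filt_le dX; lia.
  have lm : (m2 <= m)%N by lia.
  apply: (IHt) => //; rewrite m2E; apply: (IHt) => //; apply: (HB _ _ _ _ lm b2).
  by rewrite -[in RHS]lq sw_lo -sq sw_ne //= qa; clear; lia.
have {near qa} qa : val a = q.+1 by move: aq near qa => /=; clear; lia.
have la : lo a = hi q by apply: val_inj.
have e1 : sw a s' (lo q) = s' (lo q) by apply: sw_ne; rewrite /= qa; clear; lia.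
rewrite -la sw_lo e1 in sq.
have [||m2 [T2 [m2E T2E b2]]] := std_removable (p := q) b; rewrite -?la ?sq //.
have dX : filt m2 (dop (lo q) (hi q) (hi a) T2).
  rewrite (dop_word _ _ _ (std_eop b2)); case: ifP => _; last exact: Ospan0.
  by apply: Ospan_evD; [apply: closedX; lia | exact: std_filt b2].
have -> : top q (top a T') = top a (top q (top a T2)) - dop (lo q) (hi q) (hi a) T2.
  by rewrite T2E (@top_braidV q a) // addrK.
apply: OspanB; last by apply: filt_le dX; lia.
have lm : (m2 <= m)%N by lia.
apply: (IHt) => //; rewrite m2E; apply: (IHt) => //; apply: (HB _ _ _ _ lm b2).
by rewrite la sw_hi sq sw_ne //= qa; clear; lia.
Qed.

Definition lattice := Ospan (fun T => exists m s, std m s T).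
Definition lattice1 := Ospan (fun T => exists m s, std m.+1 s T).

Lemma filt_lattice m f : filt m f -> lattice f.
Proof. by apply: Ospan_sub => h [m1 [s [_ b]]]; apply: Ospan_gen; exists m1, s. Qed.

Lemma std_Lat m s T : std m s T -> lattice T.
Proof. by move=> b; apply: Ospan_gen; exists m, s. Qed.

Lemma lattice_gop g f : lattice f -> lattice (gop g f).
Proof.
apply: Ospan_gop => T [m [s b]]; case: g => [i|[p|a]].
- by have := @filt_eop m i T (std_filt b); apply: filt_lattice.
- by have [/(_ p T (std_filt b)) h _] := straightensP m; apply: filt_lattice h.
- by have [_ /(_ s T a b) [h _]] := straightensP m; apply: filt_lattice h.
Qed.

Lemma cnt_start j : (j <= n)%N -> cnt false start j = minn j k /\ cnt true start j = (j - k)%N.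
Proof.
elim: j => [|j IH] jn; first by rewrite !cnt0 min0n.
have [h1 h2] := IH (ltnW jn).
rewrite !(cntS _ _ (Ordinal jn)) /= h1 h2 ffunE /=; case: leqP; lia.
Qed.

Lemma rank_start p : rank start p = if (p < k)%N then val p else (p - k)%N.
Proof.
have [h1 h2] := cnt_start (ltnW (ltn_ord p)); rewrite /rank ffunE.
by case: leqP => h; rewrite ?h1 ?h2 // (minn_idPl (ltnW h)).
Qed.

Lemma std_cnt m s T : std m s T -> cnt true s n = (n - k)%N.
Proof.
elim=> [|{}m {}s {}T a _ IH _ _]; first by have [_ ->] := cnt_start (leqnn n).
by rewrite cnt_sw //; have := pos_hi_subproof a; clear; lia.
Qed.

Lemma two_rowB m s T p q : std m s T -> s p -> s q -> (p < q)%N -> (k.+1 < n)%N.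
Proof.
move=> b sp sq pq; have := std_cnt b.
rewrite /cnt (bigD1 p) ?ltn_ord //= sp (bigD1 q) /=; last first.
  by rewrite ltn_ord -(inj_eq val_inj) /=; clear -pq; lia.
by rewrite sq; move: (\sum_(_ < _ | _) _) => x; move: (ltn_ord p) (ltn_ord q) k_le pq; clear; lia.
Qed.

(** The first step brings an entry of row B into the first k positions, and no step takes
    it out again. *)
Lemma std_first m s T : std m.+1 s T ->
  exists p : 'I_n, [/\ (p < k)%N, s p & rank s p = 0%N].
Proof.
move=> b; have [p [pk sp]] : exists p : 'I_n, (p < k)%N /\ s p.
  move E : m.+1 b => m' b; elim: b m E => // {}m' {}s {}T a b IH sA sB m [m'E].
  case: m' m'E IH b => [|m'] m'E IH b.
    have [s0E _] := std0_inv b; exists (lo a); rewrite sw_lo; split=> //.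
    by move: sA; rewrite s0E ffunE /=; clear; lia.
  have [p [pk sp]] := IH m' erefl.
  have [pE|p1] := eqVneq p (lo a); first by move: sA; rewrite -pE sp.
  have [pE|p2] := eqVneq p (hi a).
    by exists (lo a); rewrite sw_lo sB; split=> //; move: pk; rewrite pE /=; clear; lia.
  by exists p; split=> //; rewrite sw_ne.
have h : exists j : nat, [exists p : 'I_n, (val p == j) && s p].
  by exists (val p); apply/existsP; exists p; rewrite eqxx.
case: (ex_minnP h) => j /existsP[q /andP[/eqP qj sq]] jmin.
exists q; split=> //.
  by apply: leq_ltn_trans pk; rewrite qj; apply: jmin; apply/existsP; exists p; rewrite eqxx.
rewrite /rank sq /cnt big1 // => r rq; case sr : (s r) => //.
have := jmin r; suff -> : [exists p : 'I_n, (val p == r) && s p] by move/(_ isT); move: rq; rewrite qj; clear; lia.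
by apply/existsP; exists r; rewrite eqxx.
Qed.

Hypothesis lead_notin : forall r, (r < k)%N -> L false r != L true 0.

Lemma start_word_lt p : (p < k)%N -> start_word p != L true 0.
Proof.
move=> pk; rewrite ffunE /letter rank_start pk.
by have -> : start p = false; [rewrite ffunE leqNgt pk | apply: lead_notin].
Qed.

Lemma std_start_word m s T : std m s T -> word s = start_word -> m = 0%N.
Proof.
case: m => // m b wE; have [p [pk sp rp]] := std_first b.
by have := start_word_lt pk; rewrite -wE ffunE /letter sp rp eqxx.
Qed.

Lemma std_start_vec m s T : std m s T -> word s = start_word -> T = start_vec.
Proof. by move=> b w; have m0 := std_start_word b w; rewrite m0 in b; have [] := std0_inv b. Qed.

Lemma eop_start m s T : std m.+1 s T -> eop start_word T = 0.
Proof.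
move=> b; rewrite (std_word _ b); case: eqP => // w; by have := std_start_word b w.
Qed.

Lemma start_vec_word : eop start_word start_vec = start_vec.
Proof. by rewrite eop_dirac eqxx. Qed.

Lemma lattice_split f : lattice f ->
  exists c, eop start_word f = iota c *: start_vec /\ lattice1 (f - iota c *: start_vec).
Proof.
elim=> {f} [f [[|m] [s b]]||f h _ [c [c1 c2]] _ [d [d1 d2]]|c f _ [d [d1 d2]]].
- have [_ ->] := std0_inv b; exists 1; rewrite rmorph1 scale1r subrr start_vec_word.
  by split=> //; exact: Ospan0.
- exists 0; rewrite rmorph0 scale0r subr0 (eop_start b); split=> //.
  by apply: Ospan_gen; exists m, s.
- by exists 0; rewrite rmorph0 scale0r subr0 eop0; split=> //; exact: Ospan0.
- exists (c + d); rewrite eopD c1 d1 rmorphD scalerDl; split=> //.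
  by rewrite opprD addrACA; exact: OspanD.
- exists (c * d); rewrite eopZ d1 rmorphM scalerA; split=> //.
  by rewrite -scalerA -scalerBr; exact: OspanZ.
Qed.

Lemma std_support m s T t : std m s T -> T t != 0 -> word t = word s.
Proof.
move=> b; have /ffunP/(_ t) := std_eop b; rewrite ffunE.
by case: eqP => // _ ->; rewrite eqxx.
Qed.

Variables (zeta : {poly K}) (hook : bool) (n_gt0 : (0 < n)%N).
Let p0 : 'I_n := Ordinal n_gt0.
Definition zeta_multiple (x : F) := exists g, x = iota (zeta * g).
Hypothesis HQ : (0 < k)%N -> (k < n)%N ->
  zeta_multiple (evQ o (L false k.-1) (L true 0) (iW false k.-1) (iW true 0)).
Hypothesis HD : (0 < k)%N -> (k.+1 < n)%N -> L false k.-1 = L true 1 ->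
  zeta_multiple (evD o (L false k.-1) (L true 0) (iW true 1) (iW false k.-1) (iW true 0)).
Hypothesis hook_k : hook -> (1 < k < n)%N.
Hypothesis hook_Q : hook ->
  zeta_multiple (evQ o (L false 0) (L true 0) (iW false 0) (iW true 0)).
Hypothesis hook_ne : hook -> L false 1 != L true 1.
Hypothesis hook_D : hook -> (k.+1 < n)%N -> L false 0 = L true 1 ->
  zeta_multiple (evD o (L false 0) (L true 0) (iW true 1) (iW false 0) (iW true 0)).

Definition latticeB := Ospan (fun T => exists m s, std m s T /\ s p0).
(** The third kind of generators is for the case in which Lambda may vanish at the head of
    row B: the cyclotomic ideal then contains e(i) for each word i that begins with it,
    and the vectors of these words have to be divided out. *)
Definition sublattice_gen (f : V) : Prop :=
  [\/ f = iota (zeta ^+ 2) *: start_vec, exists m s T, std m.+1 s T /\ f = iota zeta *: T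
    | hook /\ exists m s, std m s f /\ s p0].
Definition sublattice := Ospan sublattice_gen.

Lemma sublattice_zeta2 g : sublattice (iota (zeta ^+ 2 * g) *: start_vec).
Proof. by rewrite mulrC rmorphM -scalerA; apply: OspanZ; apply: Ospan_gen; constructor 1. Qed.

Lemma sublattice_lattice1 f : lattice1 f -> sublattice (iota zeta *: f).
Proof.
apply: (@Ospan_map _ _ (fun f => iota zeta *: f)) => [{}f h|c {}f|h [m [s b]]].
- exact: scalerDr.
- by rewrite !scalerA mulrC.
- by apply: Ospan_gen; constructor 2; exists m, s, h.
Qed.

(** The component along start_vec is the only one for which a factor zeta does not suffice. *)
Lemma sublattice_lattice f g : lattice f -> eop start_word f = iota (zeta * g) *: start_vec ->
  sublattice (iota zeta *: f).
Proof.
move=> Lf fE; have [c [c1 c2]] := lattice_split Lf.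
rewrite -(subrK (iota c *: start_vec) f) scalerDr; apply: OspanD; first exact: sublattice_lattice1.
by rewrite -c1 fE scalerA -rmorphM mulrA -expr2; exact: sublattice_zeta2.
Qed.

Lemma sublattice_latticeB f : hook -> latticeB f -> sublattice f.
Proof. by move=> hk; apply: Ospan_sub => h B; apply: Ospan_gen; constructor 3. Qed.

Lemma scale_start g x : x = iota (zeta * g) -> x *: start_vec = iota (zeta * g) *: start_vec.
Proof. by move->. Qed.

Lemma qop_dirac a s : qop a (dirac s) = qcoef o L iW a s *: dirac s.
Proof.
apply/ffunP=> t; rewrite !ffunE; case: (eqVneq t s) => [->|_] //.
by rewrite !mulr0 scaler0.
Qed.

(** A state whose word is one swap away from start_word carries the head b_0 of row B
    at position k - 1. Either it is itself one swap away from start, and tau^2 gives the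
    value of Q at (0, W true 0); or b_1 repeats the last letter a_{k-1} of row A, the
    state ends in a further swap, and the braid relation gives a divided difference. *)
Lemma eop_start_top m s T (p : 'I_n.-1) : std m.+1 s T ->
  exists g, eop start_word (top p T) = iota (zeta * g) *: start_vec.
Proof.
move=> b; have -> : eop start_word (top p T) = top p (eop (sw p start_word) T).
  by rewrite (top_e o L iW p (sw p start_word) T) swK.
rewrite (std_word _ b); case: eqP => [wE|_]; last first.
  by exists 0; rewrite mulr0 rmorph0 scale0r; exact: (gen_op0 (inr (inr p))).
have [r [rk sr rr]] := std_first b.
have wr : sw p start_word r = L true 0 by rewrite -wE ffunE /letter sr rr.
have [rE|r1] := eqVneq r (lo p); last first.
  have [rE|r2] := eqVneq r (hi p).
    have pk : (lo p < k)%N by move: rk; rewrite rE /=; clear; lia.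
    by have := start_word_lt pk; rewrite -wr rE sw_hi eqxx.
  by have := start_word_lt rk; rewrite -wr sw_ne ?eqxx.
rewrite {r}rE in rk sr rr wr.
have hk : (k <= hi p)%N.
  by rewrite leqNgt; apply/negP => /start_word_lt; rewrite -wr sw_lo eqxx.
have pk1 : p = k.-1 :> nat by move: hk rk => /=; clear; lia.
have kE : k = p.+1 :> nat by move: hk rk => /=; clear; lia.
have k0 : (0 < k)%N by rewrite kE.
have kn : (k < n)%N by rewrite kE; exact: pos_hi_subproof.
have s0l : start (lo p) = false by rewrite ffunE leqNgt rk.
have s0h : start (hi p) by rewrite ffunE.
have r0l : rank start (lo p) = k.-1 by rewrite rank_start rk.
have r0h : rank start (hi p) = 0%N by rewrite rank_start ltnNge hk /= kE subnn.
have W0lo : start_word (lo p) = L false k.-1.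
  by rewrite ffunE /letter s0l r0l.
have [sB|sA] := boolP (s (hi p)); last first.
  have [m1 [T1 [_ TE b1]]] := std_removable b sr sA.
  have TE1 : T1 = start_vec.
    by apply: std_start_vec b1 _; rewrite word_sw ?(negPf sA) ?sr // wE swK.
  have [g gE] := HQ k0 kn; exists g; apply: etrans (scale_start gE).
  by rewrite TE TE1 top_top // qop_dirac /qcoef /value /letter s0l r0l s0h r0h.
have k1n : (k.+1 < n)%N by apply: (two_rowB b sr sB); rewrite /=.
have rhi : rank s (hi p) = 1%N by rewrite rank_same ?rr // sr sB.
have LL : L false k.-1 = L true 1.
  by rewrite -W0lo -(sw_hi p start_word) -wE ffunE /letter sB rhi.
have kn1 : (k < n.-1)%N by clear -k1n; lia.
pose q : 'I_n.-1 := Ordinal kn1.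
have lq : lo q = hi p by apply: val_inj; rewrite /= kE.
have W0q : start_word (hi q) = L true 1.
  rewrite ffunE /letter rank_start ffunE /=.
  have -> : (k <= k.+1)%N by [].
  by have -> : (k.+1 < k)%N = false; [clear; lia | rewrite subSnn].
have nq1 : hi q != p :> nat by rewrite /= kE; clear; lia.
have nq2 : hi q != p.+1 :> nat by rewrite /= kE; clear; lia.
have sq : ~~ s (hi q).
  apply/negP => sq; have rq : rank s (hi q) = 2 by rewrite rank_same lq ?rhi // sB sq.
  have := L_ne true 1; rewrite -{1}W0q -(sw_ne (a := p) start_word nq1 nq2) -wE ffunE /letter sq rq.
  by rewrite eqxx.
have sloq : s (lo q) by rewrite lq.
have [m2 [T2 [_ TE b2]]] := std_removable b sloq sq.
have nlo1 : lo p != q :> nat by rewrite /= kE; clear; lia.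
have nlo2 : lo p != q.+1 :> nat by rewrite /= kE; clear; lia.
have u1 : sw q s (lo p) by rewrite sw_ne.
have u2 : ~~ sw q s (hi p) by rewrite -lq sw_lo.
have [m3 [T3 [_ T2E b3]]] := std_removable b2 u1 u2.
have T3E : T3 = start_vec.
  apply: std_start_vec b3 _; rewrite word_sw ?u1 ?(negPf u2) // word_sw ?sloq ?(negPf sq) // wE.
  apply/ffunP=> t; have [->|t1] := eqVneq t (lo p).
    by rewrite sw_lo -lq sw_lo sw_ne // W0q W0lo LL.
  have [->|t2] := eqVneq t (hi p).
    by rewrite sw_hi [LHS]sw_ne // sw_lo.
  rewrite [LHS]sw_ne //; have [->|t3] := eqVneq t (hi q).
    by rewrite sw_hi lq sw_hi W0q W0lo LL.
  have t4 : t != lo q by rewrite lq.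
  by rewrite sw_ne // sw_ne.
have [g gE] := HD k0 k1n LL; exists (- g); rewrite mulrN rmorphN -gE.
have qp : q = p.+1 :> nat by rewrite /= kE.
have bra := top_braidV start_vec qp; rewrite TE T2E T3E.
have tq : top q start_vec = 0.
  by rewrite top_dirac // !ffunE /=; have -> : (k <= k.+1)%N; rewrite ?leqnn.
rewrite tq in bra.
have z0 : top p (0 : V) = 0 := gen_op0 (inr (inr p)).
have z1 : top q (0 : V) = 0 := gen_op0 (inr (inr q)).
rewrite z0 z1 in bra; move/eqP: bra; rewrite eq_sym addr_eq0 => /eqP ->.
rewrite scaleNr; congr (- _); rewrite (dop_word _ _ _ start_vec_word) W0lo W0q LL eqxx.
apply/ffunP=> t; rewrite !ffunE; case: (eqVneq t start) => [->|_]; last by rewrite !mulr0 scaler0.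
have W0hi : start_word (hi p) = L true 0 by rewrite -wr sw_lo.
rewrite -LL; congr (evD _ _ _ _ _ _ * _).
- by rewrite -W0hi ffunE.
- by rewrite /value rank_start ffunE /= ltnNge leqnSn /= subSnn.
- by rewrite /value s0l r0l.
- by rewrite /value s0h r0h.
Qed.

Lemma sublattice_gop_gen g f :
  f = iota (zeta ^+ 2) *: start_vec \/ (exists m s T, std m.+1 s T /\ f = iota zeta *: T) ->
  sublattice (gop g f).
Proof.
case=> [->|[m [s [T [b ->]]]]]; rewrite gen_opZ.
  have N1 : sublattice (iota (zeta ^+ 2) *: start_vec) by have := sublattice_zeta2 1; rewrite mulr1.
  case: g => [i|[p|a]] /=.
  - by rewrite eop_dirac; case: ifP => _ //; rewrite scaler0; exact: Ospan0.
  - by rewrite xop_dirac scalerA mulrC -scalerA; exact: OspanZ.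
  have [/andP[h1 h2]|h] := boolP (~~ start (lo a) && start (hi a)).
    rewrite expr2 rmorphM -scalerA; apply: OspanZ; apply: sublattice_lattice1; apply: Ospan_gen.
    by exists 0%N, (sw a start); exact: stdS std0 h1 h2.
  rewrite top_dirac ?scaler0; first exact: Ospan0.
  by move: h; rewrite !ffunE /=; clear; lia.
have H : exists d, eop start_word (gop g T) = iota (zeta * d) *: start_vec.
  case: g => [i|[p|a]] /=; last exact: eop_start_top b.
  - exists 0; rewrite mulr0 rmorph0 scale0r (std_word _ b).
    by case: ifP => _; [exact: eop_start b | exact: eop0].
  - exists 0; rewrite mulr0 rmorph0 scale0r.
    have -> : eop start_word (xop p T) = xop p (eop start_word T).
      by apply/ffunP=> t; rewrite !ffunE; case: ifP; rewrite ?mulr0.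
    by rewrite (eop_start b); exact: (gen_op0 (inr (inl p))).
have [d dE] := H; apply: sublattice_lattice dE; apply: lattice_gop; exact: std_Lat b.
Qed.

Lemma rank0 s : rank s p0 = 0%N.
Proof. by rewrite /rank cnt0. Qed.

Lemma word0 s : word s p0 = L (s p0) 0.
Proof. by rewrite ffunE /letter rank0. Qed.

Lemma word0_B s : (0 < k)%N -> (word s p0 == L true 0) = s p0.
Proof.
move=> k0; rewrite word0; case: (s p0); first by rewrite eqxx.
exact/negbTE/lead_notin.
Qed.

Lemma latticeB_eop (w : {ffun 'I_n -> I}) f : (0 < k)%N -> w p0 = L true 0 -> lattice f -> latticeB (eop w f).
Proof.
move=> k0 w0; apply: (@Ospan_gop _ _ (inl w)) => T [m [s b]] /=; rewrite (std_word _ b).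
case: eqP => [wE|_]; last exact: Ospan0.
by apply: Ospan_gen; exists m, s; split=> //; rewrite -(word0_B _ k0) wE w0.
Qed.

Lemma latticeB_gop g f : (0 < k)%N -> (forall a, g = inr (inr a) -> val a <> 0%N) ->
  latticeB f -> latticeB (gop g f).
Proof.
move=> k0 ga; apply: Ospan_gop => T [m [s [b sB]]].
have wB : word s p0 = L true 0 by apply/eqP; rewrite word0_B.
have LT := lattice_gop g (std_Lat b).
case: g ga LT => [i|[p|a]] ga LT /=.
- rewrite (std_word _ b); case: ifP => _; last exact: Ospan0.
  by apply: Ospan_gen; exists m, s.
- suff -> : xop p T = eop (word s) (xop p T) by exact: latticeB_eop.
  apply/ffunP=> t; rewrite !ffunE -{1}(std_eop b) ffunE.
  by case: ifP; rewrite ?mulr0.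
- suff -> : top a T = eop (sw a (word s)) (top a T).
    apply: latticeB_eop => //; rewrite sw_ne //=; first by have := ga a erefl => /=; case: (val a).
  by rewrite -{1}(std_eop b) top_e.
Qed.

Lemma sublattice_gop_far g f : (forall a, g = inr (inr a) -> val a <> 0%N) ->
  sublattice f -> sublattice (gop g f).
Proof.
move=> ga; apply: Ospan_gop => h [hE|hE|[hk [m [s [b sB]]]]].
- by apply: sublattice_gop_gen; left.
- by apply: sublattice_gop_gen; right.
- apply: sublattice_latticeB => //; apply: latticeB_gop => //; first by case/andP: (hook_k hk) => /ltnW.
  by apply: Ospan_gen; exists m, s.
Qed.

Lemma sublattice_scale m s T g : std m.+1 s T -> sublattice (iota (zeta * g) *: T).
Proof.
move=> b; rewrite mulrC rmorphM -scalerA; apply: OspanZ; apply: sublattice_lattice1.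
by apply: Ospan_gen; exists m, s.
Qed.

Lemma eop_absent (w : {ffun 'I_n -> I}) f : (forall s, word s != w) -> lattice f -> eop w f = 0.
Proof.
move=> nw; elim=> {f} [f [m [s b]]||f h _ IHf _ IHh|c f _ IHf].
- by rewrite (std_word _ b) (negPf (nw s)).
- exact: eop0.
- by rewrite eopD IHf IHh addr0.
- by rewrite eopZ IHf scaler0.
Qed.

Section Hook.
Hypothesis hk : hook.
Variable a : 'I_n.-1.
Hypothesis a0 : val a = 0%N.

Let loa : lo a = p0. Proof. exact: val_inj. Qed.
Let hia : hi a = 1%N :> nat. Proof. by rewrite /= -[nat_of_ord a]/(val a) a0. Qed.
Let k1 : (1 < k)%N. Proof. by case/andP: (hook_k hk). Qed.
Let k0 : (0 < k)%N. Proof. exact: ltnW. Qed.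

Lemma rank_hi s : rank s (hi a) = (s p0 == s (hi a)).
Proof. by rewrite /rank (cntS _ _ (lo a)) loa cnt0. Qed.

(** The head of row B is not among the first letters of row A, so that a word beginning
    with a_0 b_0 tells the rows of its first two entries. *)
Lemma word_AB s : word s p0 = L false 0 -> word s (hi a) = L true 0 ->
  s p0 = false /\ s (hi a) = true.
Proof.
rewrite word0 ffunE /letter rank_hi => h1 h2.
have sA : s p0 = false.
  by apply/negbTE/negP => sB; move: (lead_notin k0); rewrite -h1 sB eqxx.
split=> //; move: h2; rewrite sA; case: (s (hi a)) => //= h2.
by move: (lead_notin k1); rewrite h2 eqxx.
Qed.

Lemma scale_AB m s T : std m s T -> s p0 = false -> s (hi a) = true ->
  qop a T = evQ o (L false 0) (L true 0) (iW false 0) (iW true 0) *: T.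
Proof.
move=> b s1 s2; apply/ffunP=> t; rewrite !ffunE.
have [->|/(std_support b) wE] := eqVneq (T t) 0; first by rewrite mulr0 scaler0.
have [] := @word_AB t; rewrite ?wE ?word0 ?s1 //.
  by rewrite ffunE /letter rank_hi s1 s2.
move=> t1 t2; congr (_ * _); rewrite /qcoef /letter /value loa t1 t2 rank0.
by rewrite rank_hi t1 t2.
Qed.

(** Induction on the length of the path. If the second entry is of row A, then the last
    step can be taken at 0, and tau_0^2 is a multiple of zeta. If it is of row B, the last
    step either commutes with tau_0 or is at 1; in the latter case the two last steps are at
    0 and at 1, one side of the braid relation vanishes because no state has a word that
    begins with a_0 b_1, and the divided difference is a multiple of zeta. *)
Lemma top_front m s T : std m s T -> s p0 -> sublattice (top a T).
Proof.
have s0F : start p0 = false by rewrite ffunE /=; move: k0; case: (k).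
elim: m s T => [|m IH] s T b sB.
  by have [sE _] := std0_inv b; move: sB; rewrite sE s0F.
have notS0 (t : S) : t (hi a) -> t <> start.
  by move=> th tE; move: th; rewrite tE ffunE hia; move: k1; clear; lia.
have [sB1|sA1] := boolP (s (hi a)); last first.
  have [|m1 [T1 [_ -> b1]]] := std_removable b _ sA1; first by rewrite loa.
  have u1 : sw a s p0 = false by rewrite -loa sw_lo; exact: negbTE.
  have u2 : sw a s (hi a) = true by rewrite sw_hi loa.
  rewrite top_top // (scale_AB b1 u1 u2).
  have [g ->] := hook_Q hk; case: m1 b1 {IH} => [|m1] b1; last exact: sublattice_scale b1.
  by have [/notS0 []] := std0_inv b1.
have [r [s' [T' [sE -> b' sA' sB']]]] := stdS_inv b.
have ra : r != a :> nat.
  apply/eqP => h; have {}h : r = a by apply: val_inj.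
  by move: sB1; rewrite sE h sw_hi -h (negPf sA').
have r0 : val r <> 0%N by move=> h; move: ra; rewrite /= -[nat_of_ord r]/(val r) h -[nat_of_ord a]/(val a) a0.
have s'0 : s' p0 by move: sB; rewrite sE sw_ne //= ; move: r0 => /=; clear; lia.
have [far|near] := boolP (a.+1 < r)%N.
  rewrite top_comm ?far //.
  by apply: (@sublattice_gop_far (inr (inr r))) => [_ [<-] //|]; exact: (IH _ _ b').
have r1 : r = a.+1 :> nat.
  by move: near ra r0; rewrite /= -[nat_of_ord a]/(val a) a0 /=; clear; lia.
have lr : lo r = hi a by apply: val_inj.
rewrite lr in sA'.
have [|m2 [T2 [mE -> b2]]] := std_removable b' _ sA'; first by rewrite loa.
set s2 := sw a s' in b2.
have t1 : s2 p0 = false by rewrite -loa sw_lo; exact: negbTE.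
have t2 : s2 (hi a) = true by rewrite sw_hi loa.
have t3 : s2 (hi r) = true by rewrite sw_ne //= r1; clear; lia.
have t3w : word s2 (hi r) = L true 1.
  by rewrite ffunE /letter rank_same lr ?t2 ?t3 // rank_hi t1 t2.
have rT2 : top r T2 = 0.
  have -> : top r T2 = eop (sw r (word s2)) (top r T2).
    by rewrite -{1}(std_eop b2) top_e.
  apply: eop_absent; last exact: (lattice_gop (inr (inr r)) (std_Lat b2)).
  move=> t; apply/eqP => tE.
  have e1 : word t p0 = L false 0.
    by rewrite tE sw_ne ?word0 ?t1 //= r1; clear; lia.
  have e2 : word t (hi a) = L true 1 by rewrite tE -lr sw_lo.
  have tp : t p0 = false.
    by apply/negbTE/negP => tB; move: (lead_notin k0); rewrite -e1 word0 tB eqxx.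
  move: e2; rewrite ffunE /letter rank_hi tp; case: (t (hi a)) => /= h.
    by have := L_ne true 0; rewrite h eqxx.
  by have := hook_ne hk; rewrite h eqxx.
(* The braid relation for the two last steps r, a of the path and tau_a. *)
have -> : top a (top r (top a T2)) = top r (top a (top r T2)) - dop (lo a) (hi a) (hi r) T2.
  by rewrite (@top_braidV a r) // addrK.
rewrite rT2; have -> : top a 0 = (0 : V) := gen_op0 (inr (inr a)).
have -> : top r 0 = (0 : V) := gen_op0 (inr (inr r)).
rewrite sub0r; apply: OspanN; rewrite (dop_word _ _ _ (std_eop b2)) t3w.
rewrite loa word0 t1; case: eqP => [LE|_]; last exact: Ospan0.
have kn : (k.+1 < n)%N by apply: (two_rowB b2 t2 t3); rewrite /= r1.
have w1 : word s2 (hi a) = L true 0 by rewrite ffunE /letter rank_hi t1 t2.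
rewrite w1; have [g gE] := hook_D hk kn LE.
case: m2 {mE} b2 => [|m2] b2; first by have [/notS0 []] := std0_inv b2.
apply: Ospan_ext (sublattice_scale g b2) _ => t; rewrite !ffunE -gE.
have [->|/(std_support b2) wE] := eqVneq (T2 t) 0; first by rewrite mulr0 scaler0.
have [||x1 x2] := @word_AB t; rewrite ?wE ?word0 ?t1 //.
have x3 : t (hi r) = true.
  have := congr1 (fun w : {ffun _} => w (hi r)) wE; rewrite t3w ffunE /letter.
  case x3 : (t (hi r)) => //; rewrite /rank x3.
  rewrite /= r1 (cntS _ _ (hi a)) (cntS _ _ (lo a)) loa cnt0 x1 x2 /= => h.
  by have := hook_ne hk; rewrite h eqxx.
congr (evD _ _ _ _ _ _ * _).
- by rewrite /value x3 rank_same lr ?x2 ?x3 // rank_hi x1 x2.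
- by rewrite /value x1 rank0.
- by rewrite /value x2 rank_hi x1 x2.
Qed.

End Hook.

Lemma sublattice_gop g f : sublattice f -> sublattice (gop g f).
Proof.
have [[ga [a [gE a0]]]|ga] := pselect (hook /\ exists a, g = inr (inr a) /\ val a = 0%N); last first.
  apply: Ospan_gop => h [hE|hE|[hk [m [s [b sB]]]]].
  - by apply: sublattice_gop_gen; left.
  - by apply: sublattice_gop_gen; right.
  - apply: sublattice_gop_far; last by apply: sublattice_latticeB => //; apply: Ospan_gen; exists m, s.
    by move=> a gE a0; apply: ga; split=> //; exists a.
apply: Ospan_gop => h [hE|hE|[hk [m [s [b sB]]]]].
- by apply: sublattice_gop_gen; left.
- by apply: sublattice_gop_gen; right.
- by rewrite gE; exact: top_front b sB.
Qed.

Variable Lam : {ffun I -> nat}.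
Hypothesis cyc0 : k = 0%N -> exists g, W true 0 ^+ Lam (L true 0) = zeta ^+ 2 * g.
Hypothesis cycA : (0 < k)%N -> W false 0 = 0 /\ (0 < Lam (L false 0))%N.
Hypothesis cycB : (0 < k)%N -> ~~ hook -> exists g, W true 0 ^+ Lam (L true 0) = zeta * g.

Lemma xop0_std m s T : std m s T -> xop p0 T = iota (W (s p0) 0) *: T.
Proof.
move=> b; have [k0|k0] := posnP k.
  case: m b => [|m] b; last by have [p [pk _ _]] := std_first b; move: pk; rewrite k0.
  by have [-> ->] := std0_inv b; rewrite xop_dirac rank0.
apply/ffunP=> t; rewrite !ffunE.
have [->|/(std_support b) wE] := eqVneq (T t) 0; first by rewrite mulr0 scaler0.
by rewrite /value rank0 -(word0_B t k0) wE (word0_B s k0).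
Qed.

Lemma iter_xop0 m s T j : std m s T -> iter j (fun f : V => xop p0 f) T = iota (W (s p0) 0 ^+ j) *: T.
Proof.
move=> b; elim: j => [|j IH]; first by rewrite expr0 rmorph1 scale1r.
by rewrite iterS IH xopZ (xop0_std b) scalerA -rmorphM mulrC -exprS.
Qed.

Lemma cyc_sublattice (i : {ffun 'I_n -> I}) f : lattice f ->
  sublattice (iter (Lam (i p0)) (fun f : V => xop p0 f) (eop i f)).
Proof.
apply: (@Ospan_map _ _ (fun f => iter (Lam (i p0)) (fun f : V => xop p0 f) (eop i f))) => [{}f h|c {}f|T [m [s b]]].
- by rewrite eopD; elim: (Lam _) => // j IH; rewrite !iterS IH xopD.
- by rewrite eopZ; elim: (Lam _) => // j IH; rewrite !iterS IH xopZ.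
rewrite (std_word _ b); case: eqP => [<-|_]; last first.
  suff -> j : iter j (fun f : V => xop p0 f) 0 = 0 by exact: Ospan0.
  by elim: j => // j IH; rewrite iterS IH; exact: (gen_op0 (inr (inl p0))).
rewrite (iter_xop0 _ b) word0; have [k0|k0] := posnP k.
  case: m b => [|m] b; last by have [p [pk _ _]] := std_first b; move: pk; rewrite k0.
  have [-> ->] := std0_inv b; have -> : start p0 = true by rewrite ffunE k0.
  by have [g ->] := cyc0 k0; exact: sublattice_zeta2.
case E : (s p0); last first.
  have [-> l] := cycA k0; rewrite expr0n; case: (Lam _) l => // j _.
  by rewrite rmorph0 scale0r; exact: Ospan0.
have [hk|hk] := boolP hook.
  by apply: OspanZ; apply: sublattice_latticeB => //; apply: Ospan_gen; exists m, s.
have [g ->] := cycB k0 hk; case: m b => [|m] b; last exact: sublattice_scale b.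
by have [sE _] := std0_inv b; move: E; rewrite sE ffunE leqNgt k0.
Qed.

Hypothesis iota_inj : injective iota.
Hypothesis zeta_ndvd : ~~ (zeta ^+ 2 %| zeta).
Variable r0 : nat.
Hypothesis r0n : (k + r0 < n)%N.
Hypothesis W_zeta : W true r0 = zeta.

(** Among the generators only zeta^2 start_vec has a component of weight start_word. *)
Lemma sublattice_dvd beta : sublattice (iota beta *: start_vec) -> zeta ^+ 2 %| beta.
Proof.
have H f : sublattice f -> exists g, eop start_word f = iota (zeta ^+ 2 * g) *: start_vec.
  elim=> {f} [f [->|[m [s [T [b ->]]]]|[hk [m [s [b sB]]]]]||f h _ [c c1] _ [d d1]|c f _ [d d1]].
  - by exists 1; rewrite mulr1 eopZ start_vec_word.
  - by exists 0; rewrite mulr0 rmorph0 scale0r eopZ (eop_start b) scaler0.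
  - exists 0; rewrite mulr0 rmorph0 scale0r; case: m b => [|m] b; last exact: eop_start b.
    have [sE _] := std0_inv b; move: sB; rewrite sE ffunE.
    by case/andP: (hook_k hk) => /ltnW; rewrite ltnNge => /negPf ->.
  - by exists 0; rewrite mulr0 rmorph0 scale0r eop0.
  - by exists (c + d); rewrite eopD c1 d1 -scalerDl -rmorphD -mulrDr.
  - by exists (c * d); rewrite eopZ d1 scalerA -rmorphM mulrCA.
move/H => [g]; rewrite eopZ start_vec_word => /ffunP/(_ start); rewrite !ffunE eqxx.
have sc (x : F) : x *: (1 : F^o) = x by exact: mulr1.
by rewrite !sc => /iota_inj ->; exact: dvdp_mulr.
Qed.

Theorem seminormal_not_semisimple :
  ~ semisimple_ring (cyclotomic_quiver_hecke (@QC1 e o K) Lam n_gt0).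
Proof.
pose kap : {rmorphism K -> F} := GRing.RMorphism.clone _ _ (iota \o polyC) _.
apply: (@not_semisimple K n e o e_ge2 F kap iota L iW L_ne row_Q row_D W_ne Lam n_gt0
  lattice sublattice _ _ _ _ _ _ _ (Ordinal r0n) start_word zeta start_vec).
- exact: OspanD.
- by move=> c f; exact: OspanZ.
- exact: sublattice_gop.
- exact: OspanD.
- by move=> c f; exact: OspanZ.
- exact: lattice_gop.
- exact: cyc_sublattice.
- exact: zeta_ndvd.
- exact: std_Lat std0.
- by move=> f /lattice_split [c [c1 _]]; exists c.
- exact: start_vec_word.
- rewrite xop_dirac rank_start /= ltnNge leq_addr /= addKn ffunE /= leq_addr.
  by rewrite W_zeta.
- exact: sublattice_zeta2.
- exact: sublattice_dvd.
Qed.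

End Lattice.

(** * Rows that zigzag along the quiver *)

Section Zigzag.
Variables (e : nat) (o : nat -> bool).
Hypothesis e_ge2 : (2 <= e)%N.
Local Notation I := 'I_e.+1.

(** The letters of a walk on 0, ..., e that starts at 0 and is reflected at both ends. *)
Definition zig (M : nat) : nat := if odd (M %/ e) then (e - M %% e)%N else (M %% e)%N.

Lemma zig_lt M : (zig M < e.+1)%N.
Proof.
have : (M %% e < e)%N by rewrite ltn_mod; lia.
by rewrite /zig; case: ifP => _; move: (M %% e)%N => t; lia.
Qed.

Definition fold M : I := Ordinal (zig_lt M).
Local Arguments fold M%_N.

Lemma divmodE q t M : M = (e * q + t)%N -> (t < e)%N -> (M %/ e = q)%N /\ (M %% e = t)%N.
Proof.
move=> -> te; rewrite mulnC divnMDl ?modnMDl; last by lia.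
by rewrite divn_small // modn_small // addn0.
Qed.

Lemma zigE q t M : M = (e * q + t)%N -> (t < e)%N -> zig M = if odd q then (e - t)%N else t.
Proof. by move=> h te; have [h1 h2] := divmodE h te; rewrite /zig h1 h2. Qed.

Variant divmodS_spec M : nat -> nat -> Prop :=
| DivmodIn of ((M %% e).+1 < e)%N : divmodS_spec M (M %/ e) (M %% e).+1
| DivmodEnd of (M %% e).+1 = e : divmodS_spec M (M %/ e).+1 0%N.

Lemma divmodSP M : divmodS_spec M (M.+1 %/ e) (M.+1 %% e).
Proof.
have me : (M %% e < e)%N by rewrite ltn_mod; lia.
have ME := divn_eq M e.
have [h|h] := ltnP (M %% e).+1 e.
  have EM : M.+1 = (e * (M %/ e) + (M %% e).+1)%N by rewrite {1}ME mulnC addnS.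
  by have [-> ->] := divmodE EM h; constructor.
have EM : M.+1 = (e * (M %/ e).+1 + 0)%N.
  by rewrite {1}ME mulnC addn0 mulnS -addnS; move: me h; set t := (M %% e)%N; lia.
by have [|-> ->] := divmodE EM; [lia | constructor; lia].
Qed.

Lemma zig_adj M : adjacent (fold M) (fold M.+1).
Proof.
rewrite /adjacent /= /zig; have : (M %% e < e)%N by rewrite ltn_mod; lia.
case: (divmodSP M); move: (M %% e)%N (M %/ e)%N => t q /=; case: (odd q) => /=; lia.
Qed.

Lemma zig_ne M : fold M != fold M.+1.
Proof. exact: adjacent_neq (zig_adj M). Qed.

Lemma zig_long M : (M %% e = 0)%N -> double_arrow e (fold M) (fold M.+1).
Proof.
rewrite /double_arrow /= /zig; case: (divmodSP M); move: (M %% e)%N (M %/ e)%N => t q /=;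
 case: (odd q) => /=; lia.
Qed.

Lemma zig_longS M : (M.+1 %% e = 0)%N -> double_arrow e (fold M.+1) (fold M).
Proof.
rewrite /double_arrow /= /zig; case: (divmodSP M); move: (M %% e)%N (M %/ e)%N => t q /=;
 case: (odd q) => /=; lia.
Qed.

Lemma zig_short M : (M %% e != 0)%N -> (M.+1 %% e != 0)%N ->
  double_arrow e (fold M) (fold M.+1) = false /\ double_arrow e (fold M.+1) (fold M) = false.
Proof.
rewrite /double_arrow /= /zig; have : (M %% e < e)%N by rewrite ltn_mod; lia.
case: (divmodSP M); move: (M %% e)%N (M %/ e)%N => t q /=;
 case: (odd q) => /=; split; lia.
Qed.

Lemma zig_turn M : fold M = fold M.+2 -> (M.+1 %% e = 0)%N.
Proof.
move=> /(congr1 val) /=; rewrite /zig; case: (divmodSP M.+1); case: (divmodSP M);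
 move: (M %% e)%N (M %/ e)%N => t q /=; case: (odd q) => /=; lia.
Qed.

Variable K : fieldType.

(** Eigenvalues for the walk. Along a single edge Q asks for equal values, at a long
    vertex for the square of the neighbouring ones, and the divided difference at the
    reflection asks for opposite values before and after it. *)
Definition zval M : {poly K} := if (M %% e == 0)%N then 'X ^+ 2 else (-1) ^+ (M %/ e) * 'X.

Local Arguments zval M%_N.

Lemma zval_X M : exists g, zval M = 'X * g.
Proof.
rewrite /zval; case: ifP => _; first by exists 'X; rewrite expr2.
by exists ((-1) ^+ (M %/ e)); rewrite mulrC.
Qed.

Lemma zval_neq0 M : zval M != 0.
Proof.
rewrite /zval; case: ifP => _; first by rewrite expf_neq0 // polyX_eq0.
by rewrite mulf_neq0 ?polyX_eq0 // signr_eq0.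
Qed.

Lemma zval_ndvd M : ~~ (zval M ^+ 2 %| zval M).
Proof.
apply/negP; rewrite expr2 -{3}[zval M]mulr1 dvdp_mul2l ?zval_neq0 //.
have [g ->] := zval_X M; move/(dvdp_trans (dvdp_mulr g (dvdpp 'X))).
by rewrite -['X]subr0 -polyC0 dvdp_XsubCl /root hornerC oner_eq0.
Qed.

Lemma zval_short_sq M : (M %% e != 0)%N -> zval M ^+ 2 = 'X ^+ 2.
Proof. by rewrite /zval => /negPf ->; rewrite exprMn sqrr_sign mul1r. Qed.

Lemma zval_row M : evQ o (fold M) (fold M.+1) (zval M) (zval M.+1) = 0.
Proof.
have [lM|sM] := eqVneq (M %% e)%N 0%N.
  have := zig_long lM; case: (edgeP o e_ge2 (zig_adj M)) => // hQ _ _ _ _.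
  rewrite hQ zval_short_sq ?/zval ?lM ?subrr //.
  case: (divmodSP M) => //; lia.
have [lM|sM1] := eqVneq (M.+1 %% e)%N 0%N.
  have := zig_longS lM; case: (edgeP o e_ge2 (zig_adj M)) => // hQ _ _ _ _.
  by rewrite hQ zval_short_sq // /zval lM subrr.
have zz : zval M = zval M.+1.
  rewrite /zval (negPf sM) (negPf sM1); case: (divmodSP M) sM1 => // _ _.
have [s1 s2] := zig_short sM sM1.
case: (edgeP o e_ge2 (zig_adj M)) s1 s2 => // hQ _ _ _ _ _; by rewrite hQ zz subrr.
Qed.

Lemma edge_long (b c : I) : double_arrow e c b -> forall (B : pzRingType) (w u v : B),
  evD o b c w u v = - (w + u).
Proof.
move=> d; have adj : adjacent b c by rewrite adjacent_sym; exact: double_adjacent.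
by case: (edgeP o e_ge2 adj) d.
Qed.

Lemma edge0_dvd (b c : I) (B : comPzRingType) (x : B) : adjacent b c ->
  exists g, evQ o b c 0 x = x * g.
Proof.
move=> adj; case: (edgeP o e_ge2 adj) => h _ _ _; rewrite h.
- by exists (-1); rewrite mulrN1 sub0r.
- by exists 1; rewrite mulr1 subr0.
- by exists (- x); rewrite mulrN sub0r expr2.
- by exists 1; rewrite mulr1 expr0n subr0.
Qed.

Lemma zval_turn M : fold M = fold M.+2 ->
  evD o (fold M) (fold M.+1) (zval M.+2) (zval M) (zval M.+1) = 0.
Proof.
move/zig_turn => l; rewrite edge_long ?zig_longS //.
rewrite /zval; move: l; case: (divmodSP M.+1) => [l1|l1] l; last by lia.
rewrite l; case: (divmodSP M) l => //= l2 _.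
have -> : (M %% e == 0)%N = false by lia.
by rewrite exprS mulN1r mulNr addNr oppr0.
Qed.

(** Row A starts at step N of the walk with eigenvalues 0, row B at step N + k with the
    eigenvalues zval. As zeta one takes the eigenvalue of an interior letter of row B if
    one of its first n - k letters is interior, and of its only letter otherwise. *)
Theorem zigzag_not_semisimple (n N k : nat) (hook : bool) (Lam : {ffun I -> nat})
    (n_gt0 : (0 < n)%N) :
  (k < n)%N -> (forall r, (r < k)%N -> fold (N + r) != fold (N + k)) ->
  (hook -> [/\ (1 < k)%N, adjacent (fold N) (fold (N + k)), fold N.+1 != fold (N + k).+1
     & fold N = fold (N + k).+1 -> ((N + k) %% e = 0)%N]) ->
  (k = 0%N -> (2 <= Lam (fold N))%N \/ [/\ (N %% e = 0)%N, (1 < n)%N & (0 < Lam (fold N))%N]) ->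
  ((0 < k)%N -> (0 < Lam (fold N))%N) ->
  ((0 < k)%N -> ~~ hook -> (0 < Lam (fold (N + k)))%N) ->
  ~ semisimple_ring (cyclotomic_quiver_hecke (@QC1 e o K) Lam n_gt0).
Proof.
move=> kn LB hk c0 cA cB.
pose L (c : bool) r := fold (if c then (N + k + r)%N else (N + r)%N).
pose W (c : bool) r : {poly K} := if c then zval (N + k + r) else 0.
pose iota : {rmorphism {poly K} -> {fraction {poly K}}} := @tofrac {poly K}.
have iI : injective iota by move=> x y /eqP; rewrite tofrac_eq => /eqP.
pose long := ((N + k) %% e == 0)%N && (k.+1 < n)%N.
pose r0 : nat := long.
pose zeta := W true r0.
have z0 : exists g, W true 0%N = zeta * g.
  rewrite /zeta /r0 /W addn0; case: (boolP long) => [/andP[/eqP l _]|_] /=; last first.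
    by exists 1; rewrite addn0 mulr1.
  exists (zval (N + k + 1)); rewrite -expr2 zval_short_sq ?addn1 /zval ?l //.
  by case: (divmodSP (N + k)) => //; rewrite l; lia.
have z1 : ((N + k) %% e = 0)%N -> (k.+1 < n)%N -> zeta = W true 1%N.
  by move=> l kn1; rewrite /zeta /r0 /long l eqxx kn1.
have inO_Q (b c : I) : adjacent b c -> zeta_multiple iota zeta (evQ o b c (iota (W false 0%N)) (iota (W true 0%N))).
  move=> adj; have [g gE] := edge0_dvd (W true 0%N) adj; have [h hE] := z0.
  by exists (h * g); rewrite mulrA -hE -gE evQ_rmorph.
have inO_D (b c : I) : double_arrow e c b -> ((N + k) %% e = 0)%N -> (k.+1 < n)%N ->
    zeta_multiple iota zeta (evD o b c (iota (W true 1%N)) (iota (W false 0%N)) (iota (W true 0%N))).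
  move=> d l kn1; exists (-1); rewrite mulrN1 rmorphN edge_long // (z1 l kn1).
  by rewrite rmorph0 addr0.
apply: (@seminormal_not_semisimple K n e o e_ge2 _ iota L W _ _ _ _ k (ltnW kn) _
  zeta hook n_gt0 _ _ _ _ _ _ Lam _ _ _ iI _ r0 _ erefl).
- by move=> [] r; rewrite /L /= addnS zig_ne.
- move=> [] r; rewrite /L /= /W /= addnS -evQ_rmorph.
    by rewrite zval_row rmorph0.
  have [g ->] := edge0_dvd (0 : {poly K}) (zig_adj (N + r)).
  by rewrite mul0r rmorph0.
- move=> [] r; rewrite /L /= /W /= !addnS => h; rewrite -evD_rmorph.
    by rewrite zval_turn // rmorph0.
  by rewrite edge_long ?zig_longS ?zig_turn // addr0 oppr0 rmorph0.
- move=> [] r t _; rewrite /W /= rmorph0 1?eq_sym -(rmorph0 iota) (inj_eq iI) ?zval_neq0 //.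
  by rewrite eq_sym zval_neq0.
- by move=> r rk; rewrite /L /= addn0 LB.
- move=> k0 _; apply: inO_Q; rewrite /L /= addn0.
  by have := zig_adj (N + k.-1); rewrite -addnS prednK.
- move=> k0 kn1 LE; have l : ((N + k) %% e = 0)%N.
    have := @zig_turn (N + k.-1); rewrite -!addnS prednK //; apply.
    by move: LE; rewrite /L /= addn1 addnS.
  apply: inO_D => //; rewrite /L /= addn0.
  by have := @zig_longS (N + k.-1); rewrite -addnS prednK //; apply.
- by move/hk => [-> _ _ _].
- by move/hk => [_ adj _ _]; apply: inO_Q; rewrite /L /= !addn0.
- by move/hk => [_ _ ne _]; rewrite /L /= !addn1.
- move/hk => [_ _ _ hE] kn1 LE.
  have LE' : fold N = fold (N + k).+1 by move: LE; rewrite /L /= addn0 addn1.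
  have l := hE LE'; apply: inO_D => //.
  have -> : L true 0%N = fold (N + k) by rewrite /L addn0.
  have -> : L false 0%N = fold N by rewrite /L addn0.
  by rewrite LE' zig_long.
- move=> k0; have [h hE] := z0.
  have NE : L true 0%N = fold N by rewrite /L /= k0 !addn0.
  rewrite NE; case: (c0 k0) => [L2|[l n1 L1]].
    exists (h ^+ 2 * W true 0%N ^+ (Lam (fold N) - 2)).
    by rewrite mulrA -exprMn -hE -exprD subnKC.
  have {}l : ((N + k) %% e = 0)%N by rewrite k0 addn0.
  exists (W true 0%N ^+ (Lam (fold N)).-1); rewrite (z1 l) ?k0 //.
  rewrite -[in LHS](prednK L1) exprS; congr (_ * _).
  rewrite /W addn0 /= addn1 zval_short_sq ?{1}/zval ?l //.
  by case: (divmodSP (N + k)) => //; rewrite l; lia.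
- move=> k0; split=> //; have -> : L false 0%N = fold N by rewrite /L addn0.
  exact: cA.
- move=> k0 nh; have := cB k0 nh; have -> : L true 0%N = fold (N + k) by rewrite /L addn0.
  have [h hE] := z0; case: (Lam _) => // j _.
  by exists (h * W true 0%N ^+ j); rewrite exprS {1}hE mulrA.
- exact: zval_ndvd.
- by rewrite /r0 /long; case: (boolP (_ && _)) => [/andP[_ h]|_] /=; rewrite ?addn1 ?addn0.
Qed.

End Zigzag.

(** * The two conditions are necessary *)

Section Converse.
Variables (K : fieldType) (e n : nat) (o : nat -> bool) (Lam : {ffun 'I_e.+1 -> nat}).
Hypothesis e_ge2 : (2 <= e)%N.
Hypothesis n_gt0 : (0 < n)%N.
Local Notation R := (cyclotomic_quiver_hecke (@QC1 e o K) Lam n_gt0).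
Implicit Types c d : 'I_e.+1.

Lemma fold_ord q t M c : M = (e * q + t)%N -> (t < e)%N ->
  (c : nat) = (if odd q then (e - t)%N else t) -> fold e_ge2 M = c.
Proof. by move=> ME te cE; apply: val_inj; rewrite /= (zigE e_ge2 ME te) cE. Qed.

Lemma fold_id c : fold e_ge2 c = c.
Proof.
have := ltn_ord c; rewrite ltnS leq_eqVlt => /orP[/eqP ce|ce].
  by apply: (@fold_ord 1 0); rewrite /= ?ce ?subn0 //; lia.
by apply: (@fold_ord 0 c) => //; lia.
Qed.

(** Row A is empty: its word has a nonzero dot of square zero. *)
Lemma not_semisimple_repeated c : (2 <= Lam c)%N -> ~ semisimple_ring R.
Proof.
move=> L2; apply: (@zigzag_not_semisimple e o e_ge2 K n c 0 false) => //.
by left; rewrite fold_id.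
Qed.

(** Row A is empty. The eigenvalue of the first dot is the square of that of the second
    one, so that the second dot is still nonzero when the first one is killed. *)
Lemma not_semisimple_end c : (0 < Lam c)%N -> (1 < n)%N -> (c == 0%N :> nat) || (c == e :> nat) ->
  ~ semisimple_ring R.
Proof.
move=> L1 n1 ce; apply: (@zigzag_not_semisimple e o e_ge2 K n c 0 false) => //.
right; rewrite fold_id; split=> //.
by case/orP: ce => /eqP ->; rewrite ?mod0n ?modnn.
Qed.

(** Row A walks from c to d - 1, and row B starts at d. *)
Lemma not_semisimple_gap c d : (0 < Lam c)%N -> (0 < Lam d)%N ->
  (0 < c)%N -> (c < d)%N -> (d < e)%N -> (d < c + n)%N -> ~ semisimple_ring R.
Proof.
move=> Lc Ld c0 cd de dcn.
have dE : (c + (d - c) = d)%N by lia.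
apply: (@zigzag_not_semisimple e o e_ge2 K n c (d - c) false); rewrite ?dE ?fold_id //.
- lia.
- move=> r rk; apply/eqP => /(congr1 val); rewrite /= (@zigE e e_ge2 0 (c + r)%N) //=; lia.
- lia.
Qed.

(** Row A walks from c to 0 and back to c, and row B goes on from c + 1. *)
Lemma not_semisimple_left c : (0 < Lam c)%N -> (0 < c < e)%N -> (c.*2.+1 < n)%N ->
  ~ semisimple_ring R.
Proof.
move=> Lc /andP[c0 ce] cn; pose N := (e.*2 - c)%N; pose k := c.*2.+1.
have NE : fold e_ge2 N = c by apply: (@fold_ord 1 (e - c)); rewrite /N /=; lia.
have zk : zig e (N + k) = c.+1.
  have [h|h] := ltnP c.+1 e.
    by rewrite (@zigE e e_ge2 2 c.+1) // /N /k; lia.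
  by rewrite (@zigE e e_ge2 3 0) /N /k /=; lia.
apply: (@zigzag_not_semisimple e o e_ge2 K n N k true) => //; rewrite ?NE //.
- move=> r rk; apply/eqP => /(congr1 val); rewrite /= zk.
  have [h|h] := ltnP r c.
    by rewrite (@zigE e e_ge2 1 (e - c + r)) /N /=; lia.
  by rewrite (@zigE e e_ge2 2 (r - c)) /N /=; move: rk; rewrite /k; lia.
- move=> _; split.
  + by rewrite /k; lia.
  + by rewrite /adjacent /= zk eqxx orbT.
  + apply/eqP => /(congr1 val) /=.
    have -> : zig e N.+1 = c.-1.
      have [h|h] := ltnP 1 c.
        by rewrite (@zigE e e_ge2 1 (e - c).+1) /N /=; lia.
      by rewrite (@zigE e e_ge2 2 0) /N /=; lia.
    have [h|h] := ltnP c.+2 e.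
      by rewrite (@zigE e e_ge2 2 c.+2) /N /k /=; lia.
    have [h'|h'] := ltnP c.+1 e.
      by rewrite (@zigE e e_ge2 3 0) /N /k /=; lia.
    by rewrite (@zigE e e_ge2 3 1) /N /k /=; lia.
  + have [h|h] := ltnP c.+1 e; last first.
      by move=> _; have [||_ ->] := @divmodE e e_ge2 3 0 (N + k); rewrite /N /k; lia.
    move=> /(congr1 val) /=.
    have [h'|h'] := ltnP c.+2 e.
      by rewrite (@zigE e e_ge2 2 c.+2) /N /k /=; lia.
    by rewrite (@zigE e e_ge2 3 0) /N /k /=; lia.
Qed.

(** Row A walks from c to e and back to c, and row B goes on from c - 1. *)
Lemma not_semisimple_right c : (0 < Lam c)%N -> (0 < c < e)%N -> ((e - c).*2.+1 < n)%N ->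
  ~ semisimple_ring R.
Proof.
move=> Lc /andP[c0 ce] cn; pose k := (e - c).*2.+1.
have zk : zig e (c + k) = c.-1.
  have [h|h] := ltnP 1 c.
    by rewrite (@zigE e e_ge2 1 (e - c).+1) // /k /=; lia.
  by rewrite (@zigE e e_ge2 2 0) /k /=; lia.
apply: (@zigzag_not_semisimple e o e_ge2 K n c k true) => //; rewrite ?fold_id //.
- move=> r rk; apply/eqP => /(congr1 val); rewrite /= zk.
  have [h|h] := ltnP (c + r) e.
    by rewrite (@zigE e e_ge2 0 (c + r)) /=; lia.
  by rewrite (@zigE e e_ge2 1 (c + r - e)) /=; move: rk; rewrite /k; lia.
- move=> _; split.
  + by rewrite /k; lia.
  + by rewrite /adjacent /= zk prednK // eqxx.
  + apply/eqP => /(congr1 val) /=.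
    have -> : zig e c.+1 = c.+1.
      have [h|h] := ltnP c.+1 e.
        by rewrite (@zigE e e_ge2 0 c.+1) /=; lia.
      by rewrite (@zigE e e_ge2 1 0) /=; lia.
    have [h|h] := ltnP 2 c.
      by rewrite (@zigE e e_ge2 1 (e - c).+2) /k /=; lia.
    have [h'|h'] := ltnP 1 c.
      by rewrite (@zigE e e_ge2 2 0) /k /=; lia.
    by rewrite (@zigE e e_ge2 2 1) /k /=; lia.
  + have [h|h] := ltnP 1 c; last first.
      by move=> _; have [||_ ->] := @divmodE e e_ge2 2 0 (c + k); rewrite /k; lia.
    move=> /(congr1 val) /=.
    have [h'|h'] := ltnP 2 c.
      by rewrite (@zigE e e_ge2 1 (e - c).+2) /k /=; lia.
    by rewrite (@zigE e e_ge2 2 0) /k /=; lia.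
Qed.

End Converse.

Section Weight.
Variables (e m : nat) (i : 'I_m -> 'I_e.+1).
Local Notation Lam := (\sum_(s < m) fundamental_weight (i s) : {ffun 'I_e.+1 -> nat}).

Lemma weight_gt0 s : (0 < Lam (i s))%N.
Proof. by rewrite sum_ffunE (bigD1 s) //= ffunE eqxx. Qed.

Lemma weight_ge2 s t : s != t -> i s = i t -> (2 <= Lam (i s))%N.
Proof.
move=> st it; rewrite sum_ffunE (bigD1 s) //= (bigD1 t) /=; last by rewrite eq_sym.
by rewrite !ffunE it eqxx.
Qed.

End Weight.

Section Bounds.
Variable R : realFieldType.

Lemma half_bounds (n e c : nat) :
  ((n%:R - 1) / 2 <= c%:R :> R <-> (n <= c.*2.+1)%N) /\
  (c%:R <= e%:R - (n%:R - 1) / 2 :> R <-> (n + c.*2 <= e.*2.+1)%N).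
Proof.
have -> : (n <= c.*2.+1)%N = (n%:R <= c%:R * 2 + 1 :> R).
  by rewrite -muln2 -natrM -[1]/(1%:R) -natrD ler_nat addn1.
have -> : (n + c.*2 <= e.*2.+1)%N = (n%:R + c%:R * 2 <= e%:R * 2 + 1 :> R).
  by rewrite -!muln2 -!natrM -[1]/(1%:R) -!natrD ler_nat addn1.
move: (n%:R : R) (c%:R : R) (e%:R : R) => x y z; split; split; lra.
Qed.

Lemma nat_dist_le (n c d : nat) :
  (n%:R <= `|c%:R - d%:R| :> R) = (c + n <= d)%N || (d + n <= c)%N.
Proof.
rewrite ler_normr orbC opprB; congr (_ || _);
  by rewrite lerBrDl -natrD ler_nat.
Qed.

End Bounds.

Theorem corollary8p7 (K : closedFieldType) (e n m : nat) (o : nat -> bool)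
    (i : 'I_m -> 'I_e.+1)
    (e_ge2 : (2 <= e)%N) (n_gt0 : (0 < n)%N) (m_gt0 : (0 < m)%N)
    (charK_neq2 : 2%N \notin [pchar K])
    (charK_ndvd : forall p : nat, p \in [pchar K] -> ~~ (p %| e)%N) :
  semisimple_ring
    (cyclotomic_quiver_hecke (@QC1 e o K)
       (\sum_(s < m) fundamental_weight (i s)) n_gt0)
  <->
  (forall s : 'I_m,
     (n%:R - 1) / 2 <= (i s)%:R :> rat /\
     (i s)%:R <= e%:R - (n%:R - 1) / 2 :> rat) /\
  (forall s1 s2 : 'I_m, s1 != s2 ->
     n%:R <= `|(i s1)%:R - (i s2)%:R| :> rat).
Proof.
have half := half_bounds rat n e; have dist := nat_dist_le rat n.
split=> [ss|[edge gap]]; last first.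
  apply: cyclotomic_semisimple => // [s|s t st].
    by have [h1 h2] := half (i s); have [/h1 h3 /h2 h4] := edge s.
  by rewrite -dist gap.
have L1 := weight_gt0 i; split=> [s|s t st].
  suff [h1 h2] : (n <= (i s).*2.+1)%N /\ (n + (i s).*2 <= e.*2.+1)%N.
    by have [h3 h4] := half (i s); split; [apply/h3|apply/h4].
  have [//|bad] := boolP ((n <= (i s).*2.+1)%N && (n + (i s).*2 <= e.*2.+1)%N).
    by move/andP.
  have ie := ltn_ord (i s); exfalso.
  have [end_|/norP[n0 ne]] := boolP ((i s == 0%N :> nat) || (i s == e :> nat)).
    by case: (not_semisimple_end e_ge2 (L1 s) _ end_ ss); lia.
  have [h|h] := ltnP (i s).*2.+1 n.
    by case: (not_semisimple_left e_ge2 (L1 s) _ h ss); lia.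
  by case: (not_semisimple_right e_ge2 (L1 s) _ _ ss); lia.
have close : (i s < i t + n)%N -> (i t < i s + n)%N -> False.
  wlog le : s t st / (i s <= i t)%N.
    have [le|/ltnW le] := leqP (i s) (i t); first by move=> H; apply: (H s t).
    by move=> H h1 h2; apply: (H t s); rewrite // eq_sym.
  move=> _ h; move: le; rewrite leq_eqVlt => /orP[/eqP/val_inj it|lt].
    exact: (not_semisimple_repeated e_ge2 (weight_ge2 st it) ss).
  have n1 : (1 < n)%N by lia.
  have et := ltn_ord (i t).
  have [s0|s0] := posnP (i s).
    by apply: (not_semisimple_end e_ge2 (L1 s) n1 _ ss); rewrite s0.
  have [te|te] := eqVneq (i t : nat) e.
    by apply: (not_semisimple_end e_ge2 (L1 t) n1 _ ss); rewrite te eqxx orbT.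
  by apply: (not_semisimple_gap e_ge2 (L1 s) (L1 t) s0 lt _ h ss); lia.
by rewrite dist; apply: contraT; rewrite negb_or -!ltnNge => /andP[h1 h2]; case: close.
Qed.
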